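(* Let $g:\mathcal X\times\mathcal Y\to\mathbb R$ be three times continuously differentiable and a parametric Morse--Bott function. Let $(x_0,y_0)\in\mathcal M$ be an augmented critical point of $g$. Denote by $\mathcal K$ the null space of the Hessian $A_0:=\partial^2_{yy}g(x_0,y_0)$ and by $\mathcal K^{\perp}$ its orthogonal complement in $\mathcal Y$. Let $J_0$ be a diagonal matrix whose diagonal elements are the signs of the non-zero eigenvalues of $A_0$ (counted with multiplicity), acting on $\mathcal K^\perp$. Then there exist open neighborhoods $\mathcal U$ of $(x_0,0_{\mathcal K},0_{\mathcal K^\perp})$ in $\mathcal X\times\mathcal K\times\mathcal K^\perp$ and $\mathcal V$ of $(x_0,y_0)$ in $\mathcal X\times\mathcal Y$, and a diffeomorphism $\psi:\mathcal U\to\mathcal V$ preserving the first variable (i.e. for every $(x,r,w)\in\mathcal U$, $\psi(x,r,w)=(x,y)$ for some $y\in\mathcal Y$), with $\psi(x_0,0_{\mathcal K},0_{\mathcal K^\perp})=(x_0,y_0)$, such that $$g(\psi(x,r,w))=g(\psi(x,0_{\mathcal K},0_{\mathcal K^\perp}))+\tfrac12 w^\top J_0 w\qquad\text{for all }(x,r,w)\in\mathcal U.$$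
   Context: $\mathcal X=\mathbb R^p$ and $\mathcal Y=\mathbb R^d$ with $p,d$ positive integers. $\partial_y g$ is the gradient and $\partial^2_{yy}g$ the Hessian of $g$ in the second variable. The set of augmented critical points of $g$ is $\mathcal M:=\{(x,y)\in\mathcal X\times\mathcal Y : \partial_y g(x,y)=0\}$. A twice continuously differentiable function $g:\mathcal X\times\mathcal Y\to\mathbb R$ is a parametric Morse--Bott function if for every $(x_0,y_0)\in\mathcal M$ there is an open neighborhood $\mathcal V$ of $(x_0,y_0)$ such that $\mathcal M\cap\mathcal V$ is a connected $C^2$ sub-manifold of $\mathcal X\times\mathcal Y$ of dimension $\dim(\mathcal X)+\dim\mathrm{Ker}(\partial^2_{yy}g(x_0,y_0))$. The space $\mathcal K^\perp$ (of dimension $\mathrm{rank}(A_0)$) is identified with $\mathbb R^{\mathrm{rank}(A_0)}$ through an orthonormal basis, so that $w^\top J_0 w$ makes sense. A diffeomorphism is a continuously differentiable bijection with continuously differentiable inverse. *)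

(* Defs.v *)
From HB Require Import structures.
From mathcomp Require Import all_boot all_order all_algebra.
From mathcomp Require Import all_classical all_reals all_analysis.

Set Implicit Arguments.
Unset Strict Implicit.
Unset Printing Implicit Defensive.

Import Order.TTheory GRing.Theory Num.Theory.
Import numFieldNormedType.Exports.

Local Open Scope classical_set_scope.
Local Open Scope ring_scope.

(* The spaces V and W below are always finite dimensional, where continuity of
   every directional derivative amounts to continuity of the differential. *)
Fixpoint Ck (R : realType) (V W : normedModType R) (k : nat)
    (O : set V) (f : V -> W) : Prop :=
  if k is k'.+1 then
    (forall z, O z -> differentiable f z) /\
    (forall v : V, Ck k' O (fun z => 'D_v f z : W))
  else forall z, O z -> {for z, continuous f}.

(* On an arbitrary subset S of V, f is C^k when it has local C^k extensions.
   If S is open this is Ck k S f; if S is relatively open in a linear subspace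
   E of V it is the intrinsic notion on E (extend along a projection). *)
Definition Ck_on (R : realType) (V W : normedModType R) (k : nat)
    (S : set V) (f : V -> W) : Prop :=
  forall z, S z -> exists (O : set V) (F : V -> W),
    [/\ open_nbhs z O, Ck k O F & forall v, O v -> S v -> f v = F v].

Definition diffeomorphism (R : realType) (V W : normedModType R) (k : nat)
    (S : set V) (T : set W) (f : V -> W) : Prop :=
  [/\ set_bij S T f, Ck_on k S f &
      exists2 h : W -> V, (forall z, S z -> h (f z) = z) & Ck_on k T h].

(* Slice charts; the codimension c is forced by m + c = dim V. *)
Definition submanifold (R : realType) (V : normedModType R) (k m : nat)
    (S : set V) : Prop :=
  forall z, S z ->
    exists (c : nat) (O : set V) (O' : set ('rV[R]_m * 'rV[R]_c))
           (phi : V -> 'rV[R]_m * 'rV[R]_c),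
      [/\ open_nbhs z O, open O', diffeomorphism k O O' phi &
          forall v, O v -> (S v <-> (phi v).2 = 0)].

Definition relatively_open (T : topologicalType) (E U : set T) : Prop :=
  exists2 O : set T, open O & U = O `&` E.

Definition grad_y (R : realType) (p d : nat) (g : 'rV[R]_p * 'rV[R]_d -> R)
    (z : 'rV[R]_p * 'rV[R]_d) : 'rV[R]_d :=
  \row_(j < d) 'D_(delta_mx 0 j) (fun y : 'rV[R]_d => g (z.1, y)) z.2.

(* Vectors are rows, so u *m hess_yy g z is the derivative of the gradient
   in the direction u, and kermx (hess_yy g z) spans the null space. *)
Definition hess_yy (R : realType) (p d : nat) (g : 'rV[R]_p * 'rV[R]_d -> R)
    (z : 'rV[R]_p * 'rV[R]_d) : 'M[R]_d :=
  jacobian (fun y : 'rV[R]_d => grad_y g (z.1, y)) z.2.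

Definition aug_crit (R : realType) (p d : nat) (g : 'rV[R]_p * 'rV[R]_d -> R) :
    set ('rV[R]_p * 'rV[R]_d) :=
  [set z | grad_y g z = 0].

Definition parametric_morse_bott (R : realType) (p d : nat)
    (g : 'rV[R]_p * 'rV[R]_d -> R) : Prop :=
  Ck 2 [set: 'rV[R]_p * 'rV[R]_d] g /\
  forall z0, aug_crit g z0 -> exists V : set ('rV[R]_p * 'rV[R]_d),
    [/\ open_nbhs z0 V, connected (aug_crit g `&` V) &
        submanifold 2 (p + \rank (kermx (hess_yy g z0)))%N
                    (aug_crit g `&` V)].

Definition orthocomp (R : realType) (d m : nat) (K : 'M[R]_(m, d)) : 'M[R]_d :=
  orthomx idfun 1%:M K.

Definition orthonormal_basis (R : realType) (d m n : nat)
    (B : 'M[R]_(n, d)) (E : 'M[R]_(m, d)) : Prop :=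
  B *m B^T = 1%:M /\ (B :=: E)%MS.

(* J is diag(sg lam_1, ..., sg lam_n), where lam lists in some order the
   non-zero eigenvalues of A with their multiplicities. *)
Definition eigen_sign_mx (R : realType) (d n : nat) (A : 'M[R]_d)
    (J : 'M[R]_n) : Prop :=
  exists lam : 'rV[R]_n,
    [/\ forall i, lam 0 i != 0,
        forall a : R, a != 0 -> #|[set i | lam 0 i == a]%SET| = mup a (char_poly A)
      & J = diag_mx (map_mx Num.sg lam)].

Definition quad_form (R : realType) (n : nat) (J : 'M[R]_n) (c : 'rV[R]_n) : R :=
  (c *m J *m c^T) 0 0.

(* Main.v *)
Require Import Defs.
From HB Require Import structures.
From mathcomp Require Import all_boot all_order all_algebra.
From mathcomp Require Import all_classical all_reals all_analysis.
From mathcomp Require Import ring lra.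
Import Order.TTheory GRing.Theory Num.Theory.
Import numFieldNormedType.Exports.
Set Implicit Arguments.
Unset Strict Implicit.
Unset Printing Implicit Defensive.
Local Open Scope classical_set_scope.
Local Open Scope ring_scope.

(** Write y = y0 + r + s with r in the null space K of A0 and s in its orthocomplement.
    As A0 is invertible on the orthocomplement, the s-part of the gradient vanishes,
    near (x0, y0), exactly on the graph of a C^1 map s = sigma(x, r): the critical
    set M is locally contained in that graph (critical_in_graph). The Morse-Bott
    hypothesis gives M the dimension p + dim K of the graph, hence M locally equals it
    (graph_in_critical): read in the coordinates (x, r), a slice chart becomes a map
    of R^(p + dim K) to itself with invertible derivative. The whole gradient
    in y then vanishes along the graph, so that g, restricted to it, does not depend on r
    (value_on_graph).

    There remains a Morse lemma with parameter z = (x, r) for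
    k(z, s) = g(graph point + s) - g(graph point), whose s-gradient is 0 at s = 0 and
    whose s-Hessian A(z) there is of class C^1 (parametric_morse). In a basis given by
    the real spectral theorem (sign_congruence), A is J0 at the base point, and
    A(z) = Y(z) J0 Y(z)^T for a C^1 matrix Y(z) close to 1 (symmetric_sqrt). With u = s Y(z),
    the new variable is sought in the form w = u + a (u J0) with a scalar a, and
    w J0 w^T = 2 k becomes a quadratic equation in a, solved by an explicit
    formula. Its coefficients are quotients by |u|^2, singular at s = 0, but the
    Taylor remainder 2 k - s A s^T is so flat there that a (u J0) is still of
    class C^1 (flat_remainder, flat_quotient, sdiff_correction). The map (z, s) |-> (z, w) has derivative the identity at the base
    point, and its local inverse (local_inverse) is the required diffeomorphism, up to
    linear coordinates.

    All these maps are handled through strict derivatives,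
    f(a) - f(b) = L(a - b) + o(|a - b|) for a and b near p. On an open set they
    amount to being of class C^1 (Ck1_sdiff, sdiff_Ck1), and they reduce the delicate
    points s = 0 to estimates on differences. *)

(** * Strict derivatives *)

(** Strict differentiability at a point. On an open set it is the same as being of
    class C^1, but it speaks of a single point: it composes without any
    continuity argument on derivatives, it is what the contraction argument of
    the inverse function theorem consumes, and it can be checked where no formula
    for the derivative is available nearby. *)
Definition sdiff {R : realType} {V W : normedModType R} (f : V -> W) (p : V)
    (L : V -> W) : Prop :=
  [/\ linear L, exists C : R, forall v, `|L v| <= C * `|v|
    & forall e : R, 0 < e -> \forall q \near (p, p),
        `|f q.1 - f q.2 - L (q.1 - q.2)| <= e * `|q.1 - q.2|].

Definition sdifferentiable {R : realType} {V W : normedModType R} (f : V -> W) (p : V) :=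
  exists L, sdiff f p L.

Lemma near_fst {T U : topologicalType} (p : T) (r : U) (P : T -> Prop) :
  (\forall a \near p, P a) -> \forall q \near (p, r), P q.1.
Proof. by move=> h; exact: cvg_fst h. Qed.
Lemma near_snd {T U : topologicalType} (p : T) (r : U) (P : U -> Prop) :
  (\forall a \near r, P a) -> \forall q \near (p, r), P q.2.
Proof. by move=> h; exact: cvg_snd h. Qed.

Section sdiff_basic.
Context {R : realType}.

Lemma near_normP {V : normedModType R} (p : V) (P : V -> Prop) :
  (\forall a \near p, P a) <->
  exists2 d : R, 0 < d & forall a, `|a - p| < d -> P a.
Proof.
split.
  move/nbhs_ballP => [d /= d0 h]; exists d => // a ad; apply: h.
  by rewrite -ball_normE /= distrC.
move=> [d d0 h]; apply/nbhs_ballP; exists d => //= a.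
by rewrite -ball_normE /= distrC => /h.
Qed.

Lemma near2_normP {V : normedModType R} (p : V) (P : V * V -> Prop) :
  (\forall q \near (p, p), P q) <->
  exists2 d : R, 0 < d & forall a b, `|a - p| < d -> `|b - p| < d -> P (a, b).
Proof.
rewrite near_normP; split=> -[d d0 h]; exists d => //.
  by move=> a b ha hb; apply: h; rewrite prod_normE /= gt_max ha hb.
by move=> [a b]; rewrite prod_normE /= gt_max => /andP[]; exact: h.
Qed.

Context {V W : normedModType R}.
Implicit Types (f g : V -> W) (p : V) (L : V -> W).

Lemma sdiff_lin0 f p L : sdiff f p L -> L 0 = 0.
Proof. by case=> h _ _; have := h (-1) 0 0; rewrite scaler0 scaleN1r addr0 addNr. Qed.
Lemma sdiff_linD f p L : sdiff f p L -> forall a b, L (a + b) = L a + L b.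
Proof. by case=> h _ _ a b; have := h 1 a b; rewrite !scale1r. Qed.
Lemma sdiff_linZ f p L : sdiff f p L -> forall (c : R) a, L (c *: a) = c *: L a.
Proof. by move=> s c a; case: (s) => h _ _; have := h c a 0; rewrite (sdiff_lin0 s) !addr0. Qed.
Lemma sdiff_linN f p L : sdiff f p L -> forall a, L (- a) = - L a.
Proof. by move=> s a; rewrite -scaleN1r (sdiff_linZ s) scaleN1r. Qed.
Lemma sdiff_linB f p L : sdiff f p L -> forall a b, L (a - b) = L a - L b.
Proof. by move=> s a b; rewrite (sdiff_linD s) (sdiff_linN s). Qed.

Lemma sdiff_bnd f p L : sdiff f p L -> exists2 C : R, 0 < C & forall v, `|L v| <= C * `|v|.
Proof.
case=> _ [C h] _; exists (`|C| + 1) => [|v]; first by rewrite ltr_wpDl.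
by rewrite (le_trans (h v))// ler_wpM2r// (le_trans (ler_norm _))// lerDl.
Qed.

Lemma sdiff_lip f p L : sdiff f p L -> exists2 C : R, 0 < C &
  \forall q \near (p, p), `|f q.1 - f q.2| <= C * `|q.1 - q.2|.
Proof.
move=> s; have [C C0 hC] := sdiff_bnd s; case: s => _ _ /(_ 1 ltr01) h.
exists (C + 1); first by rewrite addr_gt0.
near=> q; rewrite -[X in `|X|](subrK (L (q.1 - q.2))) mulrDl addrC.
rewrite (le_trans (ler_normD _ _))// lerD//.
by near: q.
Unshelve. all: by end_near. Qed.

Lemma sdiff_continuous f p L : sdiff f p L -> {for p, continuous f}.
Proof.
move=> /sdiff_lip[C C0 /near2_normP[d d0 h]].
apply/cvgrPdist_lt => e e0; apply/near_normP.
exists (Num.min d (e / C)); first by rewrite lt_min d0 divr_gt0.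
move=> a; rewrite lt_min => /andP[ad ae]; rewrite distrC.
have := h a p ad; rewrite subrr normr0 => /(_ d0) /= /le_lt_trans; apply.
by rewrite mulrC -ltr_pdivlMr.
Qed.

Lemma near_pair_continuous f p (P : W * W -> Prop) : {for p, continuous f} ->
  (\forall r \near (f p, f p), P r) -> \forall q \near (p, p), P (f q.1, f q.2).
Proof.
move=> fc h.
have : (fun q : V * V => (f q.1, f q.2)) @ (p, p) --> (f p, f p).
  by apply: cvg_pair => A /fc hA; [exact: near_fst hA|exact: near_snd hA].
by apply.
Qed.

Lemma near_pair_comp f p L (P : W * W -> Prop) : sdiff f p L ->
  (\forall r \near (f p, f p), P r) -> \forall q \near (p, p), P (f q.1, f q.2).
Proof. by move=> /sdiff_continuous; exact: near_pair_continuous. Qed.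

Lemma near_sdiff_comp f p L (P : W -> Prop) : sdiff f p L ->
  (\forall r \near f p, P r) -> \forall q \near p, P (f q).
Proof. by move=> /sdiff_continuous; apply. Qed.

Lemma sdiff_near f g p L : (\forall z \near p, f z = g z) ->
  sdiff f p L -> sdiff g p L.
Proof.
move=> fg [lL bL h]; split=> // e e0; near=> q.
have <- : f q.1 = g q.1 by near: q; exact: near_fst fg.
have <- : f q.2 = g q.2 by near: q; exact: near_snd fg.
by near: q; exact: h.
Unshelve. all: by end_near. Qed.

Lemma sdiff_is_derive f p L v : sdiff f p L -> is_derive p v f (L v).
Proof.
move=> s.
suff : h^-1 *: ((f \o shift p) (h *: v) - f p) @[h --> 0^'] --> (L v).
  move=> c; apply: DeriveDef; first by apply/cvg_ex; exists (L v).
  exact: cvg_lim c.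
apply/cvgrPdist_le => e e0.
have [_ _ h] := s.
have e1 : 0 < e / (`|v| + 1) by rewrite divr_gt0// ltr_wpDl.
have /near2_normP[d d0 hd] := h _ e1.
have d1 : 0 < d / (`|v| + 1) by rewrite divr_gt0// ltr_wpDl.
near=> t.
have t0 : t != 0 by near: t; exact: nbhs_dnbhs_neq.
have tv : `|t *: v + p - p| < d.
  rewrite addrK normrZ.
  have : `|t| * (`|v| + 1) < d.
    rewrite -ltr_pdivlMr ?ltr_wpDl//; near: t.
    exact: dnbhs0_lt.
  by apply: le_lt_trans; rewrite ler_wpM2l// lerDl.
have := hd _ p tv; rewrite subrr normr0 addrK => /(_ d0) /= est.
rewrite distrC -[L v](scalerK t0) -(sdiff_linZ s) -scalerBr normrZ normfV.
rewrite mulrC ler_pdivrMr ?normr_gt0// (le_trans est)//.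
rewrite normrZ mulrCA mulrC ler_wpM2r// mulrAC ler_pdivrMr ?ltr_wpDl//.
by rewrite ler_pM2l ?lerDl.
Unshelve. all: by end_near. Qed.


(** The case a = p + v, b = p of the two-point estimate is Frechet differentiability. *)
Lemma sdiff_differentiable f p L : sdiff f p L -> differentiable f p.
Proof.
move=> s; have [lL [C hC] h] := s.
pose Lf : {linear V -> W} := HB.pack L (GRing.isLinear.Build R V W *:%R L lL).
have cL : continuous Lf.
  move=> x; apply: (@sdiff_continuous Lf x L); split=> //; first by exists C.
  by move=> e e0; apply/(@near2_normP V); exists 1 => // a b _ _ /=;
    rewrite -(sdiff_linB s) subrr normr0; rewrite mulr_ge0 ?(ltW e0).
have H : f \o shift p = cst (f p) + Lf +o_ (0 : V) id.
  apply/eqaddoP => e e0.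
  have /near2_normP[d d0 hd] := h _ e0.
  apply/near_normP; exists d => // v; rewrite subr0 => vd.
  have := hd (v + p) p; rewrite addrK subrr normr0 => /(_ vd d0) /=.
  by rewrite !fctE /= opprD addrA.
have dL := diff_unique cL H.
apply/diff_locallyP; split; first by rewrite dL.
by rewrite dL.
Qed.

End sdiff_basic.
(** * Norms of matrices and pairs *)

Section norms.
Context {R : realType}.

Lemma mx_coord_le m n (A : 'M[R]_(m, n)) i j : `|A i j| <= `|A|.
Proof. by rewrite [leRHS]mx_normrE; exact: (le_bigmax _ (fun ij => `|A ij.1 ij.2|) (i, j)). Qed.

Lemma mx_norm_le m n (A : 'M[R]_(m, n)) c : 0 <= c ->
  (forall i j, `|A i j| <= c) -> `|A| <= c.
Proof. by move=> c0 h; rewrite [leLHS]mx_normrE; apply: bigmax_le => // -[]. Qed.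

Lemma norm_mulmx m n l (A : 'M[R]_(m, n)) (B : 'M[R]_(n, l)) :
  `|A *m B| <= n%:R * `|A| * `|B|.
Proof.
apply: mx_norm_le => [|i j]; first by rewrite !mulr_ge0.
rewrite mxE (le_trans (ler_norm_sum _ _ _))//.
rewrite -mulrA mulr_natl -[X in _ *+ X]card_ord -sumr_const ler_sum// => k _.
by rewrite normrM ler_pM// mx_coord_le.
Qed.

Lemma fst_norm_le (V W : normedModType R) (v : V * W) : `|v.1| <= `|v|.
Proof. by rewrite prod_normE le_max lexx. Qed.
Lemma snd_norm_le (V W : normedModType R) (v : V * W) : `|v.2| <= `|v|.
Proof. by rewrite prod_normE le_max lexx orbT. Qed.
Lemma pair_norm_le (V W : normedModType R) (v : V * W) c :
  `|v.1| <= c -> `|v.2| <= c -> `|v| <= c.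
Proof. by move=> h1 h2; rewrite prod_normE ge_max h1. Qed.

End norms.

(** * Calculus of strict derivatives *)

Section sdiff_calculus.
Context {R : realType}.
Implicit Types V W U : normedModType R.

Lemma linear_sub V W (L : V -> W) : linear L -> forall a b, L (a - b) = L a - L b.
Proof. by move=> h a b; have := h (-1) b a; rewrite !scaleN1r ![- _ + _]addrC. Qed.

Lemma sdiff_linear V W (L : V -> W) p : linear L ->
  (exists C : R, forall v, `|L v| <= C * `|v|) -> sdiff L p L.
Proof.
move=> lL bL; split=> // e e0; apply/(@near2_normP _ V); exists 1 => // a b _ _ /=.
by rewrite (linear_sub lL) subrr normr0 mulr_ge0 ?(ltW e0).
Qed.

Lemma sdiff_id V (p : V) : sdiff (fun z => z) p (fun v => v).
Proof. by apply: sdiff_linear => //; exists 1 => v; rewrite mul1r. Qed.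

Lemma sdiff_cst V W (p : V) (c : W) : sdiff (fun=> c) p (fun=> 0).
Proof.
split=> [a u v||e e0]; first by rewrite scaler0 addr0.
  by exists 0 => v; rewrite normr0 mul0r.
apply/(@near2_normP _ V); exists 1 => // a b _ _ /=.
by rewrite !subrr normr0 mulr_ge0 ?(ltW e0).
Qed.

Lemma sdiff_comp V W U (f : V -> W) (g : W -> U) p L M :
  sdiff f p L -> sdiff g (f p) M -> sdiff (fun z => g (f z)) p (fun v => M (L v)).
Proof.
move=> sf sg.
have [C C0 hC] := sdiff_lip sf; have [D D0 hD] := sdiff_bnd sg.
have [D' D'0 hD'] := sdiff_bnd sf.
split.
- by move=> a u v; rewrite (sdiff_linD sf) (sdiff_linZ sf) (sdiff_linD sg) (sdiff_linZ sg).
- by exists (D * D') => v; rewrite (le_trans (hD _))// -mulrA ler_pM2l.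
move=> e e0.
have [_ _ /(_ (e / 2 / D))] := sf; rewrite !divr_gt0// => /(_ isT) hf.
have [_ _ /(_ (e / 2 / C))] := sg; rewrite !divr_gt0// => /(_ isT) hg.
have {}hg := near_pair_comp sf hg.
near=> q.
rewrite (le_trans (ler_distD (M (f q.1 - f q.2)) _ _))// [e]splitr mulrDl lerD//.
  have /le_trans -> // : `|g (f q.1) - g (f q.2) - M (f q.1 - f q.2)|
      <= e / 2 / C * `|f q.1 - f q.2| by near: q.
  rewrite -mulrA ler_pM2l ?divr_gt0// mulrC ler_pdivrMr// mulrC.
  by near: q.
rewrite -(sdiff_linB sg) (le_trans (hD _))// -ler_pdivlMl// mulrA [D^-1 * _]mulrC.
by near: q.
Unshelve. all: by end_near. Qed.

Lemma sdiffD V W (f g : V -> W) p L M : sdiff f p L -> sdiff g p M ->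
  sdiff (fun z => f z + g z) p (fun v => L v + M v).
Proof.
move=> sf sg; split.
- by move=> a u v; rewrite (sdiff_linD sf) (sdiff_linZ sf) (sdiff_linD sg)
    (sdiff_linZ sg) scalerDr addrACA.
- have [C C0 hC] := sdiff_bnd sf; have [D D0 hD] := sdiff_bnd sg.
  by exists (C + D) => v; rewrite mulrDl (le_trans (ler_normD _ _))// lerD.
move=> e e0; have [_ _ /(_ (e / 2))] := sf; have [_ _ /(_ (e / 2))] := sg.
rewrite divr_gt0// => /(_ isT) hg /(_ isT) hf; near=> q.
rewrite (_ : _ - _ - _ = (f q.1 - f q.2 - L (q.1 - q.2)) + (g q.1 - g q.2 - M (q.1 - q.2))).
  rewrite (le_trans (ler_normD _ _))//.
  by rewrite [e]splitr mulrDl lerD//; near: q.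
by rewrite !opprD !addrA [RHS](ACl (1*4*2*5*3*6)).
Unshelve. all: by end_near. Qed.

Lemma sdiff_pair V W U (f : V -> W) (g : V -> U) p L M :
  sdiff f p L -> sdiff g p M ->
  sdiff (fun z => (f z, g z)) p (fun v => (L v, M v)).
Proof.
move=> sf sg; split.
- by move=> a u v; rewrite (sdiff_linD sf) (sdiff_linZ sf) (sdiff_linD sg)
    (sdiff_linZ sg).
- have [C C0 hC] := sdiff_bnd sf; have [D D0 hD] := sdiff_bnd sg.
  exists (C + D) => v; apply: pair_norm_le => /=.
    by rewrite (le_trans (hC _))// ler_wpM2r// lerDl ltW.
  by rewrite (le_trans (hD _))// ler_wpM2r// lerDr ltW.
move=> e e0; have [_ _ /(_ e e0) hg] := sg; have [_ _ /(_ e e0) hf] := sf.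
by near=> q; apply: pair_norm_le => /=; near: q.
Unshelve. all: by end_near. Qed.

Lemma sdiff_fst V W (p : V * W) : sdiff (@fst V W) p (@fst V W).
Proof. by apply: sdiff_linear => //; exists 1 => v; rewrite mul1r fst_norm_le. Qed.
Lemma sdiff_snd V W (p : V * W) : sdiff (@snd V W) p (@snd V W).
Proof. by apply: sdiff_linear => //; exists 1 => v; rewrite mul1r snd_norm_le. Qed.

Lemma sdiff_bilinear V W W' U (B : W -> W' -> U) (f : V -> W) (g : V -> W') p L M :
  (forall b, linear (B^~ b)) -> (forall a, linear (B a)) ->
  (exists C : R, forall a b, `|B a b| <= C * `|a| * `|b|) ->
  sdiff f p L -> sdiff g p M ->
  sdiff (fun z => B (f z) (g z)) p (fun v => B (L v) (g p) + B (f p) (M v)).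
Proof.
move=> Bl Br [K0 hK0] sf sg.
have [K Kp hK] : exists2 K : R, 0 < K & forall a b, `|B a b| <= K * `|a| * `|b|.
  exists (`|K0| + 1) => [|a b]; first by rewrite ltr_wpDl.
  rewrite (le_trans (hK0 a b))// ler_wpM2r// ler_wpM2r// (le_trans (ler_norm _))//.
  by rewrite lerDl.
have BlB a a' b : B (a - a') b = B a b - B a' b.
  exact: linear_sub (Bl b) a a'.
have BrB a b b' : B a (b - b') = B a b - B a b'.
  exact: linear_sub (Br a) b b'.
have [C C0 hC] := sdiff_lip sf; have [D D0 hD] := sdiff_bnd sg.
have [C' C'0 hC'] := sdiff_lip sg; have [D' D'0 hD'] := sdiff_bnd sf.
split.
- move=> a u v; rewrite (sdiff_linD sf) (sdiff_linZ sf) (sdiff_linD sg)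
    (sdiff_linZ sg).
  by rewrite (Bl (g p) a) (Br (f p) a) scalerDr addrACA.
- exists (K * D' * `|g p| + K * `|f p| * D) => v.
  rewrite mulrDl (le_trans (ler_normD _ _))// lerD// (le_trans (hK _ _))//.
    by rewrite -!mulrA ler_pM2l// [`|g p| * _]mulrC mulrA ler_wpM2r.
  by rewrite -!mulrA ler_pM2l// ler_wpM2l.
move=> e e0.
(* With da = f q.1 - f q.2 and db = g q.1 - g q.2, the increment is the sum of
   B(da - L, g p), B(f p, db - M), B(da, g q.1 - g p) and B(f q.2 - f p, db); each
   of them is kept below a quarter of e. *)
pose c K' : R := e / 4 / (K * K').
have c0 K' : 0 < K' -> 0 < c K' by move=> h; rewrite !(divr_gt0, mulr_gt0).
have cE K' x y z : 0 < K' -> 0 <= x -> x <= c K' * y -> 0 <= y -> z <= K' ->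
    K * x * z <= e / 4 * y.
  move=> k0 x0 xy y0 zk; apply: (@le_trans _ _ (K * (c K' * y) * K')).
    by rewrite -!mulrA ler_pM2l// !mulrA (le_trans (ler_wpM2l x0 zk))// ler_wpM2r// ltW.
  rewrite /c le_eqVlt; apply/orP; left; apply/eqP; field.
  by rewrite !lt0r_neq0.
have cE' K' x y z : 0 < K' -> 0 <= y -> 0 <= z -> x <= K' * y -> z <= c K' ->
    K * x * z <= e / 4 * y.
  move=> k0 y0 z0 xy zk; apply: (@le_trans _ _ (K * (K' * y) * c K')).
    apply: (@le_trans _ _ (K * (K' * y) * z)); first by rewrite ler_wpM2r// ler_pM2l.
    by rewrite ler_wpM2l// !mulr_ge0// ltW.
  rewrite /c le_eqVlt; apply/orP; left; apply/eqP; field.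
  by rewrite !lt0r_neq0.
have gp0 : 0 < `|g p| + 1 by rewrite ltr_wpDl.
have fp0 : 0 < `|f p| + 1 by rewrite ltr_wpDl.
have [_ _ /(_ _ (c0 _ gp0)) hf] := sf; have [_ _ /(_ _ (c0 _ fp0)) hg] := sg.
have cg : \forall z \near p, `|g p - g z| < c C.
  by have /cvgrPdist_lt := sdiff_continuous sg; apply; exact: c0.
have cf : \forall z \near p, `|f p - f z| < c C'.
  by have /cvgrPdist_lt := sdiff_continuous sf; apply; exact: c0.
near=> q.
have k1 : `|f q.1 - f q.2 - L (q.1 - q.2)| <= c (`|g p| + 1) * `|q.1 - q.2| by near: q.
have k2 : `|g q.1 - g q.2 - M (q.1 - q.2)| <= c (`|f p| + 1) * `|q.1 - q.2| by near: q.
have k3 : `|f q.1 - f q.2| <= C * `|q.1 - q.2| by near: q.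
have k4 : `|g q.1 - g q.2| <= C' * `|q.1 - q.2| by near: q.
have k5 : `|g q.1 - g p| <= c C.
  by rewrite distrC ltW//; near: q; exact: near_fst cg.
have k6 : `|f q.2 - f p| <= c C'.
  by rewrite distrC ltW//; near: q; exact: near_snd cf.
have -> : B (f q.1) (g q.1) - B (f q.2) (g q.2)
    - (B (L (q.1 - q.2)) (g p) + B (f p) (M (q.1 - q.2)))
  = (B (f q.1 - f q.2 - L (q.1 - q.2)) (g p) + B (f p) (g q.1 - g q.2 - M (q.1 - q.2)))
    + (B (f q.1 - f q.2) (g q.1 - g p) + B (f q.2 - f p) (g q.1 - g q.2)).
  rewrite (BlB (f q.1 - f q.2)) (BrB _ (g q.1 - g q.2)) (BrB (f q.1 - f q.2)) (BlB (f q.2)).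
  have -> : B (f q.1) (g q.1) - B (f q.2) (g q.2)
      = B (f q.1 - f q.2) (g q.1) + B (f q.2) (g q.1 - g q.2).
    by rewrite BlB BrB addrA subrK.
  by rewrite opprD !addrA [RHS](ACl (5*7*2*4*(1*6)*(3*8)))/= !subrr !addr0.
have -> : e * `|q.1 - q.2| = (e / 4 * `|q.1 - q.2| + e / 4 * `|q.1 - q.2|)
    + (e / 4 * `|q.1 - q.2| + e / 4 * `|q.1 - q.2|).
  by rewrite -!mulrDl; congr (_ * _); field.
rewrite (le_trans (ler_normD _ _))// lerD// (le_trans (ler_normD _ _))// lerD//
  (le_trans (hK _ _))//.
- by apply: cE k1 _ _ => //; rewrite lerDl.
- by rewrite mulrAC; apply: cE k2 _ _ => //; rewrite lerDl.
- exact: cE' k5.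
- by rewrite mulrAC; exact: cE' k6.
Unshelve. all: by end_near. Qed.

Lemma sdiff_ext V W (f g : V -> W) p L M : f =1 g -> L =1 M -> sdiff f p L -> sdiff g p M.
Proof. by move=> /funext <- /funext <-. Qed.

Lemma sdiff_unique V W (f : V -> W) p L M : sdiff f p L -> sdiff f p M -> L =1 M.
Proof.
move=> sf sg v; have [_ <-] := sdiff_is_derive v sf.
by have [_ <-] := sdiff_is_derive v sg.
Qed.

(** Strict derivatives vary continuously: the estimate at p, read on two points
    z and z + t v with t small, compares the derivative at z with the one at p. *)
Lemma sdiff_derive_near V W (f : V -> W) p L e : 0 < e -> sdiff f p L ->
  \forall z \near p, forall M, sdiff f z M -> forall v, `|M v - L v| <= e * `|v|.
Proof.
move=> e0 sf; have [_ _ /(_ e e0) /near2_normP[d d0 h]] := sf.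
apply/near_normP; exists (d / 2); first by rewrite divr_gt0.
move=> z zd M sM v; apply/ler_addgt0Pr => e' e'0.
have [v0|v0] := eqVneq v 0.
  by rewrite v0 (sdiff_lin0 sM) (sdiff_lin0 sf) subrr !normr0 mulr0 add0r ltW.
have nv : 0 < `|v| by rewrite normr_gt0.
have [_ _ /(_ (e' / `|v|))] := sM; rewrite divr_gt0// => /(_ isT) /near2_normP[d' d'0 h'].
have [t [t0 td td']] : exists t : R, [/\ 0 < t, t * `|v| < d / 2 & t * `|v| < d'].
  pose m := Num.min (d / 2) d'.
  have m0 : 0 < m by rewrite lt_min divr_gt0.
  exists (m / 2 / `|v|); rewrite !divr_gt0// divfK ?gt_eqF//.
  have mm : m / 2 < m by rewrite ltr_pdivrMr// ltr_pMr// ltr1n.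
  by split=> //; apply: lt_le_trans mm _; rewrite ge_min lexx ?orbT.
have ntv : `|t *: v| = t * `|v| by rewrite normrZ gtr0_norm.
have k1 : `|f (t *: v + z) - f z - L (t *: v)| <= e * `|t *: v|.
  have := h (t *: v + z) z; rewrite /= addrK; apply.
    by rewrite -addrA (le_lt_trans (ler_normD _ _))// [d]splitr ltrD// ntv.
  by rewrite (lt_trans zd)// ltr_pdivrMr// ltr_pMr// ltr1n.
have k2 : `|f (t *: v + z) - f z - M (t *: v)| <= e' / `|v| * `|t *: v|.
  have := h' (t *: v + z) z; rewrite /= addrK subrr normr0 ntv; exact.
have : `|M (t *: v) - L (t *: v)| <= e * `|t *: v| + e' / `|v| * `|t *: v|.
  rewrite (le_trans (ler_distD (f (t *: v + z) - f z) _ _))// addrC lerD//.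
  by rewrite distrC.
rewrite (sdiff_linZ sM) (sdiff_linZ sf) -scalerBr normrZ gtr0_norm// ntv.
rewrite -mulrDl mulrCA ler_pM2l// mulrDl divfK// gt_eqF//.
Qed.

Lemma sdiff_Ck1 V W (f : V -> W) (O : set V) : open O ->
  (forall z, O z -> exists L, sdiff f z L) -> Ck 1 O f.
Proof.
move=> oO h; split=> [z /h[L /sdiff_differentiable//]|v z Oz] /=.
have [L sL] := h z Oz.
apply/cvgrPdist_le => e e0.
have e1 : 0 < e / (`|v| + 1) by rewrite divr_gt0// ltr_wpDl.
have := sdiff_derive_near e1 sL.
have nO : \forall y \near z, O y by apply: open_nbhs_nbhs.
move=> nd; near=> y.
have [M sM] : exists M, sdiff f y M by apply: h; near: y.
have [_ ->] := sdiff_is_derive v sM; have [_ ->] := sdiff_is_derive v sL.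
rewrite distrC (@le_trans _ _ (e / (`|v| + 1) * `|v|))//.
  have hy : forall M, sdiff f y M -> forall v', `|M v' - L v'| <= e / (`|v| + 1) * `|v'|.
    by near: y.
  exact: hy.
by rewrite mulrAC ler_pdivrMr ?ltr_wpDl// ler_pM2l ?lerDl.
Unshelve. all: by end_near. Qed.

End sdiff_calculus.

Lemma near_finType (I : finType) (T : Type) (F : set_system T) (P : I -> T -> Prop) :
  Filter F ->
  (forall i, \forall x \near F, P i x) -> \forall x \near F, forall i, P i x.
Proof.
move=> FF h; have : \forall x \near F, forall i, i \in enum I -> P i x.
  elim: (enum I) => [|i s IH]; first by apply: filterE.
  apply: filterS2 (h i) IH => x Px sx j; rewrite inE => /predU1P[->//|]; exact: sx.
by apply: filterS => x hx i; apply: hx; rewrite mem_enum.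
Qed.

Section sdiff_mx.
Context {R : realType} {V : normedModType R}.

Lemma sdiffN (W : normedModType R) (f : V -> W) p L : sdiff f p L ->
  sdiff (fun z => - f z) p (fun v => - L v).
Proof.
move=> sf; apply: (sdiff_comp sf (g := fun w => - w) (M := fun w => - w)).
apply: sdiff_linear => [a u v|]; first by rewrite opprD scalerN.
by exists 1 => v; rewrite normrN mul1r.
Qed.

Lemma sdiffB (W : normedModType R) (f g : V -> W) p L M :
  sdiff f p L -> sdiff g p M -> sdiff (fun z => f z - g z) p (fun v => L v - M v).
Proof. by move=> sf /sdiffN; exact: sdiffD. Qed.

Lemma sdiffZl (W : normedModType R) (c : R) (f : V -> W) p L : sdiff f p L ->
  sdiff (fun z => c *: f z) p (fun v => c *: L v).
Proof.
move=> sf; apply: (sdiff_comp sf (g := fun w => c *: w) (M := fun w => c *: w)).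
apply: sdiff_linear => [a u v|]; first by rewrite scalerDr !scalerA mulrC.
by exists `|c| => v; rewrite normrZ.
Qed.

Lemma sdiff_mulmx m n l (f : V -> 'M[R]_(m, n)) (g : V -> 'M[R]_(n, l)) p L M :
  sdiff f p L -> sdiff g p M ->
  sdiff (fun z => f z *m g z) p (fun v => L v *m g p + f p *m M v).
Proof.
apply: sdiff_bilinear => [b a u v|a b u v|]; last by exists n%:R => a b; exact: norm_mulmx.
  by rewrite mulmxDl scalemxAl.
by rewrite mulmxDr scalemxAr.
Qed.

Lemma sdiffM (f g : V -> R) p L M : sdiff f p L -> sdiff g p M ->
  sdiff (fun z => f z * g z) p (fun v => L v * g p + f p * M v).
Proof.
apply: (@sdiff_bilinear R V R R R *%R) => [b a u v|a b u v|].
- by change ((a * u + v) * b = a * (u * b) + v * b); rewrite mulrDl mulrA.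
- by change (a * (b * u + v) = b * (a * u) + a * v); rewrite mulrDr mulrCA.
by exists 1 => a b; rewrite normrM mul1r.
Qed.

Lemma sdiffZ (W : normedModType R) (f : V -> R) (g : V -> W) p L M :
  sdiff f p L -> sdiff g p M ->
  sdiff (fun z => f z *: g z) p (fun v => L v *: g p + f p *: M v).
Proof.
apply: (@sdiff_bilinear R V R W W *:%R) => [b a u v|a b u v|].
- by rewrite scalerDl scalerA.
- by rewrite scalerDr !scalerA mulrC.
by exists 1 => a b; rewrite normrZ mul1r.
Qed.

Lemma sdiff_mulmxr m n l (A : 'M[R]_(n, l)) (f : V -> 'M[R]_(m, n)) p L :
  sdiff f p L -> sdiff (fun z => f z *m A) p (fun v => L v *m A).
Proof.
move=> sf; apply: (sdiff_ext _ _ (sdiff_mulmx sf (sdiff_cst p A))) => // v.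
by rewrite mulmx0 addr0.
Qed.

Lemma sdiff_mulmxl m n l (A : 'M[R]_(l, m)) (f : V -> 'M[R]_(m, n)) p L :
  sdiff f p L -> sdiff (fun z => A *m f z) p (fun v => A *m L v).
Proof.
move=> sf; apply: (sdiff_ext _ _ (sdiff_mulmx (sdiff_cst p A) sf)) => // v.
by rewrite mul0mx add0r.
Qed.

Lemma sdiff_tr m n (f : V -> 'M[R]_(m, n)) p L :
  sdiff f p L -> sdiff (fun z => (f z)^T) p (fun v => (L v)^T).
Proof.
move=> sf; apply: (sdiff_comp sf (g := fun w => w^T) (M := fun w => w^T)).
apply: sdiff_linear => [a u v|]; first by rewrite linearP.
exists 1 => v; rewrite mul1r; apply: mx_norm_le => // i j.
by rewrite mxE mx_coord_le.
Qed.

Lemma sdiff_coord m n (f : V -> 'M[R]_(m, n)) p L i j :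
  sdiff f p L -> sdiff (fun z => f z i j) p (fun v => L v i j).
Proof.
move=> sf; apply: (sdiff_comp sf (g := fun w : 'M[R]_(m, n) => w i j) (M := fun w : 'M[R]_(m, n) => w i j)).
apply: sdiff_linear => [a u v|]; first by rewrite !mxE.
by exists 1 => v; rewrite mul1r mx_coord_le.
Qed.

Lemma sdiff_mx m n (f : V -> 'M[R]_(m, n)) p (L : V -> 'M[R]_(m, n)) :
  (forall i j, sdiff (fun z => f z i j) p (fun v => L v i j)) -> sdiff f p L.
Proof.
move=> h; split.
- by move=> a u v; apply/matrixP => i j; rewrite !mxE (sdiff_linD (h i j)) (sdiff_linZ (h i j)).
- have hC i j : exists C : R, forall v, `|L v i j| <= C * `|v|.
    by have [_ H _] := h i j.
  pose C i j := sval (cid (hC i j)).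
  exists (\sum_i \sum_j `|C i j|) => v; apply: mx_norm_le => [|i j].
    by rewrite mulr_ge0// sumr_ge0// => i _; rewrite sumr_ge0.
  rewrite (le_trans (svalP (cid (hC i j)) v))// ler_wpM2r// -/(C i j).
  rewrite (le_trans (ler_norm _))// (bigD1 i)//= (bigD1 j)//= -addrA lerDl.
  by rewrite addr_ge0// !sumr_ge0// => k _; rewrite sumr_ge0.
move=> e e0.
have : \forall q \near (p, p), forall ij : 'I_m * 'I_n,
    `|f q.1 ij.1 ij.2 - f q.2 ij.1 ij.2 - L (q.1 - q.2) ij.1 ij.2| <= e * `|q.1 - q.2|.
  refine (@near_finType _ _ (nbhs (p, p)) (fun (ij : 'I_m * 'I_n) (q : V * V) =>
    `|f q.1 ij.1 ij.2 - f q.2 ij.1 ij.2 - L (q.1 - q.2) ij.1 ij.2| <= e * `|q.1 - q.2|) _ _).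
  by move=> -[i j]; have [_ _] := h i j; apply.
apply: filterS => q hq; apply: mx_norm_le => [|i j]; first by rewrite mulr_ge0// ltW.
by have := hq (i, j); rewrite !mxE.
Qed.

(** A scalar function whose difference quotient extends continuously to the diagonal
    is strictly differentiable; this covers the inverse and the square root. *)
Lemma sdiff_slope (f : R -> R) (k : R * R -> R) p :
  {for (p, p), continuous k} ->
  (\forall q \near (p, p), f q.1 - f q.2 = k q * (q.1 - q.2)) ->
  sdiff f p (fun v => k (p, p) * v).
Proof.
move=> kc kf; split.
- by move=> a u v; change (k (p, p) * (a * u + v) = a * (k (p, p) * u) + k (p, p) * v); ring.
- by exists `|k (p, p)| => v; rewrite normrM.
move=> e e0; have {}kc : \forall q \near (p, p), `|k (p, p) - k q| < e.
  by move/cvgrPdist_lt : kc; apply.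
near=> q; have -> : f q.1 - f q.2 = k q * (q.1 - q.2) by near: q.
rewrite -mulrBl normrM ler_wpM2r// distrC ltW//.
by near: q.
Unshelve. all: by end_near. Qed.

Lemma sdiff_inv (f : V -> R) p L : f p != 0 -> sdiff f p L ->
  sdiff (fun z => (f z)^-1) p (fun v => - (f p * f p)^-1 * L v).
Proof.
move=> fp sf; refine (@sdiff_comp R V R R f (fun x => x^-1) p L (fun v => - (f p * f p)^-1 * v) sf _).
apply: (@sdiff_slope _ (fun q => - (q.1 * q.2)^-1)).
  apply: cvgN; apply: cvgV; first by rewrite mulf_neq0.
  by apply: cvgM; [exact: cvg_fst|exact: cvg_snd].
have nz : \forall x \near f p, x != 0.
  by apply: (@cvgr_neq0 _ _ _ (nbhs (f p)) _ id (f p)) => //; exact: cvg_id.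
near=> q; have q1 : q.1 != 0 by near: q; exact: near_fst nz.
have q2 : q.2 != 0 by near: q; exact: near_snd nz.
by field; rewrite q1 q2.
Unshelve. all: by end_near. Qed.

Lemma sdiff_sqrt (f : V -> R) p L : 0 < f p -> sdiff f p L ->
  sdiff (fun z => Num.sqrt (f z)) p
    (fun v => (Num.sqrt (f p) + Num.sqrt (f p))^-1 * L v).
Proof.
move=> fp sf; apply: (sdiff_comp sf (g := fun x => Num.sqrt x)
  (M := fun v => (Num.sqrt (f p) + Num.sqrt (f p))^-1 * v)).
have sp : 0 < Num.sqrt (f p) by rewrite sqrtr_gt0.
apply: (@sdiff_slope _ (fun q => (Num.sqrt q.1 + Num.sqrt q.2)^-1)).
  apply: cvgV; first by rewrite gt_eqF// addr_gt0.
  by apply: cvgD => A /sqrt_continuous hA; [exact: near_fst hA|exact: near_snd hA].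
have nz : \forall x \near f p, 0 < x.
  by apply: (@cvgr_gt _ _ (nbhs (f p)) _ id (f p)) => //; exact: cvg_id.
near=> q; have q1 : 0 < q.1 by near: q; exact: near_fst nz.
have q2 : 0 < q.2 by near: q; exact: near_snd nz.
have s1 : 0 < Num.sqrt q.1 by rewrite sqrtr_gt0.
have s2 : 0 < Num.sqrt q.2 by rewrite sqrtr_gt0.
have -> : q.1 - q.2 = (Num.sqrt q.1 - Num.sqrt q.2) * (Num.sqrt q.1 + Num.sqrt q.2).
  by rewrite -subr_sqr !sqr_sqrtr// ltW.
by rewrite mulrC mulfK// gt_eqF// addr_gt0.
Unshelve. all: by end_near. Qed.
End sdiff_mx.
(** * Local inverses *)

Section inverse_function.
Context {R : realType}.

(** Solving f x = y is finding a fixed point of x - f x + y, a contraction of the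
    closed ball of radius r around p. *)
Lemma near_id_surj (V : completeNormedModType R) (f : V -> V) (p : V) (r : R) :
  0 < r ->
  (forall a b, `|a - p| <= r -> `|b - p| <= r ->
     `|f a - f b - (a - b)| <= 2^-1 * `|a - b|) ->
  forall y, `|y - f p| <= r / 2 -> exists2 x, `|x - p| <= r & f x = y.
Proof.
move=> r0 hf y hy.
pose U : set V := closed_ball_ Num.Def.normr p r.
have UE x : U x <-> `|x - p| <= r by rewrite /U /closed_ball_ /= distrC.
pose G x := x - f x + y.
have GE a b : `|G a - G b| = `|f a - f b - (a - b)|.
  rewrite -[in RHS]normrN /G; congr (`|_|).
  by rewrite !opprD !opprK !addrA [LHS](ACl (1*2*4*5*(3*6)))/= subrr addr0
    [RHS](ACl (3*1*4*2)).
have hG : {homo G : x / U x >-> U x}.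
  move=> x /UE xr; apply/UE.
  have -> : G x - p = (G x - G p) + (y - f p).
    by rewrite /G !opprD !opprK !addrA [RHS](ACl (1*2*3*4*(5*8)*(6*7)))/= subrr [- y + y]addrC subrr !addr0.
  rewrite (le_trans (ler_normD _ _))// [r]splitr lerD// GE.
  rewrite (le_trans (hf _ _ xr _))//; first by rewrite subrr normr0 ltW.
  by rewrite mulrC ler_pM2r ?invr_gt0.
have ctr : is_contraction (mkfun_fun hG).
  have h2 : 0 <= (2^-1 : R) by rewrite invr_ge0.
  exists (NngNum h2); split; first by rewrite /= invf_lt1// ltr1n.
  by move=> [a b] /= [/UE ha /UE hb]; rewrite GE; exact: hf.
have [x Ux xE] : exists2 x, U x & x = G x.
  apply: (banach_fixed_point ctr); first exact: closed_closed_ball_.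
  by exists p; apply/UE; rewrite subrr normr0 ltW.
exists x; first exact/UE.
by move: xE; rewrite /G -addrA => /eqP; rewrite -subr_eq0 opprD addrA subrr add0r oppr_eq0 addrC subr_eq0 => /eqP.
Qed.

(** Applying M to the two-point estimate of f at h y turns it into the one of h at y;
    the Lipschitz bound on h converts errors in x into errors in y. *)
Lemma sdiff_inverse (V W : normedModType R) (f : V -> W) (h : W -> V) y L (M : W -> V) :
  linear M -> (exists C : R, forall v, `|M v| <= C * `|v|) ->
  (forall v, M (L v) = v) -> sdiff f (h y) L ->
  (\forall z \near y, f (h z) = z) ->
  (exists C : R, \forall q \near (y, y), `|h q.1 - h q.2| <= C * `|q.1 - q.2|) ->
  sdiff h y M.
Proof.
move=> lM bM ML sf fh [C0 hC0]; split=> // e e0.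
have sM := sdiff_linear y lM bM.
have [D D0 hD] := sdiff_bnd sM.
pose C := `|C0| + 1.
have C_gt0 : 0 < C by rewrite ltr_wpDl.
have hC : \forall q \near (y, y), `|h q.1 - h q.2| <= C * `|q.1 - q.2|.
  apply: filterS hC0 => q /le_trans; apply; rewrite ler_wpM2r//.
  by rewrite (le_trans (ler_norm _))// lerDl.
have hc : {for y, continuous h}.
  have /near2_normP[d d0 hd] := hC.
  apply/cvgrPdist_lt => e' e'0; apply/near_normP.
  exists (Num.min d (e' / C)); first by rewrite lt_min d0 divr_gt0.
  move=> a; rewrite lt_min => /andP[ad ae]; rewrite distrC.
  have := hd a y ad; rewrite subrr normr0 => /(_ d0) /= /le_lt_trans; apply.
  by rewrite mulrC -ltr_pdivlMr.
have [_ _ /(_ (e / D / C))] := sf; rewrite !divr_gt0// => /(_ isT) hf.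
have {}hf := near_pair_continuous hc hf.
near=> q.
have e1 : f (h q.1) = q.1 by near: q; exact: near_fst fh.
have e2 : f (h q.2) = q.2 by near: q; exact: near_snd fh.
have h1 : `|f (h q.1) - f (h q.2) - L (h q.1 - h q.2)| <= e / D / C * `|h q.1 - h q.2|.
  by near: q.
have h2 : `|h q.1 - h q.2| <= C * `|q.1 - q.2| by near: q.
rewrite distrC -[h q.1 - h q.2]ML -(sdiff_linB sM) (le_trans (hD _))//.
move: h1; rewrite e1 e2 => h1.
rewrite -ler_pdivlMl// (le_trans h1)// (le_trans (ler_wpM2l _ h2))//.
  by rewrite !divr_ge0// ltW.
by rewrite mulrA divfK ?gt_eqF// mulrA [D^-1 * _]mulrC.
Unshelve. all: by end_near. Qed.

(** Inverse function theorem. The derivative is normalised to the identity, which loses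
    no generality (compose with its inverse) and makes f a perturbation of the
    identity. At a point x near p the derivative L is within 1/2 of the identity, so
    near_id_surj applied to L itself inverts it. *)
Theorem local_inverse (V : completeNormedModType R) (f : V -> V) (p : V) :
  sdiff f p id -> (\forall z \near p, exists L, sdiff f z L) ->
  exists h : V -> V, [/\ h (f p) = p, \forall y \near f p, f (h y) = y,
    \forall x \near p, h (f x) = x, sdiff h (f p) id &
    \forall y \near f p, exists M, sdiff h y M].
Proof.
move=> sp sn.
have h20 : 0 < (2^-1 : R) by rewrite invr_gt0.
have [d0 d00 hd0] : exists2 d : R, 0 < d & forall a b, `|a - p| < d -> `|b - p| < d ->
    `|f a - f b - (a - b)| <= 2^-1 * `|a - b|.
  by have [_ _ /(_ _ h20) /near2_normP] := sp.
have [d1 d10 hd1] : exists2 d : R, 0 < d & forall z, `|z - p| < d ->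
    exists2 L, sdiff f z L & forall v, `|L v - v| <= 2^-1 * `|v|.
  apply/near_normP; near=> z.
  have [L sL] : exists L, sdiff f z L by near: z.
  exists L => // v; move: v.
  have h : forall M, sdiff f z M -> forall v, `|M v - v| <= 2^-1 * `|v|.
    by near: z; exact: sdiff_derive_near.
  exact: h.
pose r := Num.min d0 d1 / 2.
have m0 : 0 < Num.min d0 d1 by rewrite lt_min d00.
have r0 : 0 < r by rewrite divr_gt0.
have rm : r < Num.min d0 d1 by rewrite ltr_pdivrMr// ltr_pMr// ltr1n.
have rd0 : r < d0 by rewrite (lt_le_trans rm)// ge_min lexx.
have rd1 : r < d1 by rewrite (lt_le_trans rm)// ge_min lexx orbT.
have hr a b : `|a - p| <= r -> `|b - p| <= r -> `|f a - f b - (a - b)| <= 2^-1 * `|a - b|.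
  by move=> ha hb; apply: hd0; [exact: le_lt_trans ha _|exact: le_lt_trans hb _].
have expand a b : `|a - p| <= r -> `|b - p| <= r -> `|a - b| <= 2 * `|f a - f b|.
  move=> ha hb; have := hr a b ha hb; rewrite distrC => /(le_trans (lerB_dist _ _)).
  lra.
pose P y x := `|x - p| <= r /\ f x = y.
have surj y : `|y - f p| <= r / 2 -> exists x, P y x.
  by move=> /(near_id_surj r0 hr)[x xr fx]; exists x.
(* Away from the ball of radius r / 2 around f p, h takes the arbitrary value p. *)
pose h y := xget p (P y).
have hP y : `|y - f p| <= r / 2 -> P y (h y).
  by move=> /surj[x Px]; exact: (xgetPex p (ex_intro _ x Px)).
have pp : `|p - p| <= r by rewrite subrr normr0 ltW.
have r20 : 0 < r / 2 by rewrite divr_gt0.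
have hfp : h (f p) = p.
  have [] := hP (f p); first by rewrite subrr normr0 ltW.
  move=> /expand /(_ pp) + fE; rewrite fE subrr normr0 mulr0 normr_le0 subr_eq0.
  by move=> /eqP.
have hlip y1 y2 : `|y1 - f p| <= r / 2 -> `|y2 - f p| <= r / 2 ->
    `|h y1 - h y2| <= 2 * `|y1 - y2|.
  by move=> /hP[h1 e1] /hP[h2 e2]; rewrite -{2}e1 -{2}e2; exact: expand.
have hinv y : `|y - f p| < r / 2 -> forall L, sdiff f (h y) L ->
    forall M : V -> V, linear M -> (exists C : R, forall v, `|M v| <= C * `|v|) ->
    (forall v, M (L v) = v) -> sdiff h y M.
  move=> hy L sL M lM bM ML; apply: sdiff_inverse sL _ _ => //.
    apply/near_normP; exists (r / 2 - `|y - f p|); first by rewrite subr_gt0.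
    move=> z hz; have [] // := hP z.
    rewrite (le_trans (ler_distD y _ _))//; lra.
  exists 2; apply/near2_normP; exists (r / 2 - `|y - f p|); first by rewrite subr_gt0.
  move=> a b ha hb /=; apply: hlip.
    rewrite (le_trans (ler_distD y _ _))//; lra.
  rewrite (le_trans (ler_distD y _ _))//; lra.
exists h; split=> //.
- apply/near_normP; exists (r / 2) => // y hy; have [] // := hP y; exact: ltW.
- apply/near_normP; exists (r / 3); first by rewrite divr_gt0.
  move=> x hx.
  have hxr : `|x - p| <= r by lra.
  have fx : `|f x - f p| <= r / 2.
    have /(le_trans (lerB_dist _ _)) := hr x p hxr pp; lra.
  have [hh fh] := hP _ fx.
  have := expand _ _ hh hxr; rewrite fh subrr normr0 mulr0 normr_le0 subr_eq0.
  by move/eqP.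
- apply: (hinv _ _ id) => //; first by rewrite subrr normr0.
    by rewrite hfp.
  by exists 1 => v; rewrite mul1r.
apply/near_normP; exists (r / 2) => // y hy.
have [hh fh] := hP y (ltW hy).
have [L sL hL] := hd1 (h y) (le_lt_trans hh rd1).
have Lsurj w : exists v, L v = w.
  have w0 : 0 < 2 * `|w| + 1 by rewrite ltr_wpDl// mulr_ge0.
  have [||v _ <-] := @near_id_surj V L 0 (2 * `|w| + 1) w0 _ w; last by exists v.
    by move=> a b _ _; rewrite -(sdiff_linB sL).
  rewrite (sdiff_lin0 sL) subr0; lra.
have Lexp v : `|v| <= 2 * `|L v|.
  have := hL v; rewrite distrC => /(le_trans (lerB_dist _ _)); lra.
pose M w := sval (cid (Lsurj w)).
have LM w : L (M w) = w by exact: svalP (cid (Lsurj w)).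
have Linj a b : L a = L b -> a = b.
  move=> e; apply/eqP; rewrite -subr_eq0 -normr_le0.
  by rewrite (le_trans (Lexp _))// (sdiff_linB sL) e subrr normr0 mulr0.
exists M; apply: (hinv _ hy L sL) => //.
- by move=> a u v; apply: Linj; rewrite LM (sdiff_linD sL) (sdiff_linZ sL) !LM.
- by exists 2 => v; rewrite -{2}(LM v).
- by move=> v; apply: Linj; rewrite LM.
Unshelve. all: by end_near. Qed.

End inverse_function.


(** * Completeness of matrix spaces and products *)

Section completeness.
Context {R : realType}.
HB.instance Definition _ m n := Complete.on (matrix R m n).
HB.instance Definition _ (V W : completeNormedModType R) := Pointed.on (V * W)%type.
Lemma prod_complete (V W : completeNormedModType R) (F : set_system ((V * W)%type : puniformType)) :
  ProperFilter F -> cauchy F -> cvg F.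
Proof.
move=> FF /cauchy_ballP cF.
have c1 : cauchy (fst @ F).
  apply/cauchy_ballP => e e0; have := cF e e0.
  move=> [[A B] /= [FA FB] AB].
  exists (fst @` A, fst @` B) => /=.
    by split; [move: FA|move: FB]; apply: filterS => x Ax; exists x.
  move=> [a b] /= [[x Ax <-] [y By <-]].
  by have [] := AB (x, y) (conj Ax By).
have c2 : cauchy (snd @ F).
  apply/cauchy_ballP => e e0; have := cF e e0.
  move=> [[A B] /= [FA FB] AB].
  exists (snd @` A, snd @` B) => /=.
    by split; [move: FA|move: FB]; apply: filterS => x Ax; exists x.
  move=> [a b] /= [[x Ax <-] [y By <-]].
  by have [] := AB (x, y) (conj Ax By).
have ha : fst @ F --> lim (fst @ F) by apply/cauchy_cvgP.
have hb : snd @ F --> lim (snd @ F) by apply/cauchy_cvgP.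
apply: (@cvgP _ _ (lim (fst @ F), lim (snd @ F))).
have h : (fun q : V * W => (q.1, q.2)) @ F --> (lim (fst @ F), lim (snd @ F)).
  exact: cvg_pair.
by move=> A /h; apply: (@filterS _ F _) => -[x y].
Qed.
HB.instance Definition _ (V W : completeNormedModType R) :=
  Uniform_isComplete.Build (V * W)%type (@prod_complete V W).
End completeness.
(** * Mean value inequalities *)

Section mean_value.
Context {R : realType}.

Lemma mean_value_le (f df : R -> R) (C : R) :
  (forall t : R, 0 <= t <= 1 -> is_derive t (1 : R) f (df t)) ->
  (forall t : R, 0 <= t <= 1 -> `|df t| <= C) -> `|f 1 - f 0| <= C.
Proof.
move=> fd dC.
have [t t01 ->] : exists2 t : R, t \in `[(0:R), 1] & f 1 - f 0 = df t * (1 - 0).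
  apply: MVT_segment => [|t|]; first exact: ler01.
    by rewrite in_itv /= => /andP[/ltW t0 /ltW t1]; apply: fd; rewrite t0.
  apply: derivable_within_continuous => t; rewrite in_itv /= => t01.
  by have [] := fd t t01.
by rewrite subr0 mulr1; apply: dC; rewrite in_itv in t01.
Qed.

Lemma is_derive_line (V W : normedModType R) (f : V -> W) a v (t : R) d :
  is_derive (a + t *: v) v f d -> is_derive t (1 : R) (fun s : R => f (a + s *: v)) d.
Proof.
have E : (fun h : R => h^-1 *: (((fun s : R => f (a + s *: v)) \o shift t) (h *: (1 : R)) - f (a + t *: v)))
   = (fun h : R => h^-1 *: ((f \o shift (a + t *: v)) (h *: v) - f (a + t *: v))).
  apply/funext => h /=; congr (_ *: (f _ - _)).
  by rewrite scalerDl addrCA -[h%:A]/(h * 1) mulr1.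
by move=> [d1 d2]; split; rewrite ?/derivable ?/derive E.
Qed.

Lemma is_derive_mulr (k t : R) : is_derive t (1 : R) (fun s : R => s * k) k.
Proof.
have h : sdiff (fun s : R => s * k) t (fun s : R => s * k + t * 0).
  exact: sdiffM (sdiff_id t) (sdiff_cst t k).
by have := sdiff_is_derive (1 : R) h; rewrite mul1r mulr0 addr0.
Qed.

Lemma convex_ball (V : normedModType R) (a b p : V) (t d : R) : 0 <= t <= 1 ->
  `|a - p| < d -> `|b - p| < d -> `|b + t *: (a - b) - p| < d.
Proof.
move=> /andP[t0 t1] ad bd.
have -> : b + t *: (a - b) - p = t *: (a - p) + (1 - t) *: (b - p).
  rewrite !scalerBr !scalerBl !scale1r !opprB !addrA.
  by rewrite [RHS](ACl (3*1*4*6*(5*2)))/= subrr addr0.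
rewrite (le_lt_trans (ler_normD _ _))// !normrZ (ger0_norm t0) ger0_norm ?subr_ge0//.
apply: (@le_lt_trans _ _ (Num.max `|a - p| `|b - p|)); last by rewrite gt_max ad bd.
set m := Num.max _ _; have -> : m = t * m + (1 - t) * m by ring.
by rewrite lerD// ler_wpM2l ?subr_ge0// le_max lexx ?orbT.
Qed.

End mean_value.

(** * Functions of class C^1 and C^2 *)

Section Ck_sdiff.
Context {R : realType}.

(** Finite dimension, as a finite family of vectors with bounded coordinates. *)
Definition fin_basis (V : normedModType R) :=
  exists (n : nat) (e : 'I_n -> V) (c : 'I_n -> V -> R) (C : R),
    (forall v, v = \sum_i c i v *: e i) /\ forall i v, `|c i v| <= C * `|v|.

Lemma fin_basis_rV n : fin_basis 'rV[R]_n.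
Proof.
exists n, (fun i => delta_mx 0 i), (fun i (v : 'rV[R]_n) => v 0 i), 1; split=> [v|i v].
  exact: row_sum_delta.
by rewrite mul1r mx_coord_le.
Qed.

Lemma sum_pair (V W : zmodType) (I : finType) (F : I -> V * W) :
  \sum_i F i = (\sum_i (F i).1, \sum_i (F i).2).
Proof. by elim/big_rec3: _ => // i a b c _ ->; case: (F i). Qed.

Lemma fin_basis_prod (V W : normedModType R) :
  fin_basis V -> fin_basis W -> fin_basis (V * W)%type.
Proof.
move=> [n [e [c [C [h1 h2]]]]] [m [e' [c' [C' [h1' h2']]]]].
exists (n + m)%N, (fun i : 'I_(n + m) => match fintype.split i with inl j => (e j, 0) | inr j => (0, e' j) end),
  (fun (i : 'I_(n + m)) (v : V * W) => match fintype.split i with inl j => c j v.1 | inr j => c' j v.2 end), (`|C| + `|C'|).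
split=> [[v w]|i v].
  rewrite big_split_ord /=.
  under eq_bigr do rewrite -[lshift _ _]/(unsplit (inl _)) unsplitK.
  under [X in _ + X]eq_bigr do rewrite -[rshift _ _]/(unsplit (inr _)) unsplitK.
  rewrite !sum_pair /= -h1 -h1'.
  rewrite [X in (_, X) + _]big1 => [|i _]; last by rewrite /= scaler0.
  rewrite [X in _ + (X, _)]big1 => [|i _]; last by rewrite /= scaler0.
  by rewrite -[RHS]/(v + 0, 0 + w) addr0 add0r.
case: (fintype.split i) => j.
  rewrite (le_trans (h2 _ _))// (le_trans (ler_wpM2r _ (ler_norm _)))//.
  by rewrite ler_pM// ?fst_norm_le// lerDl.
rewrite (le_trans (h2' _ _))// (le_trans (ler_wpM2r _ (ler_norm _)))//.
by rewrite ler_pM// ?snd_norm_le// lerDr.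
Qed.

(** By the mean value inequality on f - L, whose derivatives near p are small in each
    direction of a finite basis, hence uniformly small over all directions. *)
Lemma Ck1_sdiff (V : normedModType R) (f : V -> R) (O : set V) p :
  fin_basis V -> open O -> Ck 1 O f -> O p -> sdiff f p (fun v => 'D_v f p).
Proof.
move=> [n [e [c [C0 [vE hc0]]]]] oO [fd fc] Op.
pose C := `|C0| + 1.
have C0' : 0 < C by rewrite ltr_wpDl.
have hc i v : `|c i v| <= C * `|v|.
  by rewrite (le_trans (hc0 i v))// ler_wpM2r// (le_trans (ler_norm _))// lerDl.
have DE z v : O z -> 'D_v f z = \sum_i c i v * 'D_(e i) f z.
  move=> Oz; rewrite deriveE; last exact: fd.
  rewrite {1}(vE v) linear_sum; apply: eq_bigr => i _.
  by rewrite linearZ deriveE//; exact: fd.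
split.
- by move=> a u v; rewrite !deriveE ?linearP//; exact: fd.
- exists (\sum_i C * `|'D_(e i) f p|) => v.
  rewrite DE// (le_trans (ler_norm_sum _ _ _))// mulr_suml ler_sum// => i _.
  by rewrite normrM mulrAC ler_wpM2r.
move=> ep ep0.
have N0 : 0 < n%:R * C + 1 by rewrite ltr_wpDl// mulr_ge0// ltW.
have : \forall z \near p, O z /\ forall i, `|'D_(e i) f z - 'D_(e i) f p| <= ep / (n%:R * C + 1).
  apply: filterI; first exact: open_nbhs_nbhs.
  refine (@near_finType _ _ (nbhs p) (fun i z => _) _ _) => i.
  have := fc (e i) p Op => /cvgrPdist_le /(_ _ (divr_gt0 ep0 N0)).
  by apply: filterS => z; rewrite distrC.
move=> /near_normP[d d0 hd].
apply/near2_normP; exists d => // a b ad bd /=.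
have := @mean_value_le R (fun t => f (b + t *: (a - b)) - t * 'D_(a - b) f p)
  (fun t => 'D_(a - b) f (b + t *: (a - b)) - 'D_(a - b) f p) (ep * `|a - b|).
rewrite scale1r scale0r addr0 mul1r mul0r subr0 [b + _]addrC subrK addrAC; apply.
- move=> t t01; apply: is_deriveB; last exact: is_derive_mulr.
  apply: is_derive_line; apply: derivableP; apply: diff_derivable; apply: fd.
  by have [] := hd _ (convex_ball t01 ad bd).
move=> t t01.
have [Oz hz] := hd _ (convex_ball t01 ad bd).
rewrite !DE// -sumrB (le_trans (ler_norm_sum _ _ _))//.
apply: (@le_trans _ _ (\sum_(i < n) C * `|a - b| * (ep / (n%:R * C + 1)))).
  by apply: ler_sum => i _; rewrite -mulrBr normrM ler_pM.
rewrite sumr_const card_ord -[leLHS]mulr_natl.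
have -> : n%:R * (C * `|a - b| * (ep / (n%:R * C + 1)))
    = ep * `|a - b| * (n%:R * C / (n%:R * C + 1)) by field; rewrite gt_eqF.
by rewrite ler_piMr ?mulr_ge0 ?(ltW ep0)// ler_pdivrMr// mul1r lerDl.
Qed.

Lemma Ck1_comp_lin (V W U : normedModType R) (L : W -> U) (f : V -> W) (O : set V) :
  open O -> linear L -> (exists C : R, forall v, `|L v| <= C * `|v|) ->
  Ck 1 O f -> Ck 1 O (fun z => L (f z)).
Proof.
move=> oO lL bL [fd fc].
have sL p := sdiff_linear p lL bL.
have DL z v : O z -> 'D_v (fun z => L (f z)) z = L ('D_v f z).
  move=> Oz; rewrite deriveE; last first.
    by apply: differentiable_comp (fd z Oz) (sdiff_differentiable (sL _)).
  rewrite diff_comp/=; [|exact: fd|exact: sdiff_differentiable (sL _)].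
  rewrite -deriveE; last exact: sdiff_differentiable (sL _).
  by have [_ ->] := sdiff_is_derive ('d f z v) (sL (f z)); rewrite deriveE//; exact: fd.
split=> [z Oz|v z Oz].
  by apply: differentiable_comp (fd z Oz) (sdiff_differentiable (sL _)).
have h : {for z, continuous (fun y => L ('D_v f y))}.
  apply: continuous_comp (fc v z Oz) _; exact: sdiff_continuous (sL _).
have nO : \forall y \near z, O y by apply: open_nbhs_nbhs.
move=> A; rewrite DL// => /h; apply: filterS2 nO => y Oy /=; by rewrite DL.
Qed.

Lemma Ck1_sdifferentiable_mx (V : normedModType R) m n (f : V -> 'M[R]_(m, n)) (O : set V) p :
  fin_basis V -> open O -> Ck 1 O f -> O p -> sdifferentiable f p.
Proof.
move=> bV oO Cf Op; exists (fun v => \matrix_(i, j) 'D_v (fun z => f z i j) p).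
apply: sdiff_mx => i j.
under [X in sdiff _ _ X]funext do rewrite mxE.
apply: (Ck1_sdiff bV oO _ Op).
apply: (Ck1_comp_lin (L := fun w : 'M[R]_(m, n) => w i j) oO) => //.
  by move=> a u v; rewrite !mxE.
by exists 1 => v; rewrite mul1r mx_coord_le.
Qed.

Lemma Ck1_sdifferentiable_pair (V W U : normedModType R) (f : V -> W * U) (O : set V) p :
  (forall h : V -> W, Ck 1 O h -> sdifferentiable h p) -> (forall h : V -> U, Ck 1 O h -> sdifferentiable h p) ->
  open O -> Ck 1 O f -> sdifferentiable f p.
Proof.
move=> hW hU oO Cf.
have [L sL] : sdifferentiable (fun z => (f z).1) p.
  apply: hW; apply: (Ck1_comp_lin (L := fst) oO) => //.
  by exists 1 => v; rewrite mul1r fst_norm_le.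
have [M sM] : sdifferentiable (fun z => (f z).2) p.
  apply: hU; apply: (Ck1_comp_lin (L := snd) oO) => //.
  by exists 1 => v; rewrite mul1r snd_norm_le.
exists (fun v => (L v, M v)); apply: (sdiff_ext _ _ (sdiff_pair sL sM)) => // z.
by case: (f z).
Qed.

Section schwarz.
Variable V : normedModType R.
Hypothesis bV : fin_basis V.

Let D2 (f : V -> R) u v p (s : R) : R :=
  f (p + s *: u + s *: v) - f (p + s *: u) - (f (p + s *: v) - f p).

(** The mean value inequality in the direction v, applied to the increment of f in the
    direction u, leaves an increment of D_v f, which strict differentiability controls. *)
Lemma second_difference (f : V -> R) u v p e : Ck 2 setT f -> 0 < e ->
  exists2 d : R, 0 < d & forall s, 0 < s < d ->
    `|D2 f u v p s - s ^+ 2 * 'D_u (fun z => 'D_v f z) p| <= e * s ^+ 2.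
Proof.
move=> [fd f2] e0.
have sg : sdiff (fun z => 'D_v f z) p (fun w => 'D_w (fun z => 'D_v f z) p).
  exact: (Ck1_sdiff bV openT (f2 v)).
have u0 : 0 < `|u| + 1 by rewrite ltr_wpDl.
have uv0 : 0 < `|u| + `|v| + 1 by rewrite ltr_wpDl// addr_ge0.
have [_ _ /(_ _ (divr_gt0 e0 u0)) /near2_normP[d d0 hd]] := sg.
exists (d / (`|u| + `|v| + 1)); first by rewrite divr_gt0.
move=> s /andP[s0 sld].
have svd : s * (`|u| + `|v|) < d.
  by rewrite ltr_pdivlMr// in sld; rewrite (le_lt_trans _ sld)// ler_pM2l// lerDl.
pose A := 'D_u (fun z => 'D_v f z) p.
have := @mean_value_le R
  (fun t => f (p + s *: u + t *: (s *: v)) - f (p + t *: (s *: v)) - t * (s ^+ 2 * A))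
  (fun t => 'D_(s *: v) f (p + s *: u + t *: (s *: v)) - 'D_(s *: v) f (p + t *: (s *: v)) - s ^+ 2 * A)
  (e * s ^+ 2).
rewrite !scale1r !scale0r !addr0 !mul1r !mul0r !subr0.
have -> : f (p + s *: u + s *: v) - f (p + s *: v) - s ^+ 2 * A - (f (p + s *: u) - f p)
    = D2 f u v p s - s ^+ 2 * A by rewrite /D2; ring.
apply.
  move=> t t01; apply: is_deriveB; last exact: is_derive_mulr.
  by apply: is_deriveB; apply: is_derive_line; apply: derivableP;
    apply: diff_derivable; apply: fd.
move=> t /andP[t0 t1].
have DZ z : 'D_(s *: v) f z = s * 'D_v f z.
  by rewrite !deriveE; [exact: linearZ|exact: fd|exact: fd].
rewrite !DZ.
have tv : `|t *: (s *: v)| <= s * `|v|.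
  rewrite !normrZ (ger0_norm t0) (gtr0_norm s0) ler_piMl// mulr_ge0// ltW//.
have := hd (p + s *: u + t *: (s *: v)) (p + t *: (s *: v)).
have -> : p + s *: u + t *: (s *: v) - (p + t *: (s *: v)) = s *: u.
  by rewrite opprD addrA [LHS](ACl ((1*4)*(3*5)*2))/= !subrr !add0r.
rewrite (sdiff_linZ sg) /=.
have k1 : `|p + s *: u + t *: (s *: v) - p| < d.
  rewrite -(addrA p) [p + _]addrC addrK (le_lt_trans (ler_normD _ _))// (le_lt_trans _ svd)//.
  by rewrite mulrDr lerD// normrZ gtr0_norm.
have k2 : `|p + t *: (s *: v) - p| < d.
  rewrite [p + _]addrC addrK (le_lt_trans tv)// (le_lt_trans _ svd)//.
  by rewrite mulrDr lerDr// mulr_ge0// ltW.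
move=> /(_ k1 k2) est.
rewrite expr2 -mulrA -!mulrBr normrM gtr0_norm// [e * _]mulrCA ler_pM2l//.
rewrite (le_trans est)// normrZ gtr0_norm// [e * s]mulrC mulrCA ler_pM2l//.
by rewrite mulrAC ler_pdivrMr// ler_pM2l// lerDl.
Qed.

(** The second difference is symmetric in u and v, and both mixed derivatives are its
    limit after division by s^2. *)
Theorem schwarz (f : V -> R) u v p : Ck 2 setT f ->
  'D_u (fun z => 'D_v f z) p = 'D_v (fun z => 'D_u f z) p.
Proof.
move=> f2; apply/eqP; rewrite -subr_eq0 -normr_le0; apply/ler_addgt0Pr => e e0.
rewrite add0r.
have e2 : 0 < e / 2 by rewrite divr_gt0.
have [d1 d10 h1] := second_difference u v p f2 e2.
have [d2 d20 h2] := second_difference v u p f2 e2.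
pose s := Num.min d1 d2 / 2.
have m0 : 0 < Num.min d1 d2 by rewrite lt_min d10.
have s0 : 0 < s by rewrite divr_gt0.
have sm : s < Num.min d1 d2 by rewrite ltr_pdivrMr// ltr_pMr// ltr1n.
have sd1 : 0 < s < d1 by rewrite s0 (lt_le_trans sm)// ge_min lexx.
have sd2 : 0 < s < d2 by rewrite s0 (lt_le_trans sm)// ge_min lexx orbT.
have := h1 s sd1; have := h2 s sd2.
have -> : D2 f v u p s = D2 f u v p s by rewrite /D2 [p + s *: v + _]addrAC; ring.
set A := 'D_u _ _; set B := 'D_v _ _; set D := D2 _ _ _ _ _ => k2 k1.
have s20 : 0 < s ^+ 2 by rewrite exprn_gt0.
rewrite -(ler_pM2l s20) -[X in X * `|_|]gtr0_norm// -normrM mulrBr.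
rewrite (le_trans (ler_distD D _ _))//.
apply: (@le_trans _ _ (e / 2 * s ^+ 2 + e / 2 * s ^+ 2)); first (apply: lerD; [rewrite distrC; exact: k1|exact: k2]).
by rewrite -mulrDl -splitr mulrC.
Qed.
End schwarz.
End Ck_sdiff.
(** * Real symmetric matrices *)

Section real_spectral.
Context {R : realType}.

Lemma row_dot_gt0 n (v : 'rV[R]_n) : v != 0 -> 0 < (v *m v^T) 0 0.
Proof.
move=> v0; rewrite mxE; under eq_bigr do rewrite mxE -expr2.
rewrite lt_neqAle sumr_ge0 ?andbT => [|i _]; last by rewrite sqr_ge0.
apply: contra_neq v0 => /esym/eqP; rewrite psumr_eq0 => [|i _]; last by rewrite sqr_ge0.
by move=> /allP h; apply/rowP => i; rewrite mxE; apply/eqP; rewrite -sqrf_eq0; apply: h; rewrite mem_index_enum.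
Qed.

(** The Householder reflection along e - v. *)
Lemma orthogonal_mapping n (e v : 'rV[R]_n) : e *m e^T = v *m v^T ->
  exists2 H : 'M[R]_n, H *m H^T = 1%:M & e *m H = v.
Proof.
move=> ev; have [<-|env] := eqVneq e v; first by exists 1%:M; rewrite ?trmx1 mulmx1.
pose u := e - v; pose c := (u *m u^T) 0 0.
have c0 : 0 < c by rewrite row_dot_gt0// subr_eq0.
have uu : u *m u^T = c%:M by rewrite [LHS]mx11_scalar.
have tuu : (u^T *m u)^T = u^T *m u by rewrite trmx_mul trmxK.
pose H : 'M[R]_n := 1%:M - (2 / c) *: (u^T *m u).
have HT : H^T = H.
  by rewrite /H raddfB /= trmx1; congr (_ - _); rewrite linearZ /= tuu.
exists H.
  rewrite HT /H mulmxBr mulmx1 mulmxBl mul1mx.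
  rewrite -scalemxAl -scalemxAr scalerA mulmxA -[u^T *m u *m u^T]mulmxA uu.
  rewrite mul_mx_scalar -scalemxAl scalerA.
  rewrite (_ : 2 / c * (2 / c) * c = 2 / c + 2 / c); last by field; exact: lt0r_neq0.
  by rewrite scalerDl opprB addrK subrK.
have eu : 2 *: (e *m u^T) = c%:M.
  have ve : v *m e^T = e *m v^T.
    have -> : e *m v^T = (v *m e^T)^T by rewrite trmx_mul trmxK.
    by apply/matrixP => i j; rewrite !ord1 [RHS]mxE.
  have uT : u^T = e^T - v^T by rewrite /u raddfB.
  by rewrite -uu uT /u !mulmxBr !mulmxBl ve -ev scaler_nat mulr2n opprB.
rewrite /H mulmxBr mulmx1 -scalemxAr mulmxA.
rewrite mulrC -scalerA scalemxAl eu mul_scalar_mx scalerA mulVf ?gt_eqF//.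
by rewrite scale1r opprB addrC subrK.
Qed.

(** The two square matrices have propositionally equal sizes, because the basis they
    differ by is the concatenation of two blocks. *)
Lemma char_poly_similar (F : comNzRingType) k n (e : k = n) (A : 'M[F]_n) (D : 'M[F]_k)
    (M : 'M[F]_(k, n)) (P : 'M[F]_(n, k)) :
  M *m P = 1%:M -> M *m A = D *m M -> char_poly A = char_poly D.
Proof.
case: n / e A M P => A M P MP MA.
rewrite /char_poly.
have : map_mx polyC M *m char_poly_mx A = char_poly_mx D *m map_mx polyC M.
  rewrite /char_poly_mx mulmxBr mulmxBl -!map_mxM MA.
  by rewrite mul_mx_scalar mul_scalar_mx.
move=> /(congr1 determinant); rewrite !det_mulmx mulrC => h.
have u : \det (map_mx polyC M) * \det (map_mx polyC P) = 1.
  by rewrite -det_mulmx -map_mxM MP map_mx1 det1.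
by rewrite -[LHS]mulr1 -[RHS]mulr1 -u !mulrA h.
Qed.

Lemma char_poly_diag_block (F : comNzRingType) k n (A : 'M[F]_k) (D : 'M[F]_n) :
  char_poly (block_mx A 0 0 D) = char_poly A * char_poly D.
Proof. by rewrite /char_poly char_block_diag_mx det_ublock. Qed.

Lemma char_poly11 (F : comNzRingType) (A : 'M[F]_1) : char_poly A = 'X - (A 0 0)%:P.
Proof. by rewrite /char_poly det_mx11 !mxE eqxx mulr1n. Qed.

(** The split characteristic polynomial provides a real eigenvalue: send the first
    basis vector to an eigenvector by an orthogonal matrix, split off a 1 x 1 block, and
    recurse. *)
Lemma orthogonal_diagonalization n (S : 'M[R]_n) (lam : 'rV[R]_n) :
  S^T = S -> char_poly S = \prod_i ('X - (lam 0 i)%:P) ->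
  exists2 P : 'M[R]_n, P *m P^T = 1%:M & P *m S *m P^T = diag_mx lam.
Proof.
elim: n S lam => [|n IH] S lam Ssym cS.
  by exists 1%:M; apply/matrixP => -[].
have /eigenvalueP[v vS v0] : eigenvalue S (lam 0 0).
  rewrite eigenvalue_root_char cS big_ord_recl /root hornerM hornerXsubC subrr mul0r.
  by rewrite eqxx.
have vv0 := row_dot_gt0 v0.
pose a := Num.sqrt ((v *m v^T) 0 0).
have a0 : 0 < a by rewrite sqrtr_gt0.
pose w := a^-1 *: v.
have ww : w *m w^T = 1%:M.
  rewrite [LHS]mx11_scalar; congr (_%:M).
  rewrite /w linearZ /= -scalemxAl -scalemxAr scalerA mxE.
  rewrite -invfM -expr2 sqr_sqrtr ?(ltW vv0)// mulVf//.
  exact: lt0r_neq0.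
have wS : w *m S = lam 0 0 *: w by rewrite -scalemxAl vS !scalerA mulrC.
pose e : 'rV[R]_(1 + n) := row_mx 1%:M 0.
have ee : e *m e^T = w *m w^T.
  by rewrite ww /e tr_row_mx mul_row_col trmx1 mulmx1 mul0mx addr0.
have [H HH eH] := orthogonal_mapping ee.
have HtH : H^T *m H = 1%:M by exact: mulmx1C.
pose S1 : 'M[R]_(1 + n) := H *m S *m H^T.
have S1sym : S1^T = S1 by rewrite /S1 !trmx_mul trmxK Ssym mulmxA.
have eS1 : e *m S1 = lam 0 0 *: e.
  by rewrite /S1 !mulmxA eH wS -scalemxAl -eH -mulmxA HH mulmx1.
have S1E : S1 = block_mx (lam 0 0)%:M 0 0 (drsubmx S1).
  have h : row_mx (ulsubmx S1) (ursubmx S1) = row_mx (lam 0 0)%:M 0.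
    move: eS1; rewrite -{1}(submxK S1) /e mul_row_block !mul1mx !mul0mx !addr0.
    by move=> ->; rewrite scale_row_mx scaler0 scalemx1.
  have [h1 h2] := eq_row_mx h.
  rewrite -{1}(submxK S1) h1 h2; congr block_mx.
  by rewrite -[dlsubmx S1]trmxK trmx_dlsub S1sym h2 trmx0.
have S1H : H *m S = S1 *m H by rewrite /S1 -mulmxA HtH mulmx1.
have cS1 : char_poly S = char_poly S1 by exact: (char_poly_similar erefl HH).
have cdr : char_poly (drsubmx S1) = \prod_i ('X - ((\row_j lam 0 (lift 0 j)) 0 i)%:P).
  move: cS1; rewrite [in char_poly S1]S1E char_poly_diag_block char_poly11 cS big_ord_recl mxE eqxx mulr1n.
  move=> /mulfI <- //; last by rewrite polyXsubC_eq0.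
  by apply: eq_bigr => i _; rewrite mxE.
have [|P PP PD] := IH _ _ _ cdr; first by rewrite trmx_drsub S1sym.
pose Q : 'M[R]_(1 + n) := block_mx 1%:M 0 0 P.
have QT : Q^T = block_mx 1%:M 0 0 P^T by rewrite /Q tr_block_mx !trmx0 trmx1.
have lamE : lam = row_mx (lam 0 0)%:M (\row_j lam 0 (lift 0 j)) :> 'rV[R]_(1 + n).
  apply/rowP => i; rewrite mxE; case: splitP => j ij; rewrite !mxE ?ord1 ?mulr1n.
    by congr (lam _ _); apply/ord_inj => /=; rewrite [LHS]ij ord1.
  by congr (lam _ _); apply/ord_inj => /=; rewrite [LHS]ij.
have QQ : Q *m Q^T = 1%:M.
  rewrite QT /Q mulmx_block PP.
  by rewrite !(mulmx0, mul0mx, mulmx1, addr0, add0r) -scalar_mx_block.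
have QD : Q *m S1 *m Q^T = diag_mx lam.
  rewrite S1E QT /Q !mulmx_block.
  rewrite !(mulmx0, mul0mx, mulmx1, mul1mx, addr0, add0r) PD.
  transitivity (@diag_mx R (1 + n) (row_mx (lam 0 0)%:M (\row_j lam 0 (lift 0 j))));
    last by rewrite [in RHS]lamE.
  rewrite diag_mx_row; congr block_mx.
  by apply/matrixP => i j; rewrite !ord1 !mxE mulr1n.
exists (Q *m H).
  by rewrite trmx_mul mulmxA -[_ *m H *m H^T]mulmxA HH mulmx1 QQ.
by rewrite trmx_mul mulmxA -[_ *m H *m S]mulmxA S1H mulmxA -[_ *m H *m H^T]mulmxA HH mulmx1.
Qed.

(** Peel off one root at a time: each removal lowers both the count in s and the
    multiplicity in q by one. *)
Lemma prod_XsubC_dvd (F : fieldType) (s : seq F) (q : {poly F}) : q != 0 ->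
  (forall a, (count_mem a s <= mup a q)%N) -> \prod_(a <- s) ('X - a%:P) %| q.
Proof.
elim: s q => [|a s IH] q q0 h; first by rewrite big_nil dvd1p.
have : 'X - a%:P %| q.
  by rewrite XsubC_dvd// (leq_trans _ (h a))//= eqxx.
move=> /dvdpP[q' qE].
have q'0 : q' != 0 by apply: contraNneq q0 => e; rewrite qE e mul0r.
rewrite big_cons qE mulrC dvdp_mul2r ?polyXsubC_eq0//.
apply: IH => // b; have := h b.
rewrite qE mupM ?polyXsubC_eq0//= -['X - a%:P]expr1 mup_XsubCX.
by case: (a == b) => /=; rewrite ?addn1 ?add1n ?addn0 ?add0n.
Qed.

End real_spectral.

(** * Coordinates adapted to the null space *)

Section adapted_basis.
Context {R : realType} (d k n : nat) (A : 'M[R]_d) (Kb : 'M[R]_(k, d)) (B : 'M[R]_(n, d)).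
Hypothesis kerbase_mul : Kb *m A = 0.
Hypothesis Kfree : row_free Kb.
Hypothesis orthobasis_ker : Kb *m B^T = 0.
Hypothesis BB : B *m B^T = 1%:M.
Hypothesis kn : (k + n = d)%N.

(** A basis of Ker A and an orthonormal basis of its orthocomplement together form
    a basis, and its inverse gives coordinates; those along B are given by B^T. *)
Lemma ker_coordinates : exists P1 : 'M[R]_(d, k),
  [/\ P1 *m Kb + B^T *m B = 1%:M, Kb *m P1 = 1%:M & B *m P1 = 0].
Proof.
pose M := col_mx Kb B.
have Mfree : row_free M.
  apply: inj_row_free => v; rewrite -(hsubmxK v) /M mul_row_col => h.
  have v2 : rsubmx v = 0.
    move/(congr1 (fun X => X *m B^T)): h.
    by rewrite mulmxDl -!mulmxA orthobasis_ker BB mulmx0 mulmx1 add0r mul0mx.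
  move: h; rewrite v2 mul0mx addr0 => /(congr1 (fun X => X *m pinvmx Kb)).
  by rewrite -mulmxA mulmxVp// mulmx1 mul0mx => ->; rewrite row_mx0.
have Mfull : row_full M by move: Mfree; rewrite /row_free /row_full => /eqP ->; rewrite kn.
have := mulVpmx Mfull; have := mulmxVp Mfree.
rewrite -(hsubmxK (pinvmx M)) {1 4}/M.
set P1 := lsubmx _; set P2 := rsubmx _.
rewrite mul_col_row mul_row_col (scalar_mx_block k n) => /eq_block_mx[e1 e2 e3 e4] e5.
exists P1; split=> //.
suff <- : P2 = B^T by [].
move/(congr1 (fun X => X *m B^T)): e5.
by rewrite mulmxDl -!mulmxA orthobasis_ker BB mulmx0 mulmx1 add0r mul1mx.
Qed.

(** The non-zero eigenvalues of A are those of S = B A B^T, since A is similar to the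
    block matrix diag(0, S). This makes char_poly S the product of the X - lam_i, so
    S is orthogonally similar to diag(lam), and rescaling by the |lam_i|^(-1/2) leaves
    the signs. *)
Lemma sign_congruence (J : 'M[R]_n) : A^T = A -> eigen_sign_mx A J -> exists2 T : 'M[R]_n, T \in unitmx &
  T *m (B *m A *m B^T) *m T^T = J.
Proof.
move=> Asym hJ; have [P1 [h1 h2 h3]] := ker_coordinates.
pose S := B *m A *m B^T.
have AB : A *m B^T *m B = A.
  move/(congr1 trmx): h1; rewrite linearD /= !trmx_mul trmxK trmx1.
  move/(congr1 (fun X => A *m X)); rewrite mulmxDr mulmx1 !mulmxA.
  have -> : A *m Kb^T = 0.
    by rewrite -[A *m _]trmxK trmx_mul trmxK Asym kerbase_mul trmx0.
  by rewrite mul0mx add0r.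
have Ssym : S^T = S by rewrite /S !trmx_mul trmxK Asym mulmxA.
pose M := col_mx Kb B; pose P := row_mx P1 B^T.
have MP : M *m P = 1%:M.
  by rewrite /M /P mul_col_row h2 h3 orthobasis_ker BB -scalar_mx_block.
have MA : M *m A = block_mx (0 : 'M[R]_k) 0 0 S *m M.
  rewrite /M mul_col_mx mul_block_col !mul0mx !addr0 add0r kerbase_mul.
  by congr col_mx; rewrite /S -!mulmxA mulmxA -[in LHS]AB !mulmxA.
have cA := char_poly_similar kn MP MA.
have cS0 : char_poly (0 : 'M[R]_k) = 'X^k.
  by rewrite /char_poly /char_poly_mx map_mx0 subr0 det_scalar.
rewrite char_poly_diag_block cS0 in cA.
have [lam [lam0 lamc JE]] := hJ.
have cS : char_poly S = \prod_i ('X - (lam 0 i)%:P).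
  have S0 : char_poly S != 0 by rewrite monic_neq0// char_poly_monic.
  have E : \prod_i ('X - (lam 0 i)%:P)
      = \prod_(a <- [seq lam 0 i | i <- enum 'I_n]) ('X - a%:P).
    by rewrite big_map big_enum.
  have dv : \prod_i ('X - (lam 0 i)%:P) %| char_poly S.
    rewrite E; apply: prod_XsubC_dvd => // a.
    have [->|a0] := eqVneq a 0.
      rewrite (_ : count _ _ = 0%N)//; apply/eqP; rewrite eqn0Ngt -has_count.
      by apply/hasPn => x /mapP[i _ ->] /=.
    have /= := lamc a a0; rewrite cA mupMr; last first.
      by rewrite rootE hornerXn expf_neq0.
    move=> <-; rewrite count_map cardsE cardE -size_filter enumT.
    by rewrite leq_eqVlt /enum_mem eqxx.
  apply/eqP; rewrite eq_sym -eqp_monic ?char_poly_monic ?monic_prod_XsubC//.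
  by rewrite -dvdp_size_eqp// size_char_poly E size_prod_XsubC size_map size_enum_ord eqxx.
have [Q QQ QS] := orthogonal_diagonalization Ssym cS.
pose D := diag_mx (\row_i (Num.sqrt `|lam 0 i|)^-1).
have sq i : Num.sqrt `|lam 0 i| != 0 by rewrite gt_eqF// sqrtr_gt0 normr_gt0.
exists (D *m Q).
  rewrite unitmx_mul; apply/andP; split; last first.
    by case: (mulmx1_unit QQ).
  rewrite unitmxE det_diag unitfE prodf_seq_neq0; apply/allP => i _ /=.
  by rewrite mxE invr_eq0 sq.
have -> : D *m Q *m (B *m A *m B^T) *m (D *m Q)^T = D *m (Q *m S *m Q^T) *m D^T.
  by rewrite trmx_mul !mulmxA.
rewrite QS tr_diag_mx JE; apply/matrixP => i j.
rewrite mul_diag_mx mul_mx_diag !mxE.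
case: eqVneq => [<-|_]; rewrite ?mulr0n ?mulr0 ?mul0r// !mulr1n.
rewrite mulrAC -expr2 exprVn sqr_sqrtr//.
by rewrite {2}[lam 0 i]numEsg mulrCA mulVf ?mulr1// normr_eq0.
Qed.
End adapted_basis.

Lemma orthocomp_ker (R : realType) d n (A : 'M[R]_d) (B : 'M[R]_(n, d)) :
  orthonormal_basis B (orthocomp (kermx A)) -> row_base (kermx A) *m B^T = 0.
Proof.
case=> _ hBK.
have : (B <= orthocomp (kermx A))%MS by rewrite hBK.
rewrite /orthocomp /orthomx mul1mx => /sub_kermxP; rewrite map_mx_id//= => BK.
have : (row_base (kermx A) <= kermx A)%MS by rewrite eq_row_base.
by move=> /submxP[D ->]; rewrite -mulmxA -[kermx A *m _]trmxK trmx_mul trmxK BK trmx0 mulmx0.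
Qed.
(** * Scalar product of rows *)

Section dot.
Context {R : realType} {n : nat}.
Definition dot (u v : 'rV[R]_n) : R := (u *m v^T) 0 0.

Lemma dotDl u u' v : dot (u + u') v = dot u v + dot u' v.
Proof. by rewrite /dot mulmxDl mxE. Qed.
Lemma dotDr u v v' : dot u (v + v') = dot u v + dot u v'.
Proof. by rewrite /dot raddfD /= mulmxDr mxE. Qed.
Lemma dotBl u u' v : dot (u - u') v = dot u v - dot u' v.
Proof. by rewrite /dot mulmxBl !mxE. Qed.
Lemma dotBr u v v' : dot u (v - v') = dot u v - dot u v'.
Proof. by rewrite /dot raddfB /= mulmxBr !mxE. Qed.
Lemma dotZl c u v : dot (c *: u) v = c * dot u v.
Proof. by rewrite /dot -scalemxAl mxE. Qed.
Lemma dotZr c u v : dot u (c *: v) = c * dot u v.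
Proof. by rewrite /dot linearZ /= -scalemxAr mxE. Qed.
Lemma dot0l v : dot 0 v = 0. Proof. by rewrite /dot mul0mx mxE. Qed.
Lemma dot0r v : dot v 0 = 0. Proof. by rewrite /dot trmx0 mulmx0 mxE. Qed.
Lemma dotC u v : dot u v = dot v u.
Proof.
rewrite /dot; have -> : v *m u^T = (u *m v^T)^T by rewrite trmx_mul trmxK.
by rewrite [RHS]mxE.
Qed.
Lemma dot_sym (A : 'M[R]_n) u v : A^T = A -> dot (u *m A) v = dot (v *m A) u.
Proof. by move=> As; rewrite dotC /dot trmx_mul As mulmxA. Qed.

Lemma norm_trmx (u : 'rV[R]_n) : `|u^T| <= `|u|.
Proof. by apply: mx_norm_le => // i j; rewrite mxE mx_coord_le. Qed.

Lemma norm_dot u v : `|dot u v| <= n%:R * `|u| * `|v|.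
Proof.
rewrite (le_trans (mx_coord_le _ _ _))// (le_trans (norm_mulmx _ _))//.
by rewrite ler_wpM2l ?mulr_ge0// norm_trmx.
Qed.

Lemma dot_ge u : `|u| ^+ 2 <= dot u u.
Proof.
have dE : dot u u = \sum_i u 0 i ^+ 2.
  by rewrite /dot mxE; apply: eq_bigr => i _; rewrite mxE expr2.
have d0 : 0 <= dot u u by rewrite dE sumr_ge0// => i _; rewrite sqr_ge0.
rewrite -(sqr_sqrtr d0) ler_sqr ?nnegrE ?sqrtr_ge0//.
apply: mx_norm_le => [|i j]; first exact: sqrtr_ge0.
rewrite -sqrtr_sqr ler_wsqrtr// dE !ord1 (bigD1 j)//= lerDl sumr_ge0// => k _.
exact: sqr_ge0.
Qed.

Lemma sdiff_dot (V : normedModType R) (F G : V -> 'rV[R]_n) p L M :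
  sdiff F p L -> sdiff G p M ->
  sdiff (fun z => dot (F z) (G z)) p (fun v => dot (L v) (G p) + dot (F p) (M v)).
Proof.
move=> sF sG; have := sdiff_coord 0 0 (sdiff_mulmx sF (sdiff_tr sG)).
by apply: sdiff_ext => // v; rewrite /dot mxE.
Qed.
End dot.

(** * Square roots of symmetric matrices depending on a parameter *)

Section matrix_sqrt.
Context {R : realType} (n : nat).

(** Y is the transpose of the square root X of J A(z) close to 1, obtained by inverting
    M |-> M^2 / 2 at the identity, where its derivative is the identity. Both X and
    J X^T J are such square roots, so local uniqueness makes them equal; this
    symmetry turns X^2 = J A into X^T J X = A. *)
Lemma symmetric_sqrt (E : normedModType R) (J : 'M[R]_n) (A : E -> 'M[R]_n) (z0 : E) :
  J^T = J -> J *m J = 1%:M -> A z0 = J ->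
  (\forall z \near z0, sdifferentiable A z /\ (A z)^T = A z) ->
  exists Y : E -> 'M[R]_n, Y z0 = 1%:M /\
    \forall z \near z0, sdifferentiable Y z /\ Y z *m J *m (Y z)^T = A z.
Proof.
move=> Jt JJ A0 hA.
pose f (M : 'M[R]_n) := 2^-1 *: (M *m M).
have sf M : sdiff f M (fun H => 2^-1 *: (H *m M + M *m H)).
  by apply: sdiffZl; apply: sdiff_mulmx; exact: sdiff_id.
have sf1 : sdiff f 1%:M id.
  apply: sdiff_ext (sf 1%:M) => // H.
  rewrite mulmx1 mul1mx -[H + H]mulr2n -[H *+ 2]scaler_nat scalerA mulVf ?scale1r//.
have nf : \forall M \near (1%:M : 'M[R]_n), exists L, sdiff f M L.
  by near=> M; exists (fun H => 2^-1 *: (H *m M + M *m H)).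
have [h [h1 h2 h3 h4 h5]] := local_inverse sf1 nf.
pose G z := 2^-1 *: (J *m A z).
have G0 : G z0 = f 1%:M by rewrite /G /f A0 JJ mulmx1.
have sG z : sdifferentiable A z -> sdifferentiable G z.
  by move=> [L sL]; eexists; apply: sdiffZl; apply: sdiff_mulmxl; exact: sL.
have sA0 : sdifferentiable A z0 by have [] := nbhs_singleton hA.
have [LG sLG] := sG _ sA0.
pose X z := h (G z).
have nG P : (\forall y \near f 1%:M, P y) -> \forall z \near z0, P (G z).
  by move=> nP; apply: (near_sdiff_comp sLG); rewrite G0.
have sX : \forall z \near z0, sdifferentiable X z.
  have := nG _ h5; apply: filterS2 hA => z [/sG[L sL] _] [M sM].
  by exists (fun v => M (L v)); exact: sdiff_comp sL sM.
have X0 : X z0 = 1%:M by rewrite /X G0.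
have XX : \forall z \near z0, X z *m X z = J *m A z.
  have := nG _ h2; apply: filterS => z hz.
  by apply: (@scalerI _ _ (2^-1 : R)); [rewrite invr_eq0|exact: hz].
have [LX sLX] : sdifferentiable X z0 by exact: nbhs_singleton sX.
have sXt : sdiff (fun z => J *m (X z)^T *m J) z0 (fun v => J *m (LX v)^T *m J).
  by apply: sdiff_mulmxr; apply: sdiff_mulmxl; exact: sdiff_tr.
have nX : \forall z \near z0, h (f (X z)) = X z.
  have := @near_sdiff_comp _ _ _ X z0 LX (fun M => h (f M) = M) sLX.
  by rewrite X0; exact.
have nXt : \forall z \near z0, h (f (J *m (X z)^T *m J)) = J *m (X z)^T *m J.
  have := @near_sdiff_comp _ _ _ _ z0 _ (fun M => h (f M) = M) sXt.
  by rewrite X0 trmx1 mulmx1 JJ; exact.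
exists (fun z => (X z)^T); rewrite X0 trmx1; split=> //.
near=> z.
have [_ As] : sdifferentiable A z /\ (A z)^T = A z by near: z.
have XXz : X z *m X z = J *m A z by near: z.
have e1 : h (f (X z)) = X z by near: z.
have e2 : h (f (J *m (X z)^T *m J)) = J *m (X z)^T *m J by near: z.
split.
  have [L sL] : sdifferentiable X z by near: z.
  by exists (fun v => (L v)^T); exact: sdiff_tr.
have XJ : J *m (X z)^T *m J = X z.
  rewrite -e2 -[RHS]e1; congr (h _); rewrite /f; congr (_ *: _).
  rewrite !mulmxA -[_ *m J *m J]mulmxA JJ mulmx1 -[_ *m _ *m (X z)^T]mulmxA -trmx_mul.
  by rewrite XXz trmx_mul Jt As mulmxA -mulmxA JJ mulmx1.
rewrite trmxK.
have -> : (X z)^T *m J = J *m X z by rewrite -[in RHS]XJ !mulmxA JJ mul1mx.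
by rewrite -mulmxA XXz mulmxA JJ mul1mx.
Unshelve. all: by end_near. Qed.
End matrix_sqrt.

(** * Functions of order two in the second variable *)

Section quadratic_class.
Context {R : realType} {E : normedModType R} {n : nat}.
Implicit Types (phi : E * 'rV[R]_n -> R) (z : E).

(** The difference estimate of a function of (z, s) that is homogeneous of degree 2 in s.
    It is what makes quotients of such functions tractable at s = 0. *)
Definition flat_at phi z (al : R) :=
  \forall q \near ((z, 0 : 'rV[R]_n), (z, 0 : 'rV[R]_n)),
    `|phi q.1 - phi q.2| <= al * Num.max `|q.1.2| `|q.2.2| * `|q.1 - q.2|.

Lemma norm_to_section (P : E * 'rV[R]_n) : `|P - (P.1, 0)| = `|P.2|.
Proof.
case: P => z s /=; rewrite -[(_, _) - _]/(z - z, s - 0) subrr subr0 prod_normE /= normr0.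
exact: (max_idPr (normr_ge0 _)).
Qed.

Lemma near_section z (Q : E * 'rV[R]_n -> E * 'rV[R]_n -> Prop) :
  (\forall q \near ((z, 0 : 'rV[R]_n), (z, 0 : 'rV[R]_n)), Q q.1 q.2) ->
  \forall P \near (z, 0 : 'rV[R]_n), Q P (P.1, 0).
Proof.
move=> /near2_normP[d d0 hd]; apply/near_normP; exists d => // -[z' s] hP.
apply: (hd (z', s) (z', 0) hP).
apply: le_lt_trans hP; rewrite -[(_, _) - _]/(z' - z, 0 - 0) -[((z', s) : E * _) - _]/(z' - z, s - 0).
by rewrite !prod_normE /= subrr normr0 ge_max !le_max lexx normr_ge0.
Qed.

Lemma flat_bound phi z al : (forall z', phi (z', 0) = 0) -> flat_at phi z al ->
  \forall P \near (z, 0 : 'rV[R]_n), `|phi P| <= al * `|P.2| ^+ 2.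
Proof.
move=> p0 /(@near_section z (fun a b =>
  `|phi a - phi b| <= al * Num.max `|a.2| `|b.2| * `|a - b|)).
apply: filterS => P; rewrite /= norm_to_section p0 subr0 normr0.
by rewrite (max_idPl (normr_ge0 _)) expr2 mulrA.
Qed.

Lemma lip_section (W : normedModType R) (F : E * 'rV[R]_n -> W) z L :
  sdiff F (z, 0) L -> (forall z', F (z', 0) = 0) ->
  exists2 C, 0 < C & (\forall P \near (z, 0 : 'rV[R]_n), `|F P| <= C * `|P.2|) /\
    (\forall q \near ((z, 0 : 'rV[R]_n), (z, 0 : 'rV[R]_n)), `|F q.1 - F q.2| <= C * `|q.1 - q.2|).
Proof.
move=> sF F0; have [C C0 hC] := sdiff_lip sF; exists C => //; split=> //.
move: hC => /(@near_section z (fun a b => `|F a - F b| <= C * `|a - b|)).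
by apply: filterS => P; rewrite norm_to_section F0 subr0.
Qed.

Lemma flat_dot (F G : E * 'rV[R]_n -> 'rV[R]_n) z :
  sdifferentiable F (z, 0) -> sdifferentiable G (z, 0) -> (forall z', F (z', 0) = 0) -> (forall z', G (z', 0) = 0) ->
  exists2 al, 0 < al & flat_at (fun P => dot (F P) (G P)) z al.
Proof.
move=> [L sL] [M sM] F0 G0.
have [C C0 [bF hC]] := lip_section sL F0; have [D D0 [bG hD]] := lip_section sM G0.
exists (n%:R * (C * D + C * D) + 1).
  by rewrite ltr_wpDl// mulr_ge0// addr_ge0// mulr_ge0// ltW.
rewrite /flat_at; near=> q.
have h1 : `|F q.1| <= C * `|q.1.2| by near: q; exact: near_fst bF.
have h2 : `|G q.2| <= D * `|q.2.2| by near: q; exact: near_snd bG.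
have h3 : `|F q.1 - F q.2| <= C * `|q.1 - q.2| by near: q.
have h4 : `|G q.1 - G q.2| <= D * `|q.1 - q.2| by near: q.
set m := Num.max _ _.
have m1 : `|q.1.2| <= m by rewrite le_max lexx.
have m2 : `|q.2.2| <= m by rewrite le_max lexx orbT.
have -> : dot (F q.1) (G q.1) - dot (F q.2) (G q.2)
    = dot (F q.1) (G q.1 - G q.2) + dot (F q.1 - F q.2) (G q.2).
  by rewrite dotBr dotBl addrA subrK.
apply: (@le_trans _ _ (n%:R * (C * D + C * D) * m * `|q.1 - q.2|)); last first.
  by rewrite ler_wpM2r// ler_wpM2r// ?lerDl// (le_trans _ m1).
rewrite (le_trans (ler_normD _ _))//.
rewrite (le_trans (lerD (norm_dot _ _) (norm_dot _ _)))//.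
have k1 : `|F q.1| * `|G q.1 - G q.2| <= C * m * (D * `|q.1 - q.2|).
  by apply: ler_pM => //; rewrite (le_trans h1)// ler_wpM2l// ltW.
have k2 : `|F q.1 - F q.2| * `|G q.2| <= C * `|q.1 - q.2| * (D * m).
  by apply: ler_pM => //; rewrite (le_trans h2)// ler_wpM2l// ltW.
rewrite -!mulrA -mulrDr !mulrA; apply: (le_trans (ler_wpM2l _ (lerD k1 k2))) => //.
by rewrite le_eqVlt; apply/orP; left; apply/eqP; ring.
Unshelve. all: by end_near. Qed.

(** The quotient is bounded but singular at s = 0: its Lipschitz constant blows up like
    1 / |s|, and the factor min(|s|, |s'|) compensates for this. *)
Lemma flat_quotient phi N z al be c : 0 < c -> 0 <= al -> 0 <= be ->
  (forall z', phi (z', 0) = 0) -> (forall z', N (z', 0) = 0) ->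
  flat_at phi z al -> flat_at N z be ->
  (\forall P \near (z, 0 : 'rV[R]_n), c * `|P.2| ^+ 2 <= N P) ->
  (\forall P \near (z, 0 : 'rV[R]_n), `|phi P / N P| <= al / c) /\
  (\forall q \near ((z, 0 : 'rV[R]_n), (z, 0 : 'rV[R]_n)),
    Num.min `|q.1.2| `|q.2.2| * `|phi q.1 / N q.1 - phi q.2 / N q.2|
      <= (al / c + al * be / c ^+ 2) * `|q.1 - q.2|).
Proof.
move=> c0 al0 be0 p0 N0 fp fN hN; have bp := flat_bound p0 fp.
split.
  near=> P; have h1 : `|phi P| <= al * `|P.2| ^+ 2 by near: P.
  have h2 : c * `|P.2| ^+ 2 <= N P by near: P.
  have [s0|s0] := eqVneq `|P.2| 0.
    move: h1; rewrite s0 expr0n mulr0 normr_le0 => /eqP ->.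
    by rewrite mul0r normr0 divr_ge0// ltW.
  have {}s0 : 0 < `|P.2| ^+ 2 by rewrite exprn_gt0// lt_neqAle eq_sym s0 normr_ge0.
  have n1 : 0 < N P by rewrite (lt_le_trans _ h2)// mulr_gt0.
  rewrite normrM normfV (gtr0_norm n1) ler_pdivrMr// (le_trans h1)//.
  by rewrite -mulrA ler_wpM2l// -ler_pdivrMl ?invr_gt0// invrK.
have main P P' D : 0 <= D -> `|P.2| <= `|P'.2| -> `|phi P| <= al * `|P.2| ^+ 2 ->
    c * `|P.2| ^+ 2 <= N P -> c * `|P'.2| ^+ 2 <= N P' ->
    `|phi P' - phi P| <= al * `|P'.2| * D -> `|N P' - N P| <= be * `|P'.2| * D ->
    `|P.2| * `|phi P' / N P' - phi P / N P| <= (al / c + al * be / c ^+ 2) * D.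
  move=> D0; set x := `|P.2|; set y := `|P'.2| => xy hp hN1 hN2 dp dN.
  have C0 : 0 <= al / c + al * be / c ^+ 2.
    by rewrite addr_ge0// ?divr_ge0 ?mulr_ge0 ?exprn_ge0// ltW.
  have [x0|x0] := eqVneq x 0; first by rewrite x0 mul0r mulr_ge0.
  have {}x0 : 0 < x by rewrite lt_neqAle eq_sym x0 /x normr_ge0.
  have y0 : 0 < y by exact: lt_le_trans xy.
  have n1 : 0 < N P by rewrite (lt_le_trans _ hN1)// mulr_gt0// exprn_gt0.
  have n2 : 0 < N P' by rewrite (lt_le_trans _ hN2)// mulr_gt0// exprn_gt0.
  have -> : phi P' / N P' - phi P / N P
      = (phi P' - phi P) / N P' - phi P * (N P' - N P) / (N P * N P').
    by field; rewrite !gt_eqF.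
  apply: (@le_trans _ _ (x * (al * y * D / (c * y ^+ 2))
      + x * (al * x ^+ 2 * (be * y * D) / (c * x ^+ 2 * (c * y ^+ 2))))).
    rewrite -mulrDr ler_wpM2l// ?(ltW x0)// (le_trans (ler_normB _ _))// lerD//.
      rewrite normrM normfV (gtr0_norm n2) ler_pM ?invr_ge0 ?(ltW n2)//.
      by rewrite lef_pV2 ?posrE// mulr_gt0// exprn_gt0.
    rewrite normrM normfV (gtr0_norm (mulr_gt0 n1 n2)) ler_pM//.
    - by rewrite invr_ge0 ltW// mulr_gt0.
    - by rewrite normrM ler_pM.
    rewrite lef_pV2 ?posrE ?mulr_gt0 ?exprn_gt0// ler_pM// mulr_ge0 ?exprn_ge0// ltW//.
  have -> : x * (al * y * D / (c * y ^+ 2))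
      + x * (al * x ^+ 2 * (be * y * D) / (c * x ^+ 2 * (c * y ^+ 2)))
      = (al / c + al * be / c ^+ 2) * D * (x / y).
    by field; rewrite !gt_eqF.
  by rewrite ler_piMr ?mulr_ge0// ler_pdivrMr// mul1r.
near=> q.
have hp1 : `|phi q.1| <= al * `|q.1.2| ^+ 2 by near: q; exact: near_fst bp.
have hp2 : `|phi q.2| <= al * `|q.2.2| ^+ 2 by near: q; exact: near_snd bp.
have hN1 : c * `|q.1.2| ^+ 2 <= N q.1 by near: q; exact: near_fst hN.
have hN2 : c * `|q.2.2| ^+ 2 <= N q.2 by near: q; exact: near_snd hN.
have dp : `|phi q.1 - phi q.2| <= al * Num.max `|q.1.2| `|q.2.2| * `|q.1 - q.2| by near: q.
have dN : `|N q.1 - N q.2| <= be * Num.max `|q.1.2| `|q.2.2| * `|q.1 - q.2| by near: q.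
have [h|/ltW h] := leP `|q.1.2| `|q.2.2|.
  rewrite distrC; apply: main => //.
    by rewrite distrC (le_trans dp)// (max_idPr h).
  by rewrite distrC (le_trans dN)// (max_idPr h).
apply: main => //; first by rewrite (le_trans dp)// (max_idPl h).
by rewrite (le_trans dN)// (max_idPl h).
Unshelve. all: by end_near. Qed.

End quadratic_class.

(** * The Taylor remainder *)

Section remainder.
Context {R : realType} {E : normedModType R} {n : nat}.
Variables (k : E * 'rV[R]_n -> R) (f : E * 'rV[R]_n -> 'rV[R]_n) (A : E -> 'M[R]_n) (z : E).
Hypothesis k0 : forall z', k (z', 0) = 0.
Hypothesis f0 : \forall z' \near z, f (z', 0) = 0.
Hypothesis hA : \forall z' \near z, sdifferentiable A z' /\ (A z')^T = A z'.
Hypothesis hk : \forall P \near (z, 0 : 'rV[R]_n),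
  exists2 L, sdiff k P L & forall v, L (0, v) = dot (f P) v.
Hypothesis hf : sdiff f (z, 0) (fun v => v.2 *m A z).

(** Twice the second order Taylor remainder of k at s = 0. *)
Definition remainder (P : E * 'rV[R]_n) : R := 2 * k P - dot (P.2 *m A P.1) P.2.

Lemma remainder0 z' : remainder (z', 0) = 0.
Proof. by rewrite /remainder k0 mulr0 dot0r subr0. Qed.

Lemma remainder_derive : \forall P \near (z, 0 : 'rV[R]_n), forall v : 'rV[R]_n,
  is_derive P (0, v) remainder (2 * dot (f P) v - 2 * dot (P.2 *m A P.1) v).
Proof.
near=> P.
have [L sL LE] : exists2 L, sdiff k P L & forall v, L (0, v) = dot (f P) v by near: P.
have [[M sM] As] : sdifferentiable A P.1 /\ (A P.1)^T = A P.1 by near: P; exact: near_fst hA.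
move=> v.
have s1 := sdiff_comp (sdiff_fst P) sM.
have s2 := sdiff_mulmx (sdiff_snd P) s1.
have s3 := sdiffB (sdiffZl 2 sL) (sdiff_dot s2 (sdiff_snd P)).
have := sdiff_is_derive (0, v) s3 => /=.
rewrite LE (sdiff_lin0 sM) mulmx0 addr0 (dot_sym _ _ As) -mulr2n -[dot _ _ *+ 2]mulr_natl.
by [].
Unshelve. all: by end_near. Qed.

Lemma remainder_line (z' : E) (s v : 'rV[R]_n) (t : R) :
  is_derive (z', s + t *: v) (0, v) remainder
    (2 * dot (f (z', s + t *: v)) v - 2 * dot ((s + t *: v) *m A z') v) ->
  is_derive t (1 : R) (fun t => remainder (z', s + t *: v))
    (2 * dot (f (z', s + t *: v) - (s + t *: v) *m A z') v).
Proof.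
move=> h; rewrite dotBl mulrBr.
have := @is_derive_line R _ _ remainder (z', s) (0, v) t _.
rewrite -[(z', s) + t *: (0, v)]/(z' + t *: 0, s + t *: v) scaler0 addr0 => /(_ _ h).
congr (is_derive _ _ _ _); apply/funext => t'.
by rewrite -[(z', s) + t' *: (0, v)]/(z' + t' *: 0, s + t' *: v) scaler0 addr0.
Qed.

(** The remainder is o(|s|^2) in the sense of flat_at: move s
    first and z next, each time applying the mean value inequality along a segment
    in the s direction. Along it the derivative of the remainder is 2 (f - s A), which
    the strict derivative of f at (z, 0) makes o(|s|); and since f vanishes at s = 0
    near z, that strict derivative ignores displacements of z, so the increments of f
    in z are o of these displacements. *)
Lemma flat_remainder e : 0 < e -> flat_at remainder z e.
Proof.
move=> e0.
have [[LA sLA] As] := nbhs_singleton hA.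
have [C C0 hC] := sdiff_lip sLA.
pose K : R := 2 * n%:R * (1 + n%:R) + 2 * n%:R * (1 + n%:R * C).
have K0 : 0 <= K by rewrite addr_ge0// !mulr_ge0// addr_ge0// mulr_ge0// ltW.
(* With this e1, the two steps below add up to at most e. *)
have [e1 e10 e1K] : exists2 e1 : R, 0 < e1 & (K + 1) * e1 = e.
  exists (e / (K + 1)); first by rewrite divr_gt0// ltr_wpDl.
  by rewrite mulrC divfK// gt_eqF// ltr_wpDl.
have [_ _ /(_ e1 e10) /near2_normP[d1 d10 hd1]] := hf.
have [d2 d20 hd2] : exists2 d : R, 0 < d & forall P, `|P - (z, 0 : 'rV[R]_n)| < d ->
    f (P.1, 0) = 0 /\ `|A P.1 - A z| <= e1 /\
    forall v, is_derive P (0, v) remainder (2 * dot (f P) v - 2 * dot (P.2 *m A P.1) v).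
  apply/near_normP.
  have cA : \forall z' \near z, `|A z - A z'| < e1.
    by have /cvgrPdist_lt := sdiff_continuous sLA; apply.
  have := remainder_derive; have := near_fst (0 : 'rV[R]_n) f0; have := near_fst (0 : 'rV[R]_n) cA.
  apply: filterS3 => P h1 h2 h3; split=> //; split=> //.
  by rewrite distrC ltW.
have /near2_normP[d3 d30 hd3] := hC.
pose d := Num.min (Num.min d1 d2) (Num.min d3 e1).
apply/near2_normP; exists d; first by rewrite !lt_min d10 d20 d30.
move=> [z1 s1] [z2 s2]; rewrite -[(z1, s1) - _]/(z1 - z, s1 - 0) -[(z2, s2) - _]/(z2 - z, s2 - 0).
rewrite !subr0 !prod_normE /= !gt_max => /andP[z1d s1d] /andP[z2d s2d].
set m := Num.max _ _.
have inball z' (s : 'rV[R]_n) : `|z' - z| < d -> `|s| < d -> `|(z', s) - (z, 0 : 'rV[R]_n)| < d.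
  by move=> h1 h2; rewrite -[(z', s) - _]/(z' - z, s - 0) subr0 prod_normE gt_max h1.
have md : m < d by rewrite gt_max s1d s2d.
have dd1 : d <= d1 by rewrite !ge_min lexx.
have dd2 : d <= d2 by rewrite !ge_min lexx orbT.
have dd3 : d <= d3 by rewrite !ge_min lexx !orbT.
have dde : d <= e1 by rewrite !ge_min lexx !orbT.
have m0 : 0 <= m by rewrite le_max normr_ge0.
set D := Num.max `|z1 - z2| `|s1 - s2|.
have Dz : `|z1 - z2| <= D by rewrite le_max lexx.
have Ds : `|s1 - s2| <= D by rewrite le_max lexx orbT.
have D0 : 0 <= D by rewrite le_max normr_ge0.
have step1 : `|remainder (z1, s1) - remainder (z1, s2)| <= 2 * n%:R * (1 + n%:R) * e1 * m * D.
  have := @mean_value_le R (fun t => remainder (z1, s2 + t *: (s1 - s2)))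
    (fun t => 2 * dot (f (z1, s2 + t *: (s1 - s2)) - (s2 + t *: (s1 - s2)) *m A z1) (s1 - s2))
    (2 * n%:R * (1 + n%:R) * e1 * m * D).
  rewrite scale1r scale0r addr0 [s2 + (_ - _)]addrC subrK; apply => t t01.
    apply: remainder_line.
    have std : `|s2 + t *: (s1 - s2)| < d.
      by have := @convex_ball R _ s1 s2 0 t d t01; rewrite !subr0; apply.
    by have [_ [_]] := hd2 _ (lt_le_trans (inball _ _ z1d std) dd2); apply.
  set st := s2 + t *: (s1 - s2).
  have stm : `|st| <= m.
    have /andP[t0 t1] := t01.
    have -> : st = t *: s1 + (1 - t) *: s2.
      by rewrite /st scalerBr scalerBl scale1r addrCA.
    rewrite (le_trans (ler_normD _ _))// !normrZ (ger0_norm t0) ger0_norm ?subr_ge0//.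
    have -> : m = t * m + (1 - t) * m by ring.
    by rewrite lerD// ler_wpM2l ?subr_ge0// le_max lexx ?orbT.
  have std := le_lt_trans stm md.
  have [_ [Az _]] := hd2 _ (lt_le_trans (inball _ _ z1d std) dd2).
  have f10 : f (z1, 0) = 0.
    by have [] := hd2 _ (lt_le_trans (inball _ _ z1d std) dd2).
  have nn0 : `|(0 : 'rV[R]_n)| < d by rewrite normr0 (le_lt_trans m0).
  have est : `|f (z1, st) - st *m A z| <= e1 * `|st|.
    have := hd1 (z1, st) (z1, 0) (lt_le_trans (inball _ _ z1d std) dd1)
      (lt_le_trans (inball _ _ z1d nn0) dd1).
    rewrite /= f10 subr0.
    rewrite -[((z1, st) : E * _) - (z1, 0)]/(z1 - z1, st - 0) /= subr0 subrr prod_normE /= normr0.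
    by rewrite (max_idPr (normr_ge0 _)).
  rewrite normrM ger0_norm// -!mulrA ler_wpM2l// (le_trans (norm_dot _ _))// -!mulrA ler_wpM2l//.
  rewrite !mulrA ler_pM//.
  rewrite (le_trans (ler_distD (st *m A z) _ _))// mulrDl mul1r mulrDl lerD//.
    by rewrite (le_trans est)// ler_wpM2l// ltW.
  rewrite -mulmxBr (le_trans (norm_mulmx _ _))// -!mulrA ler_wpM2l//.
  by rewrite [e1 * m]mulrC ler_pM// distrC.
(* The remainders at z1 and z2 agree at s = 0, so it suffices to bound the derivative of
   their difference along t |-> t s2. *)
have step2 : `|remainder (z1, s2) - remainder (z2, s2)| <= 2 * n%:R * (1 + n%:R * C) * e1 * m * D.
  have := @mean_value_le R (fun t => remainder (z1, 0 + t *: s2) - remainder (z2, 0 + t *: s2))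
    (fun t => 2 * dot (f (z1, 0 + t *: s2) - (0 + t *: s2) *m A z1) s2
            - 2 * dot (f (z2, 0 + t *: s2) - (0 + t *: s2) *m A z2) s2)
    (2 * n%:R * (1 + n%:R * C) * e1 * m * D).
  rewrite !scale1r !scale0r !add0r !remainder0 !subr0.
  have tsd t : 0 <= t <= 1 -> `|0 + t *: s2| <= `|s2|.
    by move=> /andP[t0 t1]; rewrite add0r normrZ ger0_norm// ler_piMl.
  apply=> t t01; have std := le_lt_trans (tsd t t01) s2d.
    apply: is_deriveB; apply: remainder_line.
      by have [_ [_]] := hd2 _ (lt_le_trans (inball _ _ z1d std) dd2); apply.
    by have [_ [_]] := hd2 _ (lt_le_trans (inball _ _ z2d std) dd2); apply.
  have tsm := tsd t t01; move: std tsm; set st := 0 + t *: s2 => std tsm.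
  have est : `|f (z1, st) - f (z2, st)| <= e1 * `|z1 - z2|.
    have := hd1 (z1, st) (z2, st) (lt_le_trans (inball _ _ z1d std) dd1)
      (lt_le_trans (inball _ _ z2d std) dd1).
    rewrite /= -[((z1, st) : E * _) - (z2, st)]/(z1 - z2, st - st) /= subrr mul0mx subr0 prod_normE /= normr0.
    by rewrite (max_idPl (normr_ge0 _)).
  rewrite -mulrBr -dotBl normrM ger0_norm// -!mulrA ler_wpM2l// (le_trans (norm_dot _ _))// -!mulrA ler_wpM2l//.
  have s2m : `|s2| <= m by rewrite le_max lexx orbT.
  rewrite [m * D]mulrC !mulrA ler_pM//.
  have -> : f (z1, st) - st *m A z1 - (f (z2, st) - st *m A z2)
      = (f (z1, st) - f (z2, st)) - st *m (A z1 - A z2).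
    by rewrite mulmxBr !opprB !addrA [LHS](ACl (1*4*3*2)).
  rewrite (le_trans (ler_normB _ _))// mulrDl mul1r mulrDl lerD//.
    by rewrite (le_trans est)// ler_wpM2l// ltW.
  rewrite (le_trans (norm_mulmx _ _))// -!mulrA ler_wpM2l//.
  have lipA := hd3 z1 z2 (lt_le_trans z1d dd3) (lt_le_trans z2d dd3).
  rewrite [C * _]mulrCA ler_pM//.
    by rewrite (le_trans (ltW std)).
  by rewrite (le_trans lipA)// ler_wpM2l// ltW.
rewrite (le_trans (ler_distD (remainder (z1, s2)) _ _))//.
apply: (le_trans (lerD step1 step2)).
apply: (@le_trans _ _ (K * e1 * m * D)).
  by rewrite le_eqVlt; apply/orP; left; apply/eqP; rewrite /K; ring.
by rewrite ler_wpM2r// ler_wpM2r// -e1K ler_pM2r// lerDl.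
Qed.
End remainder.
(** * The correction term *)

Section correction.
Context {R : realType} {E : normedModType R} {n : nat}.

(** The root a of 2 a + a^2 e = b that is small with b, written in terms of b and b e:
    this form has no singularity at e = 0. *)
Definition damped (x : R * R) : R := x.1 * (1 + Num.sqrt (1 + x.2))^-1.

Lemma sdifferentiable_damped (x : R * R) : 0 < 1 + x.2 -> sdifferentiable damped x.
Proof.
move=> x0.
have s1 : sdiff (fun y : R * R => 1 + y.2) x (fun v => 0 + v.2).
  by apply: sdiffD; [exact: sdiff_cst|exact: sdiff_snd].
have s2 := sdiff_sqrt (f := fun y : R * R => 1 + y.2) x0 s1.
have s3 := sdiffD (sdiff_cst x (1 : R)) s2.
have nz : 1 + Num.sqrt (1 + x.2) != 0 by rewrite gt_eqF// ltr_pwDl// sqrtr_ge0.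
have s4 := sdiff_inv (f := fun y : R * R => 1 + Num.sqrt (1 + y.2)) nz s3.
by eexists; exact: sdiffM (sdiff_fst x) s4.
Qed.

Lemma damped_le (x : R * R) : `|damped x| <= `|x.1|.
Proof.
rewrite /damped normrM normfV ler_piMr// invf_le1.
  by rewrite ger0_norm ?lerDl ?sqrtr_ge0// addr_ge0// sqrtr_ge0.
by rewrite normr_gt0 gt_eqF// ltr_pwDl// sqrtr_ge0.
Qed.

Lemma dampedE (b e : R) : 0 <= 1 + b * e ->
  2 * damped (b, b * e) + damped (b, b * e) ^+ 2 * e = b.
Proof.
move=> h; rewrite /damped /=; set S := Num.sqrt _.
have S0 : 1 + S != 0 by rewrite gt_eqF// ltr_pwDl// sqrtr_ge0.
have SS : S ^+ 2 = 1 + b * e by rewrite sqr_sqrtr.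
have -> : 2 * (b / (1 + S)) + (b / (1 + S)) ^+ 2 * e
    = b * (2 * (1 + S) + b * e) / (1 + S) ^+ 2 by field.
have -> : b * e = S ^+ 2 - 1 by rewrite SS; ring.
by field.
Qed.

(** A Lipschitz estimate whose constant may blow up like 1 / |s|, as it does for the
    quotients of flat_quotient. *)
Definition min_lip (b : E * 'rV[R]_n -> R) (z : E) (C : R) :=
  \forall q \near ((z, 0 : 'rV[R]_n), (z, 0 : 'rV[R]_n)),
    Num.min `|q.1.2| `|q.2.2| * `|b q.1 - b q.2| <= C * `|q.1 - q.2|.

(** The factor of w need not be differentiable at s = 0, but it tends to 0 there, and its
    variation times |s| is o of the displacement. As |w| is at most a multiple of |s|,
    the product has the strict derivative 0. *)
Lemma sdiff_correction (b e : E * 'rV[R]_n -> R) (w : E * 'rV[R]_n -> 'rV[R]_n) (z : E) L :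
  (forall h : R, 0 < h -> (\forall P \near (z, 0 : 'rV[R]_n), `|b P| <= h) /\ min_lip b z h) ->
  (exists2 C : R, 0 < C & (\forall P \near (z, 0 : 'rV[R]_n), `|e P| <= C) /\ min_lip e z C) ->
  sdiff w (z, 0) L -> (forall z', w (z', 0) = 0) ->
  sdiff (fun P => damped (b P, b P * e P) *: w P) (z, 0) (fun=> 0).
Proof.
move=> hb [C C0 [eC eL]] sw w0; split.
- by move=> a u v; rewrite scaler0 addr0.
- by exists 0 => v; rewrite normr0 mul0r.
move=> ep ep0.
have [D D0 [wD wL]] := lip_section sw w0.
have [LP sP] : sdifferentiable damped (0, 0) by apply: sdifferentiable_damped; rewrite addr0.
have [K K0 /near2_normP[d d0 hK]] := sdiff_lip sP.
pose T : R := D * (1 + K * (1 + 2 * C)).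
have T0 : 0 < T by rewrite mulr_gt0// ltr_pwDl// mulr_ge0 ?(ltW K0)// addr_ge0// mulr_ge0// ltW.
have C10 : 0 < C + 1 by rewrite addr_gt0.
(* The first bound absorbs the final constant T; the second keeps (b, b e) in the ball
   of radius d where damped is Lipschitz. *)
pose h := Num.min (ep / T) (d / 2 / (C + 1)).
have h0 : 0 < h by rewrite lt_min !divr_gt0.
have hT : h * T <= ep by rewrite -ler_pdivlMr// ge_min lexx.
have hd : h * (C + 1) < d.
  apply: (@le_lt_trans _ _ (d / 2)); first by rewrite -ler_pdivlMr// ge_min lexx orbT.
  by rewrite ltr_pdivrMr// ltr_pMr// ltr1n.
have [b1 b2] := hb h h0.
have main (P P' : E * 'rV[R]_n) (dl : R) : 0 <= dl -> `|b P| <= h -> `|b P'| <= h ->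
    `|e P| <= C -> `|e P'| <= C -> `|P.2| * `|b P' - b P| <= h * dl ->
    `|P.2| * `|e P' - e P| <= C * dl -> `|w P| <= D * `|P.2| ->
    `|w P' - w P| <= D * dl ->
    `|damped (b P', b P' * e P') *: w P' - damped (b P, b P * e P) *: w P| <= ep * dl.
  move=> dl0 hb1 hb2 he1 he2 db de hw dw; set x := `|P.2|.
  have x0 : 0 <= x by rewrite /x.
  have inb P0 : `|b P0| <= h -> `|e P0| <= C -> `|(b P0, b P0 * e P0) - (0, 0)| < d.
    move=> k1 k2; rewrite -[(_, _) - _]/(b P0 - 0, b P0 * e P0 - 0) !subr0 prod_normE /= gt_max.
    apply/andP; split; first by rewrite (le_lt_trans k1)// (le_lt_trans _ hd)// ler_pMr// lerDr ltW.
    rewrite (le_lt_trans _ hd)// normrM ler_pM// (le_trans k2)// lerDl//.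
  have dm : x * `|b P' * e P' - b P * e P| <= h * (2 * C) * dl.
    have -> : b P' * e P' - b P * e P = b P' * (e P' - e P) + (b P' - b P) * e P by ring.
    rewrite (le_trans (ler_wpM2l x0 (ler_normD _ _)))// mulrDr !normrM.
    have -> : h * (2 * C) * dl = h * (C * dl) + (h * dl) * C by ring.
    by apply: lerD; [rewrite mulrCA ler_pM// mulr_ge0|rewrite mulrA ler_pM// mulr_ge0].
  have da : x * `|damped (b P', b P' * e P') - damped (b P, b P * e P)| <= h * (K * (1 + 2 * C)) * dl.
    have := hK _ _ (inb P' hb2 he2) (inb P hb1 he1); rewrite /=.
    move=> /(ler_wpM2l x0) /le_trans; apply.
    rewrite -[(b P', _) - _]/(b P' - b P, b P' * e P' - b P * e P) prod_normE /=.
    have -> : h * (K * (1 + 2 * C)) * dl = K * (h * (1 + 2 * C) * dl) by ring.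
    rewrite mulrCA ler_wpM2l ?(ltW K0)//.
    have hC : 0 <= h * dl by rewrite mulr_ge0// ltW.
    have [_|_] := leP `|b P' - b P| _.
      by rewrite (le_trans dm)// ler_wpM2r// ler_wpM2l ?(ltW h0)// lerDr.
    rewrite (le_trans db)// ler_wpM2r// ler_pMr// lerDl mulr_ge0// ltW//.
  have -> : damped (b P', b P' * e P') *: w P' - damped (b P, b P * e P) *: w P
     = damped (b P', b P' * e P') *: (w P' - w P)
       + (damped (b P', b P' * e P') - damped (b P, b P * e P)) *: w P.
    by rewrite scalerBr scalerBl addrA subrK.
  rewrite (le_trans (ler_normD _ _))// [X in X + _ <= _]normrZ [X in _ + X <= _]normrZ.
  apply: (@le_trans _ _ (h * T * dl)); last by rewrite ler_wpM2r.
  have -> : h * T * dl = h * (D * dl) + D * (h * (K * (1 + 2 * C)) * dl) by rewrite /T; ring.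
  apply: lerD; first by rewrite ler_pM// (le_trans (damped_le _)).
  rewrite (le_trans (ler_wpM2l (normr_ge0 _) hw))// mulrCA ler_wpM2l ?(ltW D0)//.
  by rewrite mulrC.
near=> q; rewrite subr0.
have k1 : `|b q.1| <= h by near: q; exact: near_fst b1.
have k2 : `|b q.2| <= h by near: q; exact: near_snd b1.
have k3 : `|e q.1| <= C by near: q; exact: near_fst eC.
have k4 : `|e q.2| <= C by near: q; exact: near_snd eC.
have k5 : `|w q.1| <= D * `|q.1.2| by near: q; exact: near_fst wD.
have k6 : `|w q.2| <= D * `|q.2.2| by near: q; exact: near_snd wD.
have k7 : Num.min `|q.1.2| `|q.2.2| * `|b q.1 - b q.2| <= h * `|q.1 - q.2| by near: q.
have k8 : Num.min `|q.1.2| `|q.2.2| * `|e q.1 - e q.2| <= C * `|q.1 - q.2| by near: q.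
have k9 : `|w q.1 - w q.2| <= D * `|q.1 - q.2| by near: q.
have [hh|/ltW hh] := leP `|q.1.2| `|q.2.2|.
  rewrite (min_idPl hh) in k7 k8; rewrite distrC.
  by apply: main => //; rewrite distrC.
rewrite (min_idPr hh) in k7 k8.
by apply: main.
Unshelve. all: by end_near. Qed.
End correction.

Lemma near_near {T : topologicalType} (p : T) (P : T -> Prop) :
  (\forall x \near p, P x) -> \forall y \near p, \forall x \near y, P x.
Proof. by move=> h; exact: nbhs_interior h. Qed.

Lemma near_base {R : realType} {E : normedModType R} {n} (z : E) (Q : E * 'rV[R]_n -> Prop) :
  (\forall P \near (z, 0 : 'rV[R]_n), Q P) -> \forall z' \near z, Q (z', 0).
Proof.
move=> /near_normP[d d0 hd]; apply/near_normP; exists d => // z' hz; apply: hd.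
by rewrite -[(_, _) - _]/(z' - z, 0 - 0) subr0 prod_normE /= normr0 gt_max hz.
Qed.

(** * The Morse lemma with parameters *)

Section morse.
Context {R : realType} {E : normedModType R} {n : nat}.
Variables (k : E * 'rV[R]_n -> R) (f : E * 'rV[R]_n -> 'rV[R]_n) (A : E -> 'M[R]_n) (z0 : E).
Variable J : 'M[R]_n.
Hypothesis Jt : J^T = J.
Hypothesis JJ : J *m J = 1%:M.
Hypothesis A0 : A z0 = J.
Hypothesis k0 : forall z', k (z', 0) = 0.
Hypothesis f0 : \forall z \near z0, f (z, 0) = 0.
Hypothesis hA : \forall z \near z0, sdifferentiable A z /\ (A z)^T = A z.
Hypothesis hk : \forall P \near (z0, 0 : 'rV[R]_n),
  exists2 L, sdiff k P L & forall v, L (0, v) = dot (f P) v.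
Hypothesis hf : \forall z \near z0, sdiff f (z, 0) (fun v => v.2 *m A z).

(** Morse lemma with parameters, in C^1 form. Write A = Y J Y^T and u = s Y, so that
    s A s^T = u J u^T, and look for W = u + a (u J) with a scalar a. As J^2 = 1,
    the equation W J W^T = 2 k reads 2 a N + a^2 q = rho, where N = u u^T,
    q = u J u^T and rho is the remainder; dividing by N, a = damped (b, b e) with
    b = rho / N and e = q / N. *)
Theorem parametric_morse : exists W : E * 'rV[R]_n -> 'rV[R]_n,
  [/\ forall z, W (z, 0) = 0, sdiff W (z0, 0) snd,
      \forall P \near (z0, 0 : 'rV[R]_n), sdifferentiable W P &
      \forall P \near (z0, 0 : 'rV[R]_n), dot (W P *m J) (W P) = 2 * k P].
Proof.
have [Y [Y0 hY]] := symmetric_sqrt Jt JJ A0 hA.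
pose u (P : E * 'rV[R]_n) := P.2 *m Y P.1.
pose N P := dot (u P) (u P).
pose q (P : E * 'rV[R]_n) := dot (P.2 *m A P.1) P.2.
pose rho := remainder k A.
pose b P := rho P / N P.
pose e P := q P / N P.
pose w P := u P *m J.
pose corr P := damped (b P, b P * e P) *: w P.
pose W P := u P + corr P.
have u0 z : u (z, 0) = 0 by rewrite /u mul0mx.
have w0 z : w (z, 0) = 0 by rewrite /w u0 mul0mx.
have N0 z : N (z, 0) = 0 by rewrite /N u0 dot0l.
have q0 z : q (z, 0) = 0 by rewrite /q dot0r.
have su P LY : sdiff Y P.1 LY -> sdiff u P (fun v => v.2 *m Y P.1 + P.2 *m LY v.1).
  by move=> sY; exact: sdiff_mulmx (sdiff_snd P) (sdiff_comp (sdiff_fst P) sY).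
have sw P LY : sdiff Y P.1 LY -> sdifferentiable w P.
  by move=> /su s; eexists; exact: sdiff_mulmxr s.
pose c : R := 2^-1 * 2^-1.
have c0 : 0 < c by rewrite mulr_gt0// invr_gt0.
(* Near z0, Y is so close to 1 that |s Y| >= |s| / 2: this is where c = 1/4 comes from. *)
have hN : \forall z \near z0, forall s, c * `|s| ^+ 2 <= N (z, s).
  have [[LY sY] _] := nbhs_singleton hY.
  have n0 : 0 < (2 * (n%:R + 1))^-1 :> R by rewrite invr_gt0 mulr_gt0// ltr_wpDl.
  have cY : \forall z \near z0, `|Y z0 - Y z| < (2 * (n%:R + 1))^-1.
    by have /cvgrPdist_lt := sdiff_continuous sY; apply.
  near=> z => s.
  have hz : `|Y z0 - Y z| < (2 * (n%:R + 1))^-1 by near: z.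
  rewrite (le_trans _ (dot_ge _))// /c -expr2 -exprMn ler_sqr ?nnegrE ?mulr_ge0 ?invr_ge0//.
  have : `|s - s *m Y z| <= 2^-1 * `|s|.
    rewrite -{1}[s]mulmx1 -Y0 -mulmxBr (le_trans (norm_mulmx _ _))//.
    rewrite mulrAC ler_wpM2r//.
    apply: (@le_trans _ _ (n%:R * (2 * (n%:R + 1))^-1)); first by rewrite ler_wpM2l// ltW.
    rewrite invfM mulrCA ler_piMr ?invr_ge0// ler_pdivrMr ?ltr_wpDl//.
    by rewrite mul1r lerDl.
  move=> /(le_trans (lerB_dist _ _)); rewrite /u /=; set X := `|s|; set X' := `|_ *m _|; lra.
have dwJ P : dot (w P) (u P) = q P -> dot (W P *m J) (W P)
    = q P + (2 * damped (b P, b P * e P) + damped (b P, b P * e P) ^+ 2 * e P) * N P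
      + damped (b P, b P * e P) ^+ 2 * (q P - e P * N P).
  move=> wu; rewrite /W /corr mulmxDl -scalemxAl !(dotDl, dotDr, dotZl, dotZr).
  have -> : dot (u P *m J) (u P) = q P by [].
  have -> : dot (w P *m J) (u P) = N P by rewrite /w -mulmxA JJ mulmx1.
  have -> : dot (u P *m J) (w P) = N P.
    by rewrite dot_sym// /w -mulmxA JJ mulmx1.
  have -> : dot (w P *m J) (w P) = q P.
    by rewrite {1}/w -mulmxA JJ mulmx1 dotC.
  ring.
have wuq : \forall z \near z0, forall s, dot (w (z, s)) (u (z, s)) = q (z, s).
  apply: filterS hY => z [_ hz] s.
  by rewrite /w /u /q /dot /= trmx_mul -hz !mulmxA.
have quot : \forall z \near z0,
    (forall h : R, 0 < h -> (\forall P \near (z, 0 : 'rV[R]_n), `|b P| <= h) /\ min_lip b z h) /\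
    (exists2 C : R, 0 < C & (\forall P \near (z, 0 : 'rV[R]_n), `|e P| <= C) /\ min_lip e z C).
  have nk := near_base (near_near hk).
  have := near_near f0; have := near_near hA; have := near_near hN => h1 h2 h3.
  near=> z.
  have kz : \forall P \near (z, 0 : 'rV[R]_n),
     exists2 L, sdiff k P L & forall v, L (0, v) = dot (f P) v by near: z.
  have fz : \forall z' \near z, f (z', 0) = 0 by near: z.
  have Az : \forall z' \near z, sdifferentiable A z' /\ (A z')^T = A z' by near: z.
  have Nz : \forall z' \near z, forall s, c * `|s| ^+ 2 <= N (z', s) by near: z.
  have sfz : sdiff f (z, 0) (fun v => v.2 *m A z) by near: z.
  have [[LY sY] _] : sdifferentiable Y z /\ Y z *m J *m (Y z)^T = A z by near: z.
  have {}Nz : \forall P \near (z, 0 : 'rV[R]_n), c * `|P.2| ^+ 2 <= N P.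
    by have := near_fst (0 : 'rV[R]_n) Nz; apply: filterS => -[z' s]; apply.
  have sdu : sdifferentiable u (z, 0) by eexists; exact: (su (z, 0) _ sY).
  have [be be0 fN] := flat_dot sdu sdu u0 u0.
  have [[LA sA] _] := nbhs_singleton Az.
  have sdsA : sdifferentiable (fun P : E * 'rV[R]_n => P.2 *m A P.1) (z, 0).
    by eexists; exact: sdiff_mulmx (sdiff_snd (z, 0)) (sdiff_comp (sdiff_fst (z, 0)) sA).
  have sds : sdifferentiable (fun P : E * 'rV[R]_n => P.2) (z, 0) by eexists; exact: sdiff_snd.
  have [al al0 fq] := flat_dot sdsA sds (fun _ => mul0mx _ _) (fun _ => erefl).
  have rho0 z' : rho (z', 0) = 0 by exact: remainder0.
  split.
    move=> h h0.
    have T0 : 0 < 1 / c + be / c ^+ 2 by rewrite addr_gt0 ?divr_gt0 ?exprn_gt0.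
    pose h' := h / (1 / c + be / c ^+ 2).
    have h'0 : 0 < h' by rewrite divr_gt0.
    have fr : flat_at rho z h' by exact: (flat_remainder k0 fz Az kz sfz h'0).
    have [k1 k2] := flat_quotient c0 (ltW h'0) (ltW be0) rho0 N0 fr fN Nz.
    split.
      apply: filterS k1 => P /le_trans; apply.
      rewrite ler_pdivrMr// /h' ler_pdivrMr// -mulrA ler_pMr// mulrDr.
      by rewrite mulrCA mulfV ?gt_eqF// mulr1 lerDl mulr_ge0 ?(ltW c0)// divr_ge0 ?(ltW be0)// exprn_ge0// ltW.
    apply: filterS k2 => Q /le_trans; apply.
    rewrite ler_wpM2r// le_eqVlt; apply/orP; left; apply/eqP.
    have -> : h' / c + h' * be / c ^+ 2 = h' * (1 / c + be / c ^+ 2) by ring.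
    by rewrite /h' divfK// gt_eqF.
  have [k1 k2] := flat_quotient c0 (ltW al0) (ltW be0) q0 N0 fq fN Nz.
  have t0 : 0 < al / c by rewrite divr_gt0.
  have t1 : 0 < al * be / c ^+ 2 by rewrite divr_gt0 ?mulr_gt0 ?exprn_gt0.
  exists (al / c + al * be / c ^+ 2); first by rewrite addr_gt0.
  split; last exact: k2.
  by apply: filterS k1 => P /le_trans; apply; rewrite lerDl ltW.
have scorr : \forall z \near z0, sdiff corr (z, 0) (fun=> 0).
  near=> z.
  have [hb he] : (forall h : R, 0 < h -> (\forall P \near (z, 0 : 'rV[R]_n), `|b P| <= h) /\ min_lip b z h) /\
    (exists2 C : R, 0 < C & (\forall P \near (z, 0 : 'rV[R]_n), `|e P| <= C) /\ min_lip e z C).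
    by near: z.
  have [[LY sY] _] : sdifferentiable Y z /\ Y z *m J *m (Y z)^T = A z by near: z.
  have [Lw sdw] := sw (z, 0) _ sY.
  exact: sdiff_correction hb he sdw w0.
have be_small : \forall P \near (z0, 0 : 'rV[R]_n), 0 < 1 + b P * e P.
  have [hb [C C0 [he _]]] := nbhs_singleton quot.
  have h0 : 0 < (2 * C)^-1 by rewrite invr_gt0 mulr_gt0.
  have [k1 _] := hb _ h0.
  near=> P.
  have b1 : `|b P| <= (2 * C)^-1 by near: P.
  have e1 : `|e P| <= C by near: P.
  have : `|b P * e P| <= 2^-1.
    rewrite normrM (le_trans (ler_pM _ _ b1 e1))// invfM -mulrA mulVf ?gt_eqF// mulr1//.
  rewrite ler_norml => /andP[h1 _].
  have : (2^-1 : R) < 1 by rewrite invf_lt1// ltr1n.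
  lra.
exists W; split.
- by move=> z; rewrite /W /corr u0 w0 scaler0 addr0.
- have [[LY sY] _] := nbhs_singleton hY.
  have := sdiffD (su (z0, 0) _ sY) (nbhs_singleton scorr).
  apply: sdiff_ext => // v /=.
  by rewrite Y0 mulmx1 mul0mx !addr0.
- have n1 := near_fst (0 : 'rV[R]_n) scorr; have n2 := near_fst (0 : 'rV[R]_n) hY.
  have n3 := near_fst (0 : 'rV[R]_n) hN; have n4 := near_fst (0 : 'rV[R]_n) hA.
  near=> P.
  have scP : sdiff corr (P.1, 0) (fun=> 0) by near: P.
  have [[LY sY] _] : sdifferentiable Y P.1 /\ Y P.1 *m J *m (Y P.1)^T = A P.1 by near: P.
  have NP : forall s, c * `|s| ^+ 2 <= N (P.1, s) by near: P.
  have [[LA sA] _] : sdifferentiable A P.1 /\ (A P.1)^T = A P.1 by near: P.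
  have [Lk sk _] : exists2 L, sdiff k P L & forall v, L (0, v) = dot (f P) v by near: P.
  have beP : 0 < 1 + b P * e P by near: P.
  suff [Lc sc] : sdifferentiable corr P by eexists; exact: sdiffD (su _ _ sY) sc.
  have [P20|P20] := eqVneq P.2 0.
    exists (fun=> 0); move: scP; rewrite -P20; by case: (P).
  have NP0 : N P != 0.
    have := NP P.2; rewrite -surjective_pairing => /(lt_le_trans _) h.
    by rewrite gt_eqF// h// mulr_gt0// exprn_gt0// normr_gt0.
  have sN := sdiff_dot (su _ _ sY) (su _ _ sY).
  have sNi := sdiff_inv NP0 sN.
  have sq := sdiff_dot (sdiff_mulmx (sdiff_snd P) (sdiff_comp (sdiff_fst P) sA)) (sdiff_snd P).
  have sr := sdiffB (sdiffZl 2 sk) sq.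
  have sb := sdiffM sr sNi; have se := sdiffM sq sNi.
  have sbe := sdiff_pair sb (sdiffM sb se).
  have [Lw sdw] := sw _ _ sY.
  have [Ld sd1] := sdifferentiable_damped (x := (b P, b P * e P)) beP.
  have sdd := sdiff_comp sbe sd1.
  by eexists; exact: sdiffZ sdd sdw.
have n3 := near_fst (0 : 'rV[R]_n) hN; have n4 := near_fst (0 : 'rV[R]_n) wuq.
near=> P.
have NP : forall s, c * `|s| ^+ 2 <= N (P.1, s) by near: P.
have wuP : forall s, dot (w (P.1, s)) (u (P.1, s)) = q (P.1, s) by near: P.
have beP : 0 < 1 + b P * e P by near: P.
rewrite dwJ; last by have := wuP P.2; rewrite -surjective_pairing.
have [P20|P20] := eqVneq P.2 0.
  have -> : P = (P.1, 0) by rewrite -P20; case: (P).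
  by rewrite q0 N0 k0 !mulr0 subr0 !add0r mulr0.
have NP0 : N P != 0.
  have := NP P.2; rewrite -surjective_pairing => /(lt_le_trans _) h.
  by rewrite gt_eqF// h// mulr_gt0// exprn_gt0// normr_gt0.
rewrite dampedE ?(ltW beP)// /b /e !divfK// subrr mulr0 addr0.
by rewrite /rho /remainder addrC subrK.
Unshelve. all: by end_near. Qed.
End morse.
(** * Gradient and Hessian in the second variable *)

Section partial_derivatives.
Context {R : realType} {p d : nat}.
Variable g : 'rV[R]_p * 'rV[R]_d -> R.
Hypothesis hg : Ck 3 [set: 'rV[R]_p * 'rV[R]_d] g.
Let bXY : fin_basis ('rV[R]_p * 'rV[R]_d)%type := fin_basis_prod (fin_basis_rV p) (fin_basis_rV d).

Lemma Ck2_Ck1 (V W : normedModType R) (O : set V) (f : V -> W) : Ck 2 O f -> Ck 1 O f.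
Proof.
move=> [fd f2]; split=> // v z Oz.
by have [h _] := f2 v; exact: differentiable_continuous (h z Oz).
Qed.

Lemma Ck3_Ck2 (V W : normedModType R) (O : set V) (f : V -> W) : Ck 3 O f -> Ck 2 O f.
Proof. by move=> [fd f2]; split=> // v; apply: Ck2_Ck1; exact: f2. Qed.

Lemma derive_snd (W : normedModType R) (f : 'rV[R]_p * 'rV[R]_d -> W) x y w :
  'D_w (fun y => f (x, y)) y = 'D_(0, w) f (x, y).
Proof.
rewrite /derive.
have -> : (fun h : R => h^-1 *: (((fun y => f (x, y)) \o shift y) (h *: w) - f (x, y)))
    = (fun h : R => h^-1 *: ((f \o shift (x, y)) (h *: (0, w)) - f (x, y))).
  apply/funext => h /=; congr (_ *: (f _ - _)).
  by rewrite -[h *: (0, w) + (x, y)]/(h *: 0 + x, h *: w + y) scaler0 add0r.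
by [].
Qed.

Lemma Ck3_sdiff z : sdiff g z (fun v => 'D_v g z).
Proof. by apply: (Ck1_sdiff bXY openT) => //; exact: Ck2_Ck1 (Ck3_Ck2 hg). Qed.

Lemma Ck3_sdiff_derive v z : sdiff (fun z => 'D_v g z) z (fun w => 'D_w (fun z => 'D_v g z) z).
Proof. by have [_ h] := hg; apply: (Ck1_sdiff bXY openT) => //; exact: Ck2_Ck1 (h v). Qed.

Lemma Ck3_sdifferentiable_derive2 u v z : sdifferentiable (fun z => 'D_u (fun z => 'D_v g z) z) z.
Proof.
eexists; apply: (Ck1_sdiff bXY openT) => //.
by have [_ h] := hg; have [_] := h v; apply.
Qed.

Lemma grad_yE z j : grad_y g z 0 j = 'D_(0, delta_mx 0 j) g z.
Proof. by rewrite mxE derive_snd; case: z. Qed.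

Lemma sdiff_grad_y z : sdiff (grad_y g) z
  (fun v => \row_j 'D_v (fun z => 'D_(0, delta_mx 0 j) g z) z).
Proof.
apply: sdiff_mx => i j; rewrite ord1.
apply: (sdiff_ext _ _ (Ck3_sdiff_derive (0, delta_mx 0 j) z)) => [w|v]; first by rewrite grad_yE.
by rewrite mxE.
Qed.

Lemma derive_grad z u : 'D_(0, u) g z = dot (grad_y g z) u.
Proof.
rewrite {1}[u]row_sum_delta.
have -> : (0, \sum_i u 0 i *: delta_mx 0 i) = \sum_i u 0 i *: (0, delta_mx 0 i) :> 'rV[R]_p * 'rV[R]_d.
  rewrite sum_pair /=; congr (_, _).
  by rewrite big1// => i _; rewrite scaler0.
have s := Ck3_sdiff z.
rewrite (big_morph _ (sdiff_linD s) (sdiff_lin0 s)) /dot mxE; apply: eq_bigr => i _.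
by rewrite (sdiff_linZ s) grad_yE [u^T _ _]mxE mulrC.
Qed.

Lemma sdiff_inr (x : 'rV[R]_p) (y : 'rV[R]_d) : sdiff (fun y : 'rV[R]_d => (x, y)) y (fun v => (0, v)).
Proof. by apply: sdiff_pair; [exact: sdiff_cst|exact: sdiff_id]. Qed.

Lemma hess_yyE z u : u *m hess_yy g z = \row_j 'D_(0, u) (fun z => 'D_(0, delta_mx 0 j) g z) z.
Proof.
case: z => x y; rewrite /hess_yy /=.
have s := sdiff_comp (sdiff_inr x y) (sdiff_grad_y (x, y)).
rewrite -deriveEjacobian; last exact: sdiff_differentiable s.
by have [_ ->] := sdiff_is_derive u s.
Qed.

Lemma hess_yy_coord z i j : hess_yy g z i j
  = 'D_(0, delta_mx 0 i) (fun z => 'D_(0, delta_mx 0 j) g z) z.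
Proof. by have := hess_yyE z (delta_mx 0 i); rewrite -rowE => /rowP/(_ j); rewrite !mxE. Qed.

Lemma hess_yy_sym z : (hess_yy g z)^T = hess_yy g z.
Proof.
apply/matrixP => i j; rewrite mxE !hess_yy_coord.
apply: (schwarz bXY); exact: Ck3_Ck2 hg.
Qed.

Lemma sdifferentiable_hess_yy z : sdifferentiable (hess_yy g) z.
Proof.
have h i j : sdifferentiable (fun z => hess_yy g z i j) z.
  have [L sL] := Ck3_sdifferentiable_derive2 (0, delta_mx 0 i) (0, delta_mx 0 j) z.
  by exists L; apply: sdiff_ext sL => // w; rewrite hess_yy_coord.
exists (fun v => \matrix_(i, j) sval (cid (h i j)) v); apply: sdiff_mx => i j.
have := svalP (cid (h i j)); apply: sdiff_ext => // v.
by rewrite mxE.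
Qed.

Lemma sdiff_gradient z : exists2 L, sdiff (grad_y g) z L &
  forall u, L (0, u) = u *m hess_yy g z.
Proof.
by eexists=> [|u]; [exact: sdiff_grad_y|rewrite hess_yyE].
Qed.

Lemma sdiff_value z : exists2 L, sdiff g z L & forall u, L (0, u) = dot (grad_y g z) u.
Proof. by exists (fun v => 'D_v g z) => [|u]; [exact: Ck3_sdiff|rewrite derive_grad]. Qed.
End partial_derivatives.

(** * Implicit functions *)

Section implicit_function.
Context {R : realType}.

(** The map (z, w) |-> (z, F (z, w) - L (z, 0)) has derivative the identity at
    (z0, w0); its local inverse solves F (z, w) = 0 for w. *)
Theorem implicit_function (E W : completeNormedModType R) (F : E * W -> W) z0 w0 L :
  sdiff F (z0, w0) L -> (forall w, L (0, w) = w) -> F (z0, w0) = 0 ->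
  (\forall P \near (z0, w0), sdifferentiable F P) ->
  exists s : E -> W, [/\ s z0 = w0, \forall z \near z0, sdifferentiable s z,
    \forall z \near z0, F (z, s z) = 0 &
    \forall P \near (z0, w0), F P = 0 -> P.2 = s P.1].
Proof.
move=> sF L0 F0 nF.
pose c (z : E) : W := - L (z, 0).
pose f (P : E * W) := (P.1, F P + c P.1).
have sc z : sdiff c z c.
  apply: sdiffN; apply: sdiff_comp (sdiff_pair (sdiff_id z) (sdiff_cst z (0 : W))) _.
  by have [l b _] := sF; exact: sdiff_linear.
have sf : sdiff f (z0, w0) id.
  have := sdiff_pair (sdiff_fst (z0, w0)) (sdiffD sF (sdiff_comp (sdiff_fst (z0, w0)) (sc z0))).
  apply: sdiff_ext => // -[v1 v2] /=.
  rewrite /c -[X in L X](_ : (v1, 0) + (0, v2) = (v1, v2)); last first.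
    by rewrite -[LHS]/(v1 + 0, 0 + v2) addr0 add0r.
  by rewrite (sdiff_linD sF) addrC addrA addNr add0r L0.
have nf : \forall P \near (z0, w0), exists M, sdiff f P M.
  apply: filterS nF => P [M sM]; eexists.
  exact: sdiff_pair (sdiff_fst P) (sdiffD sM (sdiff_comp (sdiff_fst P) (sc P.1))).
have [h [h1 h2 h3 h4 h5]] := local_inverse sf nf.
have f0E : f (z0, w0) = (z0, c z0) by rewrite /f F0 add0r.
have sgr z : sdiff (fun z => (z, c z)) z (fun v => (v, c v)).
  exact: sdiff_pair (sdiff_id z) (sc z).
have near_gr Q : (\forall y \near f (z0, w0), Q y) -> \forall z \near z0, Q (z, c z).
  by rewrite f0E => nQ; exact: (near_sdiff_comp (sgr z0) nQ).
exists (fun z => (h (z, c z)).2); split.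
- by rewrite -f0E h1.
- have := near_gr _ h5; apply: filterS => z [M sM]; eexists.
  exact: sdiff_comp (sdiff_comp (sgr z) sM) (sdiff_snd _).
- have := near_gr _ h2; apply: filterS => z.
  rewrite /f; case: (h (z, c z)) => z' w' /= [-> e].
  by apply: (addIr (c z)); rewrite e add0r.
apply: filterS h3 => -[z w] + F00; rewrite /f F00 add0r /=.
by move=> ->.
Qed.
End implicit_function.
(** * Smooth maps between row spaces *)

Section smooth_maps.
Context {R : realType}.

Lemma sdifferentiable_comp (V W U : normedModType R) (f : V -> W) (g : W -> U) p :
  sdifferentiable f p -> sdifferentiable g (f p) -> sdifferentiable (fun z => g (f z)) p.
Proof. by move=> [L sL] [M sM]; exists (fun v => M (L v)); exact: sdiff_comp. Qed.

Lemma sdifferentiable_pair (V W U : normedModType R) (f : V -> W) (g : V -> U) p :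
  sdifferentiable f p -> sdifferentiable g p -> sdifferentiable (fun z => (f z, g z)) p.
Proof. by move=> [L sL] [M sM]; exists (fun v => (L v, M v)); exact: sdiff_pair. Qed.

Lemma near_sdifferentiable (V W : normedModType R) (f : V -> W) p (P : W -> Prop) :
  sdifferentiable f p -> (\forall w \near f p, P w) -> \forall z \near p, P (f z).
Proof. by move=> [L sL]; exact: near_sdiff_comp sL. Qed.

(** The local extension given by Ck_on agrees with f near z because S is open. *)
Lemma Ck_on_sdifferentiable (V : normedModType R) a b (f : V -> 'rV[R]_a * 'rV[R]_b) (S : set V) z :
  fin_basis V -> open S -> S z -> Ck_on 2 S f -> sdifferentiable f z.
Proof.
move=> bV oS Sz /(_ z Sz)[Q [F [[oO Oz] CF fF]]].
have [L sL] : sdifferentiable F z.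
  apply: (Ck1_sdifferentiable_pair (O := Q)) => //; last exact: Ck2_Ck1.
    by move=> h Ch; exact: Ck1_sdifferentiable_mx Ch Oz.
  by move=> h Ch; exact: Ck1_sdifferentiable_mx Ch Oz.
exists L; apply: sdiff_near sL.
have n1 : \forall v \near z, Q v by apply: open_nbhs_nbhs.
have n2 : \forall v \near z, S v by apply: open_nbhs_nbhs.
by apply: filterS2 n1 n2 => v Ov Sv; rewrite fF.
Qed.

(** On matrices this is mulmx1C. *)
Lemma linear_left_inverse m (L M : 'rV[R]_m -> 'rV[R]_m) : linear L -> linear M ->
  (forall v, M (L v) = v) -> forall v, L (M v) = v.
Proof.
move=> lL lM ML.
pose mx (N : 'rV[R]_m -> 'rV[R]_m) : 'M[R]_m := \matrix_i N (delta_mx 0 i).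
have mxE (N : 'rV[R]_m -> 'rV[R]_m) : linear N -> forall v, N v = v *m mx N.
  move=> lN v; pose Nf : {linear _ -> _} := HB.pack N (GRing.isLinear.Build R _ _ *:%R N lN).
  rewrite mulmx_sum_row {1}[v]row_sum_delta -[N _]/(Nf _) linear_sum.
  by apply: eq_bigr => i _; rewrite linearZ /= rowK.
have LM : mx L *m mx M = 1%:M.
  by apply/row_matrixP => i; rewrite row_mul rowK -mxE// ML row1.
by move=> v; rewrite (mxE _ lL) (mxE _ lM) -mulmxA (mulmx1C LM) mulmx1.
Qed.

Lemma sdiff_lsubmx m a b (A : 'M[R]_(m, a + b)) : sdiff (@lsubmx R m a b) A (@lsubmx R m a b).
Proof.
apply: sdiff_linear => [c u v|]; first by rewrite linearP.
by exists 1 => v; rewrite mul1r; apply: mx_norm_le => // i j; rewrite mxE mx_coord_le.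
Qed.

Lemma sdiff_rsubmx m a b (A : 'M[R]_(m, a + b)) : sdiff (@rsubmx R m a b) A (@rsubmx R m a b).
Proof.
apply: sdiff_linear => [c u v|]; first by rewrite linearP.
by exists 1 => v; rewrite mul1r; apply: mx_norm_le => // i j; rewrite mxE mx_coord_le.
Qed.

Lemma sdiff_row_mx m a b (z : 'M[R]_(m, a) * 'M[R]_(m, b)) :
  sdiff (fun z : 'M[R]_(m, a) * 'M[R]_(m, b) => row_mx z.1 z.2) z (fun z => row_mx z.1 z.2).
Proof.
apply: sdiff_linear => [c u v|]; first by rewrite /= scale_row_mx add_row_mx.
exists 1 => v; rewrite mul1r; apply: mx_norm_le => // i j; rewrite mxE.
by case: splitP => l _; rewrite (le_trans (mx_coord_le _ _ _))// ?fst_norm_le ?snd_norm_le.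
Qed.
End smooth_maps.

(** * The critical set as a graph *)

Section critical_graph.
Context {R : realType} {p d k n : nat}.
Variable g : 'rV[R]_p * 'rV[R]_d -> R.
Hypothesis hg : Ck 3 [set: 'rV[R]_p * 'rV[R]_d] g.
Variables (x0 : 'rV[R]_p) (y0 : 'rV[R]_d).
Hypothesis crit0 : grad_y g (x0, y0) = 0.
Variables (Kb : 'M[R]_(k, d)) (C : 'M[R]_(n, d)) (P1 : 'M[R]_(d, k)) (P2 : 'M[R]_(d, n)).
Variable J : 'M[R]_n.
Hypothesis PC : P1 *m Kb + P2 *m C = 1%:M.
Hypothesis KP1 : Kb *m P1 = 1%:M.
Hypothesis KP2 : Kb *m P2 = 0.
Hypothesis CP1 : C *m P1 = 0.
Hypothesis CP2 : C *m P2 = 1%:M.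
Hypothesis CAC : C *m hess_yy g (x0, y0) *m C^T = J.
Hypothesis JJ : J *m J = 1%:M.

Local Notation E := ('rV[R]_p * 'rV[R]_k)%type.
Local Notation XY := ('rV[R]_p * 'rV[R]_d)%type.

(** Coordinates (x, r, s) with y = y0 + r Kb + s C, the rows of Kb and C spanning the
    null space of the Hessian and its orthocomplement. *)
Definition chart (P : E * 'rV[R]_n) : XY := (P.1.1, y0 + (P.1.2 *m Kb + P.2 *m C)).
Definition chart_inv (v : XY) : E * 'rV[R]_n := ((v.1, (v.2 - y0) *m P1), (v.2 - y0) *m P2).

Lemma chartK P : chart_inv (chart P) = P.
Proof.
case: P => [[x r] s]; rewrite /chart /chart_inv /= addrC addKr.
by rewrite !mulmxDl -!mulmxA KP1 KP2 CP1 CP2 !mulmx0 !mulmx1 addr0 add0r.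
Qed.

Lemma chart_invK v : chart (chart_inv v) = v.
Proof.
case: v => x y; rewrite /chart /chart_inv /= -!mulmxA -mulmxDr PC mulmx1.
by rewrite addrC subrK.
Qed.

Lemma sdiff_chart P : sdiff chart P (fun v => (v.1.1, v.1.2 *m Kb + v.2 *m C)).
Proof.
apply: sdiff_pair; first exact: sdiff_comp (sdiff_fst P) (sdiff_fst _).
apply: (sdiff_ext (f := fun P : E * 'rV[R]_n => y0 + (P.1.2 *m Kb + P.2 *m C))
  (L := fun v => 0 + (v.1.2 *m Kb + v.2 *m C))) => // [v|]; first by rewrite add0r.
apply: sdiffD; first exact: sdiff_cst.
apply: sdiffD; apply: sdiff_mulmxr; last exact: sdiff_snd.
exact: sdiff_comp (sdiff_fst P) (sdiff_snd _).
Qed.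

Lemma sdifferentiable_chart_inv v : sdifferentiable chart_inv v.
Proof.
have s : sdiff (fun v : XY => v.2 - y0) v (fun v => v.2 - 0).
  by apply: sdiffB; [exact: sdiff_snd|exact: sdiff_cst].
by eexists; exact: sdiff_pair (sdiff_pair (sdiff_fst v) (sdiff_mulmxr P1 s)) (sdiff_mulmxr P2 s).
Qed.

Let z0 : E := (x0, 0).

Lemma chart0 : chart (z0, 0) = (x0, y0).
Proof. by rewrite /chart /= !mul0mx !addr0. Qed.

(** The derivative of the C-components of the gradient in the direction s is J at the
    base point, hence invertible: the equations they form define a graph over (x, r),
    and every critical point satisfies them. *)
Lemma critical_in_graph : exists s : E -> 'rV[R]_n, [/\ s z0 = 0,
  \forall z \near z0, sdifferentiable s z &
  \forall v \near (x0, y0), grad_y g v = 0 -> v = chart ((chart_inv v).1, s (chart_inv v).1)].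
Proof.
pose F (P : E * 'rV[R]_n) := grad_y g (chart P) *m C^T *m J.
have sF P : sdifferentiable F P.
  have [L sL _] := sdiff_gradient hg (chart P).
  by eexists; exact: sdiff_mulmxr (sdiff_mulmxr _ (sdiff_comp (sdiff_chart P) sL)).
have [L sL LE] := sdiff_gradient hg (chart (z0, 0)).
have sF0 := sdiff_mulmxr J (sdiff_mulmxr C^T (sdiff_comp (sdiff_chart (z0, 0)) sL)).
have [|||s [s1 s2 _ s4]] := implicit_function sF0.
- by move=> w /=; rewrite mul0mx add0r LE chart0 -!mulmxA (mulmxA C) (mulmxA (C *m _)) CAC JJ mulmx1.
- by rewrite chart0 crit0 !mul0mx.
- by near=> P; exact: sF.
exists s; split=> //.
have s5 : \forall P \near chart_inv (x0, y0), F P = 0 -> P.2 = s P.1.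
  by rewrite -chart0 chartK.
have := near_sdifferentiable (sdifferentiable_chart_inv (x0, y0)) s5.
apply: filterS => v; rewrite /F chart_invK => h vc.
by rewrite -h ?vc ?mul0mx// -surjective_pairing chart_invK.
Unshelve. all: by end_near. Qed.

Hypothesis hM : exists2 V, open_nbhs (x0, y0) V & submanifold 2 (p + k)%N (aug_crit g `&` V).

(** A slice chart phi, with inverse h, parametrizes the critical set by u |-> h (u, 0),
    where u has p + k components, as many as (x, r). By the previous inclusion
    h (u, 0) is the point of the graph above its own (x, r) = Lam u, and phi recovers u
    from it: so Lam has a left inverse kap, its derivative is invertible for dimension
    reasons, and Lam covers a neighborhood of (x0, 0). Every point of the graph
    above that neighborhood is therefore some h (u, 0). *)
Lemma graph_in_critical (s : E -> 'rV[R]_n) : s z0 = 0 -> (\forall z \near z0, sdifferentiable s z) ->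
  (\forall v \near (x0, y0), grad_y g v = 0 -> v = chart ((chart_inv v).1, s (chart_inv v).1)) ->
  \forall z \near z0, grad_y g (chart (z, s z)) = 0.
Proof.
move=> s0 sds hcg.
have [V [oV V0] /(_ (x0, y0) (conj crit0 V0))] := hM.
move=> [c [Q [Q' [phi [[oQ Q0] oQ' [pbij pC [h hphi hC]] slice]]]]].
pose bXY : fin_basis XY := fin_basis_prod (fin_basis_rV p) (fin_basis_rV d).
have sphi : sdifferentiable phi (x0, y0) by exact: Ck_on_sdifferentiable bXY oQ Q0 pC.
have sh w : Q' w -> sdifferentiable h w.
  by move=> Q'w; exact: Ck_on_sdifferentiable (fin_basis_prod (fin_basis_rV _) (fin_basis_rV _)) oQ' Q'w hC.
have pO : forall v, Q v -> Q' (phi v) by have [+ _ _] := pbij; exact.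
have pS w : Q' w -> exists2 v, Q v & phi v = w.
  by have [_ _ hs] := pbij; move=> /hs[v Ov <-]; exists v.
pose u0 := (phi (x0, y0)).1.
have phi0 : phi (x0, y0) = (u0, 0).
  have /(slice _ Q0) p2 : (aug_crit g `&` V) (x0, y0) by [].
  by rewrite [LHS]surjective_pairing p2.
pose hu (u : 'rV[R]_(p + k)) : XY := h (u, 0).
have hu0 : hu u0 = (x0, y0) by rewrite /hu -phi0 hphi.
have sj (u : 'rV[R]_(p + k)) : sdifferentiable (fun u => (u, 0 : 'rV[R]_c)) u.
  by eexists; exact: sdiff_pair (sdiff_id u) (sdiff_cst u (0 : 'rV[R]_c)).
have nO' : \forall u \near u0, Q' (u, 0).
  apply: (near_sdifferentiable (sj u0)); apply: open_nbhs_nbhs; split=> //.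
  by rewrite -phi0; exact: pO.
have shu : \forall u \near u0, sdifferentiable hu u.
  by apply: filterS nO' => u /sh; exact: sdifferentiable_comp (sj u).
have shu0 := nbhs_singleton shu.
have hu_inv u : Q' (u, 0) -> phi (hu u) = (u, 0) /\ grad_y g (hu u) = 0.
  move=> /pS[v Ov vE]; rewrite /hu -vE hphi//; split=> //.
  by have [|+ _] := (slice v Ov).2; first by rewrite vE.
have hu_graph : \forall u \near u0, hu u = chart ((chart_inv (hu u)).1, s (chart_inv (hu u)).1).
  have n1 : \forall v \near hu u0, grad_y g v = 0 -> v = chart ((chart_inv v).1, s (chart_inv v).1).
    by rewrite hu0.
  have := near_sdifferentiable shu0 n1; apply: filterS2 nO' => u /hu_inv[_ cu]; exact.
pose Lam u := row_mx (chart_inv (hu u)).1.1 (chart_inv (hu u)).1.2.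
have sLam u : sdifferentiable hu u -> sdifferentiable Lam u.
  move=> su; have [L sL] := sdifferentiable_comp su (sdifferentiable_chart_inv (hu u)).
  have := sdiff_comp (sdiff_comp sL (sdiff_fst _)) (sdiff_row_mx _).
  by move=> sR; eexists; exact: sR.
pose spl (a : 'rV[R]_(p + k)) : E := (lsubmx a, rsubmx a).
have splK u : spl (Lam u) = (chart_inv (hu u)).1.
  by rewrite /spl /Lam row_mxKl row_mxKr -surjective_pairing.
have ssp a : sdifferentiable spl a by eexists; exact: sdiff_pair (sdiff_lsubmx a) (sdiff_rsubmx a).
have spl0 : spl (Lam u0) = z0.
  by rewrite splK hu0 -chart0 chartK.
pose kap a := (phi (chart (spl a, s (spl a)))).1.
have [Lk skap] : sdifferentiable kap (Lam u0).
  have s1 : sdifferentiable (fun a => (spl a, s (spl a))) (Lam u0).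
    apply: sdifferentiable_pair => //; apply: sdifferentiable_comp => //.
    by rewrite spl0; exact: nbhs_singleton sds.
  have s2 : sdifferentiable (fun a => chart (spl a, s (spl a))) (Lam u0).
    by apply: (sdifferentiable_comp s1); eexists; exact: sdiff_chart.
  apply: (@sdifferentiable_comp _ _ _ _ (fun a => phi (chart (spl a, s (spl a)))) fst).
    by apply: (sdifferentiable_comp s2); rewrite spl0 s0 chart0.
  by eexists; exact: sdiff_fst.
have [Ll sl] := sLam u0 shu0.
have kapLam : \forall u \near u0, kap (Lam u) = u.
  apply: filterS2 nO' hu_graph => u /hu_inv[e _] hg'.
  by rewrite /kap splK -hg' e.
have LkLl v : Lk (Ll v) = v.
  have s1 := sdiff_comp sl skap.
  by have := sdiff_unique (sdiff_near kapLam s1) (sdiff_id u0) v.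
have [linL _ _] := sl; have [linK bndK _] := skap.
have LlLk := linear_left_inverse linL linK LkLl.
have sLk a := sdiff_linear a linK bndK.
have sTh : sdiff (fun u => Lk (Lam u)) u0 id.
  by apply: (sdiff_ext _ _ (sdiff_comp sl (sLk _))) => // v; exact: LkLl.
have nTh : \forall u \near u0, exists M, sdiff (fun u => Lk (Lam u)) u M.
  by apply: filterS shu => u /sLam[M sM]; eexists; exact: sdiff_comp sM (sLk _).
have [h' [h1 h2 _ h4 _]] := local_inverse sTh nTh.
have sdiff_y : sdiff (fun z : E => Lk (row_mx z.1 z.2)) z0 (fun z => Lk (row_mx z.1 z.2)).
  exact: sdiff_comp (sdiff_row_mx z0) (sLk _).
have y0E : Lk (row_mx z0.1 z0.2) = Lk (Lam u0).
  by rewrite -spl0 /spl /= hsubmxK.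
have near_y (T : 'rV[R]_(p + k) -> Prop) : (\forall y \near Lk (Lam u0), T y) ->
    \forall z \near z0, T (Lk (row_mx z.1 z.2)).
  by rewrite -y0E => nQ; exact: near_sdiff_comp sdiff_y nQ.
have n1 := near_y _ h2.
pose T u := Q' (u, 0) /\ hu u = chart ((chart_inv (hu u)).1, s (chart_inv (hu u)).1).
have nT : \forall u \near h' (Lk (Lam u0)), T u by rewrite h1; exact: filterI.
have n2 := near_y _ (near_sdiff_comp h4 nT).
apply: filterS2 n1 n2 => z e1; set u := h' _ in e1 * => -[Q'u e2].
have [_ cu] := hu_inv u Q'u.
have Lz : Lam u = row_mx z.1 z.2 by rewrite -[LHS]LlLk -[RHS]LlLk e1.
have zE : (chart_inv (hu u)).1 = z.
  by rewrite -splK Lz /spl row_mxKl row_mxKr -surjective_pairing.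
by rewrite -zE -e2.
Qed.

(** Moving in the direction r keeps x fixed: the point of the graph moves in y only, where
    the derivative of g vanishes. *)
Lemma value_on_graph (s : E -> 'rV[R]_n) : (\forall z \near z0, sdifferentiable s z) ->
  (\forall z \near z0, grad_y g (chart (z, s z)) = 0) ->
  \forall z \near z0, g (chart (z, s z)) = g (chart ((z.1, 0), s (z.1, 0))).
Proof.
move=> sds cs.
have : \forall z \near z0, sdifferentiable s z /\ grad_y g (chart (z, s z)) = 0 by exact: filterI.
move=> /near_normP[e e0 he]; apply/near_normP; exists e => // -[x r] hz /=.
have hx : `|x - x0| < e by rewrite (le_lt_trans _ hz)// (fst_norm_le ((x, r) - z0)).
have hr : `|r| < e.
  by have := le_lt_trans (snd_norm_le ((x, r) - z0)) hz; rewrite /= subr0.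
apply/eqP; rewrite -subr_eq0 -normr_le0.
pose G (z : E) := g (chart (z, s z)).
have := @mean_value_le R (fun t => G ((x, 0) + t *: (0, r))) (fun=> 0) 0.
have -> : ((x, 0) + 1 *: (0, r) : E) = (x, r).
  by rewrite scale1r -[LHS]/(x + 0, 0 + r) addr0 add0r.
rewrite scale0r addr0; apply=> t /andP[t0 t1]; last by rewrite normr0.
apply: is_derive_line.
have -> : ((x, 0) + t *: (0, r) : E) = (x, t *: r).
  by rewrite -[LHS]/(x + t *: 0, 0 + t *: r) scaler0 addr0 add0r.
have [|[Ls sLs] ct] := he (x, t *: r).
  rewrite -[(x, t *: r) - z0]/(x - x0, t *: r - 0) subr0 prod_normE /= gt_max hx.
  by rewrite normrZ ger0_norm// (le_lt_trans _ hr)// ler_piMl.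
have [Lg sg LgE] := sdiff_value hg (chart ((x, t *: r), s (x, t *: r))).
have sG := sdiff_comp (sdiff_comp (sdiff_pair (sdiff_id _) sLs) (sdiff_chart _)) sg.
have := sdiff_is_derive (0, r) sG => /=.
by rewrite LgE ct dot0l.
Qed.

Hypothesis Jt : J^T = J.

(** The Morse lemma is applied to the increment of g from the graph, with (x, r) as the
    parameter. Its s-gradient f vanishes on s = 0, so the strict derivative of f there
    is s |-> s A, where A is the Hessian of g in the basis C, of class C^1 because g is C^3. *)
Theorem normal_form : exists (Psi : E * 'rV[R]_n -> XY) (H : XY -> E * 'rV[R]_n),
  [/\ Psi (z0, 0) = (x0, y0), H (x0, y0) = (z0, 0),
   \forall v \near (x0, y0), sdifferentiable H v /\ Psi (H v) = v &
   \forall a \near (z0, 0 : 'rV[R]_n), [/\ sdifferentiable Psi a, H (Psi a) = a, (Psi a).1 = a.1.1 &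
     g (Psi a) = g (Psi ((a.1.1, 0), 0)) + 2^-1 * dot (a.2 *m J) a.2]].
Proof.
have [s [s0 sds hcg]] := critical_in_graph.
have cs := graph_in_critical s0 sds hcg.
have gval := value_on_graph sds cs.
pose k' (P : E * 'rV[R]_n) := g (chart (P.1, s P.1 + P.2)) - g (chart (P.1, s P.1)).
pose f (P : E * 'rV[R]_n) := grad_y g (chart (P.1, s P.1 + P.2)) *m C^T.
pose A z := C *m hess_yy g (chart (z, s z)) *m C^T.
have sc (z : E) L : sdiff s z L ->
    sdiff (fun z : E => chart (z, s z)) z (fun v => (v.1, v.2 *m Kb + L v *m C)).
  move=> sL; exact: (sdiff_comp (sdiff_pair (sdiff_id z) sL) (sdiff_chart (z, s z))).
have sq (P : E * 'rV[R]_n) L : sdiff s P.1 L ->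
    sdiff (fun P : E * 'rV[R]_n => chart (P.1, s P.1 + P.2)) P
      (fun v => (v.1.1, v.1.2 *m Kb + (L v.1 + v.2) *m C)).
  move=> sL; apply: (sdiff_comp (sdiff_pair (sdiff_fst P) _) (sdiff_chart _)).
  exact: sdiffD (sdiff_comp (sdiff_fst P) sL) (sdiff_snd P).
have k0 z : k' (z, 0) = 0 by rewrite /k' /= addr0 subrr.
have f0 : \forall z \near z0, f (z, 0) = 0.
  by apply: filterS cs => z cz; rewrite /f /= addr0 cz mul0mx.
have A0 : A z0 = J by rewrite /A s0 chart0.
have hA : \forall z \near z0, sdifferentiable A z /\ (A z)^T = A z.
  apply: filterS sds => z [L sL]; split.
    have [M sM] := sdifferentiable_hess_yy hg (chart (z, s z)).
    by eexists; exact: sdiff_mulmxr (sdiff_mulmxl C (sdiff_comp (sc z L sL) sM)).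
  by rewrite /A !trmx_mul trmxK hess_yy_sym// mulmxA.
have hk : \forall P \near (z0, 0 : 'rV[R]_n),
    exists2 L, sdiff k' P L & forall v, L (0, v) = dot (f P) v.
  have := near_fst (0 : 'rV[R]_n) sds; apply: filterS => P [L sL].
  have [M sM ME] := sdiff_value hg (chart (P.1, s P.1 + P.2)).
  have [M' sM' _] := sdiff_value hg (chart (P.1, s P.1)).
  have s1 := sdiff_comp (sq P L sL) sM.
  have s2 := sdiff_comp (sdiff_comp (sdiff_fst P) (sc P.1 L sL)) sM'.
  exists (fun v => M (v.1.1, v.1.2 *m Kb + (L v.1 + v.2) *m C)
      - M' (v.1.1, v.1.2 *m Kb + L v.1 *m C)); first exact: sdiffB s1 s2.
  move=> v /=; rewrite (sdiff_lin0 sL) add0r !mul0mx !add0r ME (sdiff_lin0 sM') subr0.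
  by rewrite /f /dot trmx_mul mulmxA.
have hf : \forall z \near z0, sdiff f (z, 0) (fun v => v.2 *m A z).
  have ncs := near_near cs; near=> z.
  have [L sL] : sdifferentiable s z by near: z.
  have cz : \forall z' \near z, grad_y g (chart (z', s z')) = 0 by near: z.
  have [M sM ME] := sdiff_gradient hg (chart (z, s z + 0)).
  have s1 := sdiff_mulmxr C^T (sdiff_comp (sq (z, 0) L sL) sM).
  apply: (sdiff_ext _ _ s1) => // v.
  have -> : (v.1.1, v.1.2 *m Kb + (L v.1 + v.2) *m C)
      = (v.1.1, v.1.2 *m Kb + L v.1 *m C) + (0, v.2 *m C) :> XY.
    by rewrite -[RHS]/(v.1.1 + 0, _ + v.2 *m C) addr0 mulmxDl addrA.
  rewrite (sdiff_linD sM) ME.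
  have -> : M (v.1.1, v.1.2 *m Kb + L v.1 *m C) = 0.
    move: sM; rewrite addr0 => sM; have s2 := sdiff_comp (sc z L sL) sM.
    exact: (sdiff_unique (sdiff_near cz s2) (sdiff_cst z 0) v.1).
  by rewrite add0r /A addr0 !mulmxA.
have [W [W0 sW sdW WE]] := parametric_morse Jt JJ A0 k0 f0 hA hk hf.
pose Phi (P : E * 'rV[R]_n) := (P.1, W P).
have sPhi : sdiff Phi (z0, 0) id.
  by apply: (sdiff_ext _ _ (sdiff_pair (sdiff_fst (z0, 0)) sW)) => // -[].
have nPhi : \forall P \near (z0, 0 : 'rV[R]_n), exists M, sdiff Phi P M.
  by apply: filterS sdW => P [M sM]; eexists; exact: sdiff_pair (sdiff_fst P) sM.
have Phi0 z : Phi (z, 0) = (z, 0) by rewrite /Phi W0.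
have [h [h1 h2 h3 h4 h5]] := local_inverse sPhi nPhi.
rewrite !Phi0 in h1 h2 h4 h5.
pose Psi a := chart ((h a).1, s (h a).1 + (h a).2).
pose tau (v : XY) := ((chart_inv v).1, (chart_inv v).2 - s (chart_inv v).1).
pose H v := Phi (tau v).
have ci0 : chart_inv (x0, y0) = (z0, 0) by rewrite -chart0 chartK.
have tau0 : tau (x0, y0) = (z0, 0) by rewrite /tau ci0 /= s0 subrr.
have nh (Q : E * 'rV[R]_n -> Prop) : (\forall P \near (z0, 0 : 'rV[R]_n), Q P) ->
    \forall a \near (z0, 0 : 'rV[R]_n), Q (h a).
  by rewrite -{1}h1 => nQ; exact: near_sdiff_comp h4 nQ.
have stau : \forall v \near (x0, y0), sdifferentiable tau v.
  have n1 : \forall z \near (chart_inv (x0, y0)).1, sdifferentiable s z by rewrite ci0.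
  have [Lc sLc] := sdifferentiable_chart_inv (x0, y0).
  have := near_sdiff_comp (sdiff_comp sLc (sdiff_fst _)) n1.
  apply: filterS => v [L sL]; have [M sM] := sdifferentiable_chart_inv v.
  have s1 := sdiff_comp sM (sdiff_fst _); have s2 := sdiff_comp sM (sdiff_snd _).
  by eexists; exact: sdiff_pair s1 (sdiffB s2 (sdiff_comp s1 sL)).
have ntau (Q : E * 'rV[R]_n -> Prop) : (\forall P \near (z0, 0 : 'rV[R]_n), Q P) ->
    \forall v \near (x0, y0), Q (tau v).
  by rewrite -tau0 => nQ; have [L sL] := nbhs_singleton stau; exact: near_sdiff_comp sL nQ.
exists Psi, H; split.
- by rewrite /Psi h1 /= s0 addr0 chart0.
- by rewrite /H tau0 Phi0.
- have n1 := ntau _ nPhi; have n2 := ntau _ h3.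
  near=> v; split.
    have [L sL] : sdifferentiable tau v by near: v.
    have [M sM] : exists M, sdiff Phi (tau v) M by near: v.
    by exists (fun w => M (L w)); exact: sdiff_comp sL sM.
  have hP : h (Phi (tau v)) = tau v by near: v.
  rewrite /Psi /H hP -[RHS]chart_invK [chart_inv v in RHS]surjective_pairing.
  by congr (chart (_, _)); rewrite [LHS]addrC; exact: subrK.
have n1 := nh _ WE; have n2 := nh _ (near_fst (0 : 'rV[R]_n) sds).
have n3 := near_fst (0 : 'rV[R]_n) gval.
have n4 : \forall a \near (z0, 0 : 'rV[R]_n), h ((a.1.1, 0), 0) = ((a.1.1, 0), 0).
  have n5 : \forall z \near z0, h (z, 0) = (z, 0).
    by have := near_base h3; apply: filterS => z; rewrite Phi0.
  have sp : sdiff (fun a : E * 'rV[R]_n => (a.1.1, 0 : 'rV[R]_k)) (z0, 0) (fun v => (v.1.1, 0)).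
    exact: sdiff_pair (sdiff_comp (sdiff_fst (z0, 0)) (sdiff_fst _)) (sdiff_cst _ _).
  exact: near_sdiff_comp sp n5.
near=> a.
have Pha : Phi (h a) = a by near: a.
have ha1 : (h a).1 = a.1 by rewrite -{2}Pha.
have ha2 : W (h a) = a.2 by rewrite -{2}Pha.
have [M sM] : exists M, sdiff h a M by near: a.
have WEa : dot (W (h a) *m J) (W (h a)) = 2 * k' (h a) by near: a.
have [L sL] : sdifferentiable s (h a).1 by near: a.
split.
- by eexists; exact: sdiff_comp sM (sq (h a) L sL).
- by rewrite /H /tau /Psi chartK /= addrAC subrr add0r -surjective_pairing.
- by rewrite /Psi /= ha1.
have -> : Psi (a.1.1, 0, 0) = chart ((a.1.1, 0), s (a.1.1, 0)).
  have e : h (a.1.1, 0, 0) = (a.1.1, 0, 0) by near: a.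
  by rewrite /Psi e /= addr0.
have <- : g (chart (a.1, s a.1)) = g (chart (a.1.1, 0, s (a.1.1, 0))) by near: a.
rewrite -ha2 WEa mulrA mulVf ?pnatr_eq0// mul1r /k' -ha1 addrC subrK.
by [].
Unshelve. all: by end_near. Qed.

End critical_graph.
(** * Morse-Bott coordinates *)

Lemma sign_mx_props (R : realType) d n (A : 'M[R]_d) (J : 'M[R]_n) :
  eigen_sign_mx A J -> J^T = J /\ J *m J = 1%:M.
Proof.
move=> [lam [lam0 _ ->]]; rewrite tr_diag_mx; split=> //.
apply/matrixP => i j; rewrite mul_diag_mx !mxE.
case: (i =P j) => [_|_]; last by rewrite !mulr0n mulr0.
by rewrite !mulr1n -expr2 sqr_sg lam0.
Qed.

Lemma open_norm_ball (R : realType) (V : normedModType R) (p : V) (e : R) :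
  open [set z | `|z - p| < e].
Proof.
rewrite openE => z /= hz; apply/near_normP; exists (e - `|z - p|); first by rewrite subr_gt0.
move=> y hy /=; rewrite (le_lt_trans (ler_distD z _ _))//.
by rewrite -ltrBrDr.
Qed.

Lemma open_preimage_sd (R : realType) (V W : normedModType R) (f : V -> W) (D : set V) (O : set W) :
  open D -> open O -> (forall z, D z -> sdifferentiable f z) -> open (D `&` f @^-1` O).
Proof.
move=> oD oO sf; rewrite openE => z [Dz Oz].
have n1 : \forall y \near z, D y by apply: open_nbhs_nbhs.
have n2 : \forall y \near f z, O y by apply: open_nbhs_nbhs.
by have := near_sdifferentiable (sf z Dz) n2; apply: filterS2 n1 => y Dy Oy; split.
Qed.

Lemma Ck_on_open (R : realType) (V W : normedModType R) (f : V -> W) (S O : set V) :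
  open O -> S `<=` O -> (forall z, O z -> sdifferentiable f z) -> Ck_on 1 S f.
Proof.
move=> oO SO sf z Sz; exists O, f; split=> //; first by split=> //; exact: SO.
exact: sdiff_Ck1.
Qed.

Theorem theorem1 (R : realType) (p d : nat) (hp : (0 < p)%N) (hd : (0 < d)%N)
  (g : 'rV[R]_p * 'rV[R]_d -> R)
  (hg : Ck 3 [set: 'rV[R]_p * 'rV[R]_d] g)
  (hMB : parametric_morse_bott g)
  (x0 : 'rV[R]_p) (y0 : 'rV[R]_d) (hcrit : aug_crit g (x0, y0))
  (A0 : 'M[R]_d) (hA0 : A0 = hess_yy g (x0, y0))
  (K : 'M[R]_d) (hK : K = kermx A0)
  (Kperp : 'M[R]_d) (hKperp : Kperp = orthocomp K)
  (B : 'M[R]_(\rank A0, d)) (hB : orthonormal_basis B Kperp)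
  (J0 : 'M[R]_(\rank A0)) (hJ0 : eigen_sign_mx A0 J0) :
  exists (U : set ('rV[R]_p * 'rV[R]_d * 'rV[R]_d))
         (V : set ('rV[R]_p * 'rV[R]_d))
         (psi : 'rV[R]_p * 'rV[R]_d * 'rV[R]_d -> 'rV[R]_p * 'rV[R]_d),
    [/\ relatively_open [set z | (z.1.2 <= K)%MS /\ (z.2 <= Kperp)%MS] U
          /\ U (x0, 0, 0),
        open_nbhs (x0, y0) V,
        diffeomorphism 1 U V psi,
        (forall x r w, U (x, r, w) -> exists y, psi (x, r, w) = (x, y))
          /\ psi (x0, 0, 0) = (x0, y0)
      & forall x r w, U (x, r, w) ->
          U (x, 0, 0) /\
          g (psi (x, r, w)) =
            g (psi (x, 0, 0)) + 2^-1 * quad_form J0 (w *m B^T)].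
Proof.
have Asym : A0^T = A0 by rewrite hA0 hess_yy_sym.
have hB' := hB; rewrite hKperp hK in hB'.
have BB : B *m B^T = 1%:M by case: hB.
pose k := \rank (kermx A0).
have [Kb [KbE Kfree KbA KbB]] : exists Kb : 'M[R]_(k, d),
    [/\ (Kb :=: K)%MS, row_free Kb, Kb *m A0 = 0 & Kb *m B^T = 0].
  exists (row_base (kermx A0)); split; first by rewrite hK; exact: eq_row_base.
  - exact: row_base_free.
  - by apply/sub_kermxP; rewrite eq_row_base.
  - exact: orthocomp_ker hB'.
have kn : (k + \rank A0 = d)%N by rewrite /k mxrank_ker subnK// rank_leq_row.
have [P1 [e1 KP1 BP1]] := ker_coordinates Kfree KbB BB kn.
have [T uT TJ] := sign_congruence KbA Kfree KbB BB kn Asym hJ0.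
have [Jt JJ] := sign_mx_props hJ0.
pose C := T *m B; pose P2 := B^T *m invmx T.
have PC : P1 *m Kb + P2 *m C = 1%:M.
  by rewrite /P2 /C mulmxA -[_ *m invmx T *m T]mulmxA mulVmx// mulmx1.
have KP2 : Kb *m P2 = 0 by rewrite /P2 mulmxA KbB mul0mx.
have CP1 : C *m P1 = 0 by rewrite /C -mulmxA BP1 mulmx0.
have CP2 : C *m P2 = 1%:M.
  by rewrite /C /P2 mulmxA -[T *m B *m B^T]mulmxA BB mulmx1 mulmxV.
have CAC : C *m hess_yy g (x0, y0) *m C^T = J0.
  by rewrite -hA0 /C trmx_mul -TJ !mulmxA.
have hM : exists2 V, open_nbhs (x0, y0) V & submanifold 2 (p + k)%N (aug_crit g `&` V).
  by have [_ /(_ _ hcrit)[V [oV _ sV]]] := hMB; exists V => //; move: sV; rewrite -hA0.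
have [Psi [H [Psi0 H0 nH nPsi]]] :=
  normal_form hg hcrit PC KP1 KP2 CP1 CP2 CAC JJ hM Jt.
pose z0 : 'rV[R]_p * 'rV[R]_k := (x0, 0).
(* pr is defined on the whole space, so that Psi o pr extends psi off the subspace
   X * K * K^perp, as the definition of a C^1 map on a subset asks. *)
pose pr (z : 'rV[R]_p * 'rV[R]_d * 'rV[R]_d) := ((z.1.1, z.1.2 *m P1), z.2 *m B^T).
pose io (a : 'rV[R]_p * 'rV[R]_k * 'rV[R]_(\rank A0)) := ((a.1.1, a.1.2 *m Kb), a.2 *m B).
pose S := [set z : 'rV[R]_p * 'rV[R]_d * 'rV[R]_d | (z.1.2 <= K)%MS /\ (z.2 <= Kperp)%MS].
have prK a : pr (io a) = a.
  by case: a => [[x r] w]; rewrite /pr /io /= -!mulmxA KP1 BB !mulmx1.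
have ioK z : S z -> io (pr z) = z.
  case: z => [[x r] w] [/= rK wK]; rewrite /pr /io /=.
  have /submxP[r' rE] : (r <= Kb)%MS by rewrite KbE.
  have /submxP[w' wE] : (w <= B)%MS by case: hB => _ ->.
  by rewrite rE wE -!mulmxA (mulmxA Kb) KP1 (mulmxA B B^T) BB !mul1mx.
have ioS a : S (io a).
  split; rewrite /io /=; first by rewrite -KbE submxMl.
  by case: hB => _ <-; rewrite submxMl.
have spr z : sdifferentiable pr z.
  eexists; apply: sdiff_pair; last exact: sdiff_mulmxr (sdiff_snd z).
  apply: sdiff_pair; first exact: sdiff_comp (sdiff_fst z) (sdiff_fst _).
  exact: sdiff_mulmxr (sdiff_comp (sdiff_fst z) (sdiff_snd _)).
have sio a : sdifferentiable io a.
  eexists; apply: sdiff_pair; last exact: sdiff_mulmxr (sdiff_snd a).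
  apply: sdiff_pair; first exact: sdiff_comp (sdiff_fst a) (sdiff_fst _).
  exact: sdiff_mulmxr (sdiff_comp (sdiff_fst a) (sdiff_snd _)).
(* Psi inverts H on D; cutting D by the preimage of the ball Om makes H a bijection onto
   Om. A ball is convenient as it contains ((x, 0), 0) along with ((x, r), w). *)
pose D := interior [set v | sdifferentiable H v /\ Psi (H v) = v].
have oD : open D by exact: open_interior.
have D0 : D (x0, y0) by [].
have [[LP sLP] _ _ _] := nbhs_singleton nPsi.
have nD : \forall a \near (z0, 0 : 'rV[R]_(\rank A0)), D (Psi a).
  by apply: (near_sdiff_comp sLP); rewrite Psi0; apply: open_nbhs_nbhs.
have [e e0 he] := (near_normP _ _).1 (filterI nPsi nD).
pose Om := [set a : 'rV[R]_p * 'rV[R]_k * 'rV[R]_(\rank A0) | `|a - (z0, 0)| < e].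
have oOm : open Om by exact: open_norm_ball.
have Om0 x r w : Om (x, r, w) -> Om (x, 0, 0).
  rewrite /Om /= -[(x, r, w) - _]/((x - x0, r - 0), w - 0) -[(x, 0, 0) - _]/((x - x0, 0 - 0), 0 - 0).
  rewrite !subr0 !prod_normE /= !normr0 !gt_max => /andP[/andP[-> _] _].
  by rewrite e0.
have DH v : D v -> sdifferentiable H v /\ Psi (H v) = v by exact: nbhs_singleton.
pose V := D `&` H @^-1` Om.
pose O := [set z | Om (pr z)].
have oO : open O.
  have -> : O = setT `&` pr @^-1` Om by rewrite setTI.
  by apply: open_preimage_sd => //; exact: openT.
have oV : open V by apply: open_preimage_sd => // v /DH[].
have PsiOm a : Om a -> [/\ sdifferentiable Psi a, H (Psi a) = a, (Psi a).1 = a.1.1,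
    g (Psi a) = g (Psi ((a.1.1, 0), 0)) + 2^-1 * dot (a.2 *m J0) a.2 & D (Psi a)].
  by move=> /he[[h1 h2 h3 h4] h5].
have pr0 x : pr (x, 0, 0) = ((x, 0), 0) by rewrite /pr /= !mul0mx.
exists (O `&` S), V, (fun z => Psi (pr z)); split.
- split; first by exists O.
  split; last by split; exact: sub0mx.
  by rewrite /O /= pr0 /Om /= subrr normr0.
- split=> //; split=> //.
  by rewrite /= H0 /Om /= subrr normr0.
- split.
  + split.
    * move=> z [Oz Sz]; have [_ h2 _ _ h5] := PsiOm _ Oz.
      by split=> //; rewrite /preimage /= h2; exact: Oz.
    * move=> z1 z2; rewrite !inE => -[/PsiOm[_ h2 _ _ _] S1] [/PsiOm[_ h2' _ _ _] S2] E.
      by rewrite -(ioK _ S1) -(ioK _ S2) -h2 -h2' E.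
    * move=> v [Dv Hv]; exists (io (H v)); last by rewrite prK; have [] := DH v Dv.
      by split; [rewrite /O /= prK|exact: ioS].
  + apply: (Ck_on_open oO) => [z []//|z Oz].
    by apply: sdifferentiable_comp (spr z) _; have [] := PsiOm _ Oz.
  + exists (fun v => io (H v)).
      by move=> z [/PsiOm[_ h2 _ _ _] Sz]; rewrite h2 ioK.
    apply: (Ck_on_open oV) => // v [/DH[sH _] _].
    by apply: sdifferentiable_comp sH _.
- split; last by rewrite pr0 Psi0.
  move=> x r w [/PsiOm[_ _ h3 _ _] _]; exists (Psi (pr (x, r, w))).2.
  by rewrite [LHS]surjective_pairing h3.
move=> x r w [Ow Sw]; split.
  split; last by split; exact: sub0mx.
  by rewrite /O /= pr0; exact: Om0 Ow.
by rewrite pr0; have [_ _ _ -> _] := PsiOm _ Ow.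
Qed.
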